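(* Let $H$ be a real Hilbert space of infinite dimension. Let $G \subset H$ be an additive subgroup of $H$ and let $\alpha : G \curvearrowright H$ be the translation action. Suppose that $G$ is sequentially weakly dense in $H$. Then $\widehat{\alpha} : G \curvearrowright (\widehat{H},\mu)$ is ergodic of type $\mathrm{III}_1$.
   Context: All Hilbert spaces are separable. $G$ is sequentially weakly dense in $H$ if every vector of $H$ is the weak limit of a sequence in $G$. Gaussian construction: $(\widehat H,\mu)$ is the (essentially unique) standard probability space equipped with a linear map $\xi\mapsto\langle\,\cdot\,,\xi\rangle$ from $H$ to real random variables such that each $\langle\,\cdot\,,\xi\rangle$ is centered Gaussian with variance $\|\xi\|^2$ and these generate the $\sigma$-algebra. For $\eta\in H$, $\omega\mapsto\omega+\eta$ denotes the nonsingular automorphism of $(\widehat H,\mu)$ with $\langle\omega+\eta,\xi\rangle=\langle\omega,\xi\rangle+\langle\eta,\xi\rangle$ a.e. for all $\xi \in H$; it pushes $\mu$ forward to $\exp(-\tfrac12\|\eta\|^2+\langle\,\cdot\,,\eta\rangle)\,\mu$. The translation action is $\alpha_\eta(\xi)=\xi+\eta$ for $\eta\in G$, and $\widehat\alpha_\eta(\omega)=\omega+\eta$. A nonsingular action $G\curvearrowright(X,\mu)$ is ergodic if every $G$-invariant function in $L^\infty(X,\mu)$ is a.e. constant; an ergodic action is of type $\mathrm{III}_1$ if its Maharam extension $g\cdot(x,t)=(g\cdot x,\ t+\log\frac{d(g^{-1}\mu)}{d\mu}(x))$ on $X\times\mathbb R$ is ergodic. *)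

(* Defs.v *)
From HB Require Import structures.
From mathcomp Require Import all_boot all_order all_algebra.
From mathcomp Require Import all_classical all_reals all_analysis.

Set Implicit Arguments.
Unset Strict Implicit.
Unset Printing Implicit Defensive.

Import Order.TTheory GRing.Theory Num.Theory.
Import numFieldNormedType.Exports.

Local Open Scope classical_set_scope.
Local Open Scope ring_scope.

Definition separable_space (T : topologicalType) : Prop :=
  exists2 D : set T, countable D & dense D.

Definition infinite_dimensional (R : realType) (H : lmodType R) : Prop :=
  forall (n : nat) (e : 'I_n -> H),
    exists x : H, forall a : 'I_n -> R, x <> \sum_(i < n) a i *: e i.

(* A real Hilbert space is a complete normed module over a real field whose   *)
(* norm is the one of the inner product dot.                                  *)
Definition hilbert_norm (R : realType) (H : completeNormedModType R)
    (dot : {dot H for idfun}) : Prop :=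
  forall x : H, `|x| ^+ 2 = dot x x.

Definition weak_limit (R : realType) (H : completeNormedModType R)
    (dot : {dot H for idfun}) (u : nat -> H) (x : H) : Prop :=
  forall y : H, dot (u n) y @[n --> \oo] --> dot x y.

Definition seq_weakly_dense (R : realType) (H : completeNormedModType R)
    (dot : {dot H for idfun}) (G : {pred H}) : Prop :=
  forall x : H, exists2 u : nat -> H, (forall n, u n \in G) & weak_limit dot u x.

(* X is Borel isomorphic to a Polish space Y. *)
Definition standard_borel (R : realType) (d : measure_display)
    (X : measurableType d) : Prop :=
  exists (Y : completePseudoMetricType R) (f : X -> Y),
    [/\ hausdorff_space Y, separable_space Y, bijective f &
        forall A : set X, measurable A <-> <<s open >> (f @` A)].

(* The law N(0, s^2). The case s = 0 is separate because the library's        *)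
(* normal_prob 0 0 is the uniform law on [0, 1] and not the point mass at 0.  *)
Definition centered_gaussian (R : realType) (s : R) : set R -> \bar R :=
  if s == 0 then \d_(0 : R) else normal_prob 0 s.

Section nonsingular_actions.
Context (R : realType) (d : measure_display) (X : measurableType d).

Definition nonsingular_automorphism (mu : probability X R)
    (f : {mfun X >-> X}) : Prop :=
  (exists2 g : {mfun X >-> X},
     (\forall x \ae mu, g (f x) = x) & (\forall x \ae mu, f (g x) = x)) /\
  (distribution mu f `<< mu /\ mu `<< distribution mu f).

(* Functions are invariant as elements of L^oo: for each g separately, the    *)
(* equality holds outside a null set that may depend on g.                    *)
Definition ergodic (m : {measure set X -> \bar R}) (V : Type) (G : {pred V})
    (act : V -> X -> X) : Prop :=
  forall f : X -> R, f \in Lfun m +oo%E ->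
    (forall g, g \in G -> \forall x \ae m, f (act g x) = f x) ->
    exists c : R, \forall x \ae m, f x = c.

(* The group V is written additively: act (- g) is the inverse of act g, and  *)
(* distribution mu (act (- g)) is the measure g^{-1} mu : A |-> mu (g A).     *)
Definition maharam (mu : probability X R) (V : zmodType)
    (act : V -> {mfun X >-> X}) (g : V) (p : X * measurableTypeR R) :
    X * measurableTypeR R :=
  let D := Radon_Nikodym
    (charge_of_finite_measure (distribution mu (act (- g)))) mu in
  (act g p.1, p.2 + ln (fine (D p.1))).

End nonsingular_actions.

(* The type of an action that is itself ergodic; ergodicity of the action is  *)
(* not repeated here.                                                         *)
Definition type_III1 (R : realType) (d : measure_display)
    (X : measurableType d) (mu : probability X R) (V : zmodType)
    (G : {pred V}) (act : V -> {mfun X >-> X}) : Prop :=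
  ergodic (mu \x @lebesgue_measure R)%E G (maharam mu act).

Section gaussian.
Context (R : realType) (H : completeNormedModType R)
  (dot : {dot H for idfun}) (d : measure_display) (X : measurableType d)
  (mu : probability X R) (W : H -> {mfun X >-> R}).

(* W xi is the random variable <. , xi>. Random variables are taken up to     *)
(* a.e. equality, and so the sigma-algebra they generate is taken up to null  *)
(* sets.                                                                      *)
Record gaussian_construction : Prop := {
  gc_standard : standard_borel R X ;
  gc_linear : forall (a : R) (xi eta : H),
    \forall w \ae mu, W (a *: xi + eta) w = a * W xi w + W eta w ;
  gc_gaussian : forall (xi : H) (A : set R), measurable A ->
    distribution mu (W xi) A = centered_gaussian `|xi| A ;
  gc_generate : forall A : set X, measurable A ->
    exists2 B : set X,
      <<s [set W xi @^-1` C | xi in [set: H] & C in measurable] >> B &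
      mu.-negligible ((A `\` B) `|` (B `\` A))
}.

(* T eta is the automorphism w |-> w + eta. *)
Definition gaussian_translation (T : H -> {mfun X >-> X}) : Prop :=
  forall eta : H, nonsingular_automorphism mu (T eta) /\
    forall xi : H, \forall w \ae mu, W xi (T eta w) = W xi w + dot eta xi.

End gaussian.

(* Main.v *)
(* Write [w g = exp(<.,g> - |g|^2/2)] for the density of the translate by [g].  For
   a bounded [f] that is invariant under the Maharam extension and for [h] of
   bounded support, let [F x = int f(x,t) h(t) dt].  By Cameron-Martin and
   invariance, [exp <z,g>] times the integral of [F exp <.,z>] is the integral of
   [f(x,t) exp <x,z> h(t + <x,g> - |g|^2/2) (w g) x], for any [g] in [G].  Take for
   [g] the terms of a weakly null sequence of [G] with norms bounded below by a large
   [s]: this exists because [H] is infinite-dimensional and [G] is weakly dense.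
   Then [h(t + <.,g> - |g|^2/2) w g] becomes weakly constant in [x], namely the
   convolution of [h] with a Gaussian of deviation at least [s], which is small in
   [L^1] when [int h = 0].  So [F] is orthogonal to all exponentials and vanishes
   whenever [int h = 0]: [f] does not depend on [t].  What is left is invariant under
   [G]; as [w (u n)] tends weakly to [w z] in [L^2] when [u n] tends weakly to [z], its
   integral against [w z] is the same for all [z] in [H], so that it is orthogonal to
   all exponentials up to its mean.  The exponentials being total, it is constant. *)
From HB Require Import structures.
Require Import Defs.
From mathcomp Require Import all_boot all_order all_algebra.
From mathcomp Require Import all_classical all_reals all_analysis.
From mathcomp Require Import measurable_realfun ess_sup_inf.
From mathcomp Require Import ring lra.

Set Implicit Arguments.
Unset Strict Implicit.
Unset Printing Implicit Defensive.

Import Order.TTheory GRing.Theory Num.Theory.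
Import numFieldNormedType.Exports HBNNSimple.
Local Open Scope classical_set_scope.
Local Open Scope ring_scope.

(** Nothing is assumed about the density of a translate, so even the Cameron-Martin formula has to
    be derived. It and all weak convergences are treated as properties of a test function: checked
    on exponentials, where everything is an explicit Gaussian integral, and preserved by linear
    combinations and by limits dominated by a Gaussian weight. The weight has to be integrable,
    which is why each such closure property carries its own [e]. The norms of the weakly null
    sequence need not converge, so neither do the Gaussians that spread [h]: the kernels are
    compared with constants that depend on [n], of which only the [L^1] size in [t] is used. This
    fixes the order of choices: the tolerance, then the deviation [s], then the sequence. The limit
    is taken at fixed [t], where the support of [h] keeps the unbounded densities [w g] below
    [exp(N - t)]. Integration over [t] needs another majorant, a Gaussian in [t]; for it the norms
    must also be bounded above, which follows from weak convergence by uniform boundedness. *)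

Section exp_estimates.
Context {R : realType}.
Implicit Types (x y a b e p q : R) (n k : nat).

Lemma normr_expR_sub1 x : `|expR x - 1| <= `|x| * expR `|x|.
Proof.
have [x0|x0] := leP 0 x.
  have := expR_ge1Dx (- x); have := expR_gt0 x; have := expR_ge1Dx x.
   rewrite !ger0_norm ?subr_ge0 -?[leLHS]expR0 ?ler_expR//.
  have := expRxMexpNx_1 x; nra.
have := expR_ge1Dx x; have e1 : expR x < 1 by rewrite expR_lt1.
rewrite ltr0_norm ?subr_lt0// ltr0_norm//.
have : 1 <= expR (- x) by rewrite -[leLHS]expR0 ler_expR; lra.
by nra.
Qed.

Lemma pow_normr_le_expR k x : `|x| ^+ k <= k`!%:R * expR `|x|.
Proof.
case: k => [|k]; first by rewrite expr0 fact0 mul1r -[leLHS]expR0 ler_expR.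
have := @expR_ge1Dxn _ `|x| k (normr_ge0 _).
rewrite -ler_pdivrMl ?ltr0n ?fact_gt0// mulrC; lra.
Qed.

Lemma mulr_normr_le_sqr e a x : 0 < e -> a * `|x| <= a ^+ 2 / (4 * e) + e * x ^+ 2.
Proof.
move=> e0; rewrite -(real_normK (num_real x)).
rewrite -subr_ge0; have -> : a ^+ 2 / (4 * e) + e * `|x| ^+ 2 - a * `|x| =
  (a / (2 * e) - `|x|) ^+ 2 * e by field; rewrite gt_eqF.
by rewrite mulr_ge0 ?sqr_ge0// ltW.
Qed.

(** The power costs one more exponential, as [|x|^k <= k! exp |x|], and completing the square
    absorbs [exp((a + 1) |x|)] into an arbitrarily small Gaussian weight at the price of [K]. *)
Lemma pow_expR_le_gauss k a e : 0 < e ->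
  exists K, forall x, `|x| ^+ k * expR (a * `|x|) <= K * expR (e * x ^+ 2).
Proof.
move=> e0; exists (k`!%:R * expR ((a + 1) ^+ 2 / (4 * e))) => x.
apply: (@le_trans _ _ (k`!%:R * expR `|x| * expR (a * `|x|))).
  by rewrite ler_wpM2r ?expR_ge0// pow_normr_le_expR.
rewrite -!mulrA ler_wpM2l// -!expRD ler_expR.
by have := @mulr_normr_le_sqr e (a + 1) x e0; lra.
Qed.

(** The difference quotient at 0 of [a -> exp(a y)] along the steps [1/(n + 1)]: this is how a
    factor [y] will be produced from exponentials. *)
Lemma cvg_expR_quotient y : (expR (y / n.+1%:R) - 1) * n.+1%:R @[n --> \oo] --> y.
Proof.
have h0 : (fun n => n.+1%:R^-1 : R) @ \oo --> (0 : R) by exact: cvg_harmonic.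
have hy : (fun n => y / n.+1%:R) @ \oo --> (0 : R).
  by rewrite -(mulr0 y); apply: cvgM h0; exact: cvg_cst.
have he : (fun n => expR (y / n.+1%:R)) @ \oo --> (1 : R).
  by have := cvg_comp _ _ hy (@continuous_expR R 0); rewrite expR0.
have hye : (fun n => y * expR (y / n.+1%:R)) @ \oo --> y.
  by rewrite -[X in _ --> X]mulr1; apply: cvgM he; exact: cvg_cst.
apply: (@squeeze_cvgr _ _ _ _ (cst y) (fun n => y * expR (y / n.+1%:R))) => //.
  apply: nearW => n /=; set h := y / _.
  have n0 : (0 : R) < n.+1%:R by rewrite ltr0n.
  have -> : y = h * n.+1%:R by rewrite /h; field; rewrite addrC natr1 gt_eqF.
  have e1 := expR_ge1Dx h; have e2 := expR_ge1Dx (- h).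
  have e3 := expRxMexpNx_1 h; have e4 := expR_gt0 h.
  apply/andP; split; first by rewrite ler_pM2r//; lra.
  by rewrite mulrAC ler_pM2r//; nra.
exact: cvg_cst.
Qed.

Lemma cvg_expR_series x : (\sum_(0 <= i < n) x ^+ i / i`!%:R) @[n --> \oo] --> expR x.
Proof.
have := @is_cvg_series_exp_coeff R x.
rewrite /expR; apply: cvg_trans => //.
Qed.

Lemma normr_exp_sum_le x n : `|\sum_(0 <= i < n) x ^+ i / i`!%:R| <= expR `|x|.
Proof.
apply: (le_trans (ler_norm_sum _ _ _)).
under eq_bigr do rewrite normrM normrX normfV normr_nat.
have nd : nondecreasing_seq (fun n => \sum_(0 <= i < n) `|x| ^+ i / i`!%:R : R).
  apply/nondecreasing_seqP => m; rewrite big_nat_recr//= lerDl.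
  by rewrite divr_ge0// exprn_ge0.
have c := @cvg_expR_series `|x|.
by rewrite -(cvg_lim _ c)//; apply: nondecreasing_cvgn_le => //; apply/cvg_ex; exists (expR `|x|).
Qed.

(** The factor [n] sends the borderline case [x = 1] to 0. Below 1, with [x = exp(- c)], the bound
    [exp y >= 1 + y^2/2] makes [n x^n] at most [2/(c^2 n)]. *)
Lemma cvg_expR_switch x : 0 < x -> expR (- (n%:R * x ^+ n)) @[n --> \oo] --> ((x < 1)%R%:R : R).
Proof.
move=> x0; have [x1|x1] := ltP x 1.
  pose c := - ln x; have c0 : 0 < c by rewrite oppr_gt0 ln_lt0 ?x0.
  have hx n : x ^+ n = expR (- (n%:R * c)).
    by rewrite /c mulrN opprK expRM_natl lnK// posrE.
  have h0 : (fun n => n.+1%:R^-1 : R) @ \oo --> (0 : R) by exact: cvg_harmonic.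
  have h1 : (fun n => 1 + - (n.+1%:R^-1 * (2 / c ^+ 2)) : R) @ \oo --> (1 : R).
    rewrite -[X in _ --> X]addr0; apply: cvgD; first exact: cvg_cst.
    rewrite -oppr0; apply: cvgN; rewrite -(mul0r (2 / c ^+ 2)).
    by apply: cvgM h0 _; exact: cvg_cst.
  rewrite -cvg_shiftS.
  apply: (@squeeze_cvgr _ _ _ _ (fun n => 1 + - (n.+1%:R^-1 * (2 / c ^+ 2))) (cst 1)) => //; last exact: cvg_cst.
  apply: nearW => n /=; apply/andP; split; last first.
    by rewrite -expR0 ler_expR oppr_le0 mulr_ge0// exprn_ge0// ltW.
  apply: le_trans (expR_ge1Dx _); rewrite lerD2l lerN2.
  rewrite hx expRN.
  have n0 : (0 : R) < n.+1%:R by rewrite ltr0n.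
  have := @expR_ge1Dxn _ (n.+1%:R * c) 1 (mulr_ge0 (ltW n0) (ltW c0)).
  have -> : 2`!%:R = 2 :> R by [].
  move: (expR_gt0 (n.+1%:R * c)); set E := expR _ => E0 hE.
  have -> : n.+1%:R^-1 * (2 / c ^+ 2) = n.+1%:R * ((n.+1%:R * c) ^+ 2 / 2)^-1 :> R.
    by field; rewrite addrC natr1 !gt_eqF.
  rewrite ler_pM2l// lef_pV2 ?posrE//; first by lra.
  by rewrite divr_gt0// exprn_gt0// mulr_gt0.
have h : expR (- n%:R) @[n --> \oo] --> (0 : R).
  have : expR (1 *- n) @[n --> \oo] --> (0 : R) by exact: cvgn_expR.
  by apply: cvg_trans; apply: near_eq_cvg; apply: nearW => n /=.
apply: (@squeeze_cvgr _ _ _ _ (cst 0) (fun n => expR (- n%:R))) => //; last exact: cvg_cst.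
apply: nearW => n /=; rewrite expR_ge0/= ler_expR lerN2 ler_peMr//.
by rewrite exprn_ege1.
Qed.

End exp_estimates.

(** * Totality of the exponentials *)

(* A class of functions on the line that contains the exponentials, and that is
   closed under linear combinations and under pointwise limits dominated by a
   Gaussian weight, contains the indicators of half-lines.  Difference quotients
   give [y^k e^(ay)], their power series give [w = e^(-d y^2)] and, iterating,
   the powers of [u = e^(-d(y-p)(y-q))], which is at least 1 exactly on [[p, q]];
   then [exp(- n u^n)] tends to the indicator of [u < 1]. *)
Section exponential_class.
Context {R : realType} (e : R) (e0 : 0 < e) (C : (R -> R) -> Prop).
Hypothesis C_lin : forall a f g, C f -> C g -> C (fun y => a * f y + g y).
Hypothesis C_dom : forall (u : nat -> R -> R) v K, (forall n, C (u n)) ->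
  (forall n y, `|u n y| <= K * expR (e * y ^+ 2)) ->
  (forall y, u n y @[n --> \oo] --> v y) -> C v.
Hypothesis C_exp : forall a, C (fun y => expR (a * y)).

Let C_ext f g : f =1 g -> C f -> C g.
Proof. by move=> /funext ->. Qed.

Let C_scale a f : C f -> C (fun y => a * f y).
Proof.
move=> Cf; have C0 : C (fun y => -1 * f y + f y) by exact: C_lin.
by apply: C_ext (C_lin a Cf (C_lin (-1) Cf Cf)) => y /=; ring.
Qed.

Let C_sum (F : nat -> R -> R) n : (forall i, C (F i)) ->
  C (fun y => \sum_(0 <= i < n) F i y).
Proof.
move=> CF; elim: n => [|n IH].
  by apply: C_ext (C_scale 0 (CF 0)) => y; rewrite big_geq// mul0r.
by apply: C_ext (C_lin 1 (CF n) IH) => y; rewrite big_nat_recr//= mul1r addrC.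
Qed.

(** Each new factor [y] is a derivative in [a]. The bounded factor [w] is carried along so that the
    statement can be reused after a Gaussian factor has been gained. *)
Let C_pow w k : (forall y, 0 <= w y <= 1) ->
  (forall a, C (fun y => w y * expR (a * y))) ->
  forall a, C (fun y => w y * y ^+ k * expR (a * y)).
Proof.
move=> w01 Cw; elim: k => [|k IH] a.
  by apply: C_ext (Cw a) => y; rewrite expr0 mulr1.
(* The difference quotient is at most [|y| exp |y|] for every [n]; hence one more power and one more
   unit in the exponent. *)
have [K hK] := @pow_expR_le_gauss R k.+1 (`|a| + 1) e e0.
apply: (@C_dom (fun n y => (w y * y ^+ k * expR (a * y)) * ((expR (y / n.+1%:R) - 1) * n.+1%:R)) _ K).
- move=> n; apply: C_ext (C_lin (- n.+1%:R) (IH a) (C_scale n.+1%:R (IH (a + n.+1%:R^-1)))) => y /=.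
  rewrite mulrDl expRD (mulrC _^-1 y); ring.
- move=> n y; apply: le_trans (hK y); rewrite !normrM (ger0_norm (expR_ge0 _)) normrX normr_nat.
  have /andP[w0 w1] := w01 y; rewrite (ger0_norm w0).
  apply: (@le_trans _ _ (1 * `|y| ^+ k * expR (`|a| * `|y|) * (`|y| * expR `|y|))); last first.
    by rewrite mul1r exprSr mulrDl mul1r expRD; lra.
  apply: ler_pM => //; first by rewrite !mulr_ge0.
    apply: ler_pM; [by rewrite mulr_ge0|by []|by rewrite ler_wpM2r|].
    by rewrite ler_expR -normrM ler_norm.
  have n0 : (0 : R) < n.+1%:R by rewrite ltr0n.
  rewrite -ler_pdivlMr//; apply: le_trans (normr_expR_sub1 _) _.
  rewrite normrM normfV normr_nat mulrAC ler_wpM2r ?invr_ge0 ?ler0n// ler_wpM2l// ler_expR.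
  by rewrite ler_piMr// invf_le1// ler1n.
- move=> y; rewrite exprSr.
  have -> : w y * (y ^+ k * y) * expR (a * y) = (w y * y ^+ k * expR (a * y)) * y by ring.
  by apply: cvgM; [exact: cvg_cst|exact: cvg_expR_quotient].
Qed.

(** Half of the admissible weight: the partial sums of the series of [exp(- d y^2)] are only bounded
    by [exp(d y^2)], and the other half has to absorb [exp(a y)]. *)
Let d := e / 2.

Let d0 : 0 < d. Proof. by rewrite /d divr_gt0. Qed.

Let C_gauss1 w : (forall y, 0 <= w y <= 1) ->
  (forall a, C (fun y => w y * expR (a * y))) ->
  forall a, C (fun y => w y * expR (- d * y ^+ 2) * expR (a * y)).
Proof.
move=> w01 Cw a; have [K hK] := @pow_expR_le_gauss R 0 `|a| d d0.
apply: (@C_dom (fun n y => \sum_(0 <= i < n) ((- d * y ^+ 2) ^+ i / i`!%:R) * (w y * expR (a * y))) _ K).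
- move=> n; apply: (C_sum (F := fun i y => (- d * y ^+ 2) ^+ i / i`!%:R * (w y * expR (a * y)))) => i.
  apply: C_ext (C_scale ((- d) ^+ i / i`!%:R) (C_pow (2 * i) w01 Cw a)) => y /=.
  by rewrite exprMn -exprM; ring.
- move=> n y; rewrite -mulr_suml 2!normrM.
  have /andP[wy0 wy1] := w01 y; rewrite (ger0_norm wy0) (ger0_norm (expR_ge0 _)).
  have := normr_exp_sum_le (- d * y ^+ 2) n; rewrite normrM normrN (gtr0_norm d0) normrX real_normK ?num_real//.
  set S := `|\sum_(_ <= _ < _) _| => hS.
  have := hK y; rewrite expr0 mul1r => hy.
  have : expR (a * y) <= K * expR (d * y ^+ 2).
    by apply: le_trans hy; rewrite ler_expR -normrM ler_norm.
  have -> : e * y ^+ 2 = d * y ^+ 2 + d * y ^+ 2 by rewrite /d; field.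
  rewrite expRD => h; have h2 : w y * expR (a * y) <= K * expR (d * y ^+ 2).
    by apply: le_trans h; rewrite ler_piMl ?expR_ge0.
  have -> : K * (expR (d * y ^+ 2) * expR (d * y ^+ 2)) =
    expR (d * y ^+ 2) * (K * expR (d * y ^+ 2)) by ring.
  by apply: ler_pM; [exact: normr_ge0|rewrite mulr_ge0 ?expR_ge0|exact: hS|exact: h2].
- move=> y; under eq_fun do rewrite -mulr_suml.
  have -> : w y * expR (- d * y ^+ 2) * expR (a * y) = expR (- d * y ^+ 2) * (w y * expR (a * y)) by ring.
  by apply: cvgM; [exact: cvg_expR_series|exact: cvg_cst].
Qed.

(** One factor [exp(- d y^2)] is gained at a time, the previous ones serving as [w]. Expanding
    [exp(- j d y^2)] at once would call for the weight [exp(j d y^2)], which is too large for large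
    [j]. *)
Let C_gauss j a : C (fun y => expR (- (j%:R * d) * y ^+ 2) * expR (a * y)).
Proof.
elim: j a => [|j IH] a.
  by apply: C_ext (C_exp a) => y; rewrite mul0r oppr0 mul0r expR0 mul1r.
have w01 y : 0 <= expR (- (j%:R * d) * y ^+ 2) <= 1.
  rewrite expR_ge0 -[leRHS]expR0 ler_expR mulNr oppr_le0 mulr_ge0 ?sqr_ge0//.
  by rewrite mulr_ge0// ltW.
apply: C_ext (C_gauss1 w01 IH a) => y /=.
by rewrite -!expRD -natr1; congr expR; ring.
Qed.

Let u p q y := expR (- (d * (y - p) * (y - q))).

Let C_upow p q n : C (fun y => u p q y ^+ n).
Proof.
apply: C_ext (C_scale (expR (- (n%:R * d * p * q))) (C_gauss n (n%:R * d * (p + q)))) => y /=.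
by rewrite /u -!expRD -expRM_natl; congr expR; ring.
Qed.

Let u_le p q y : u p q y <= expR (d * ((p - q) / 2) ^+ 2).
Proof.
rewrite /u ler_expR; rewrite -subr_ge0.
have -> : d * ((p - q) / 2) ^+ 2 - - (d * (y - p) * (y - q)) = d * (y - (p + q) / 2) ^+ 2 by field.
by rewrite mulr_ge0 ?sqr_ge0// ltW.
Qed.

Let C_itv p q : C (fun y => (~~ ((y < p) || (q < y)))%:R).
Proof.
have [pq|qp] := leP p q; last first.
  apply: C_ext (C_scale 0 (C_exp 0)) => y; rewrite mul0r.
  by have [//|py] := ltP y p; rewrite (lt_le_trans qp py) orbT.
have h1 y : 1 <= expR (e * y ^+ 2) by rewrite -[leLHS]expR0 ler_expR mulr_ge0 ?sqr_ge0// ltW.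
have C1 : C (fun=> 1) by apply: C_ext (C_exp 0) => y; rewrite mul0r expR0.
(* Since [u] is bounded, so is [n u^n] for fixed [n], and the power series of the outer exponential
   converges under a constant bound. *)
have Cu n : C (fun y => expR (- (n%:R * u p q y ^+ n))).
  set M := expR (d * ((p - q) / 2) ^+ 2).
  apply: (@C_dom (fun m y => \sum_(0 <= i < m) (- (n%:R * u p q y ^+ n)) ^+ i / i`!%:R) _ (expR (n%:R * M ^+ n))).
  - move=> m; apply: (C_sum (F := fun i y => (- (n%:R * u p q y ^+ n)) ^+ i / i`!%:R)) => i.
    apply: C_ext (C_scale ((- n%:R) ^+ i / i`!%:R) (C_upow p q (n * i))) => y.
    by rewrite -mulNr exprMn -exprM; ring.
  - move=> m y; apply: (le_trans (normr_exp_sum_le _ _)).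
    rewrite normrN normrM normr_nat normrX ger0_norm ?expR_ge0//.
    apply: (@le_trans _ _ (expR (n%:R * M ^+ n) * 1)).
      by rewrite mulr1 ler_expR ler_wpM2l// lerXn2r// ?nnegrE ?expR_ge0// u_le.
    by rewrite ler_wpM2l// expR_ge0.
  - by move=> y; exact: cvg_expR_series.
have Cu1 : C (fun y => (u p q y < 1)%R%:R).
  apply: (@C_dom (fun n y => expR (- (n%:R * u p q y ^+ n))) _ 1) => //.
  - move=> n y; rewrite mul1r (ger0_norm (expR_ge0 _)); apply: le_trans (h1 y).
    by rewrite -[leRHS]expR0 ler_expR oppr_le0 mulr_ge0// exprn_ge0// expR_ge0.
  - by move=> y; apply: cvg_expR_switch; exact: expR_gt0.
apply: C_ext (C_lin (-1) Cu1 C1) => y /=.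
have -> : (u p q y < 1) = (y < p) || (q < y).
  rewrite /u -[X in _ < X]expR0 ltr_expR oppr_lt0 -mulrA pmulr_rgt0//.
  have [yp|py] := ltP y p; first by rewrite nmulr_rgt0 ?subr_lt0//= (lt_le_trans yp pq).
  have [qy|yq] := ltP q y; first by rewrite mulr_gt0// subr_gt0// (le_lt_trans pq qy).
  by apply/negbTE; rewrite -leNgt mulr_ge0_le0 ?subr_ge0 ?subr_le0.
by case: (_ || _) => /=; ring.
Qed.

Lemma exponential_class_ray p : C (fun y => (p <= y)%R%:R).
Proof.
apply: (@C_dom (fun n y => (~~ ((y < p) || (p + n%:R < y)))%:R) _ 1).
- by move=> n; exact: C_itv.
- move=> n y; rewrite mul1r; apply: (@le_trans _ _ 1); first by case: (~~ _); rewrite ?normr1 ?normr0.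
  by rewrite -[leLHS]expR0 ler_expR mulr_ge0 ?sqr_ge0// ltW.
- move=> y; apply: cvg_near_cst.
  near=> n; have -> : (p + n%:R < y) = false.
    apply/negbTE; rewrite -leNgt addrC -lerBlDr; near: n.
    exact: nbhs_infty_ger.
  by rewrite orbF -leNgt.
Unshelve. all: by end_near. Qed.

End exponential_class.


(* Exponentials [exp(W y)] span, under linear combinations and dominated limits,
   all random variables dominated by one of them. *)
Section exponential_total.
Context {R : realType} {H : lmodType R} {d} {X : measurableType d}
  (mu : {measure set X -> \bar R}) (W : H -> {mfun X >-> R}).
Hypothesis W_lin : forall a z y, \forall w \ae mu, W (a *: z + y) w = a * W z w + W y w.
Hypothesis W_gen : forall A : set X, measurable A ->
  exists2 B : set X,
    <<s [set W xi @^-1` C | xi in [set: H] & C in measurable] >> B &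
    mu.-negligible ((A `\` B) `|` (B `\` A)).
Variable C : (X -> R) -> Prop.
Hypothesis C_lin : forall a f g, C f -> C g -> C (fun x => a * f x + g x).
Hypothesis C_ae : forall f g, C f -> measurable_fun setT g ->
  (\forall x \ae mu, f x = g x) -> C g.
(** The weight [e] may depend on [z] but not on [y] and [K], which vary while [z] is fixed in the
    proof of [C_above]. *)
Hypothesis C_dom : forall z, exists2 e, 0 < e & forall y K (u : nat -> X -> R) v,
  (forall n, C (u n)) ->
  (forall n x, `|u n x| <= K * (1 + expR (W y x) * expR (e * W z x ^+ 2))) ->
  (forall x, u n x @[n --> \oo] --> v x) -> C v.
Hypothesis C_exp : forall z, C (fun x => expR (W z x)).

Let C_ext f g : f =1 g -> C f -> C g.
Proof. by move=> /funext ->. Qed.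

Let C_scale a f : C f -> C (fun y => a * f y).
Proof.
by move=> Cf; apply: C_ext (C_lin a Cf (C_lin (-1) Cf Cf)) => y /=; ring.
Qed.

Let C_dom_exp y K (u : nat -> X -> R) v : (forall n, C (u n)) ->
  (forall n x, `|u n x| <= K * (1 + expR (W y x))) ->
  (forall x, u n x @[n --> \oo] --> v x) -> C v.
Proof.
move=> Cu uK uv; have [e e0 dom] := C_dom y; apply: (dom y `|K| u) => // n x.
apply: (le_trans (uK n x)); apply: (@le_trans _ _ (`|K| * (1 + expR (W y x)))).
  by rewrite ler_wpM2r ?ler_norm// addr_ge0// expR_ge0.
rewrite ler_wpM2l// lerD2l ler_peMr ?expR_ge0//.
by rewrite -[leLHS]expR0 ler_expR mulr_ge0 ?sqr_ge0// ltW.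
Qed.

Let above (s : seq (H * R)) (x : X) := all (fun zp => zp.2 <= W zp.1 x) s.

Let measurable_above s : measurable_fun setT (fun x => (above s x)%:R : R).
Proof.
elim: s => [|[z p] s IH]; first exact: measurable_cst.
have -> : (fun x => (above ((z, p) :: s) x)%:R : R) =
    (fun x => \1_(W z @^-1` `[p, +oo[) x * (above s x)%:R).
  apply/funext => x; rewrite indicE /above /=.
  have -> : (x \in W z @^-1` `[p, +oo[%classic) = (p <= W z x).
    by apply/idP/idP; rewrite inE /= in_itv/= andbT.
  by rewrite -natrM mulnb.
apply: measurable_funM => //; apply: measurable_indic.
by rewrite -[X in measurable X]setTI; exact: measurable_funPT.
Qed.

(** Half-space conditions are added one at a time: the earlier ones and [exp(W y)] are frozen into
    [psi], and [exponential_class_ray] is applied in the variable [W z]. The induction runs over all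
    [y] because [psi exp(a W z)] is a.e. the same expression at [a z + y]. *)
Let C_above s y : C (fun x => (above s x)%:R * expR (W y x)).
Proof.
elim: s y => [|[z p] s IH] y.
  by apply: C_ext (C_exp y) => x; rewrite mul1r.
have [e e0 dom] := C_dom z.
pose psi x : R := (above s x)%:R * expR (W y x).
have psi0 x : 0 <= psi x by rewrite mulr_ge0 ?expR_ge0.
have psile x : psi x <= expR (W y x).
  by rewrite ler_piMl ?expR_ge0//; case: (above s x).
pose C' (g : R -> R) := C (fun x => psi x * g (W z x)).
suff : C' (fun t => (p <= t)%R%:R).
  apply: C_ext => x; rewrite /psi /above/=.
  by case: (p <= W z x) => /=; rewrite ?mulr1 ?mulr0 ?mul0r.
apply: (@exponential_class_ray R e e0).
- move=> a f g Cf Cg; apply: C_ext (C_lin a Cf Cg) => x /=; ring.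
- move=> u v K Cu uK uv; apply: (dom y `|K| (fun n x => psi x * u n (W z x))) => //.
    move=> n x; rewrite normrM (ger0_norm (psi0 x)).
    have hk := uK n (W z x); have := psile x; have := psi0 x.
    set E := expR (W y x) => h0 h1; set G := expR (e * _).
    have G0 : 0 <= G by exact: expR_ge0.
    apply: (@le_trans _ _ (E * (`|K| * G))).
      apply: ler_pM => //; apply: le_trans hk _.
      by rewrite ler_wpM2r// ler_norm.
    by rewrite mulrCA ler_wpM2l// lerDr.
  by move=> x; apply: cvgM; [exact: cvg_cst|exact: uv].
- move=> a; apply: (C_ae (IH (a *: z + y))).
    apply: measurable_funM; first by apply: measurable_funM; [exact: measurable_above|exact: measurableT_comp].
    by apply: measurableT_comp => //; exact: measurable_funM.
  apply: filterS (W_lin a z y) => x ->; rewrite expRD /psi; ring.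
Qed.

Let C_cst1 : C (fun=> 1).
Proof.
apply: (C_ae (C_exp 0)) => //.
have := W_lin (-1) 0 0; apply: filterS => x.
by rewrite scaler0 addr0 mulN1r addNr => ->; rewrite expR0.
Qed.

Let C_above1 s : C (\1_[set x | above s x]).
Proof.
apply: (C_ae (C_above s 0)).
  have -> : \1_[set x | above s x] = (fun x => (above s x)%:R : R).
    by apply/funext => x; rewrite indicE mem_setE.
  exact: measurable_above.
have := W_lin (-1) 0 0; apply: filterS => x.
by rewrite scaler0 addr0 mulN1r addNr indicE mem_setE => ->; rewrite expR0 mulr1.
Qed.

Let rays := [set [set x | above s x] | s in [set: seq (H * R)]].

(** Concatenating lists intersects the sets, so [rays] is a pi-system and it is enough to check a
    Dynkin system; its countable disjoint unions are limits of functions bounded by 1. *)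
Let C_rays B : <<s rays >> B -> C \1_B.
Proof.
have rI : setI_closed rays.
  move=> _ _ [s _ <-] [t _ <-]; exists (s ++ t) => //.
  by apply/seteqP; split => x /=; rewrite /above all_cat => /andP.
rewrite -(setI_closed_g_dynkin_g_sigma_algebra rI).
suff dC : dynkin [set A | C \1_A].
  by move=> /(_ _ (conj dC _)); apply => _ [s _ <-] /=; exact: C_above1.
split.
- by rewrite /= indicT.
- move=> A CA /=; apply: C_ext (C_lin (-1) CA C_cst1) => x /=.
  by rewrite !indicE in_setC; case: (x \in A) => /=; ring.
- move=> F tF CF /=.
  have Cn n : C (\1_(\big[setU/set0]_(i < n) F i)).
    elim: n => [|n IH].
      by apply: C_ext (C_scale 0 C_cst1) => x; rewrite big_ord0 indic0 mul0r.
    apply: C_ext (C_lin 1 (CF n) IH) => x /=.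
    rewrite big_ord_recr/= !indicE mul1r in_setU.
    have [xF|] := boolP (x \in F n); last by rewrite add0r orbF.
    have -> : x \in \big[setU/set0]_(i < n) F i = false.
      apply/negbTE/negP; rewrite inE -bigcup_mkord => -[k /= kn Fkx].
      have := tF k n I I; rewrite inE in xF => /(_ (ex_intro _ x (conj Fkx xF))) kE.
      by rewrite kE ltnn in kn.
    by rewrite addr0.
  apply: (C_dom_exp (y := 0) (K := 1) Cn).
    move=> n x; rewrite mul1r indicE normr_nat.
    by apply: (@le_trans _ _ 1); [case: (_ \in _)|rewrite lerDl expR_ge0].
  move=> x; have [xF|xF] := pselect ((\bigcup_k F k) x).
    apply: cvg_near_cst; have [k _ Fkx] := xF.
    near=> n; rewrite !indicE [in RHS]mem_set// mem_set//.
    by rewrite -bigcup_mkord; exists k => //=; near: n; exact: nbhs_infty_gt.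
  apply: cvg_near_cst; apply: nearW => n; rewrite !indicE.
  rewrite [in RHS]memNset// memNset// -bigcup_mkord => -[k _ Fkx].
  by apply: xF; exists k.
Unshelve. all: by end_near. Qed.

Let cylinders_rays :
  <<s [set W xi @^-1` D | xi in [set: H] & D in measurable] >> `<=` <<s rays >>.
Proof.
apply: smallest_sub; first exact: smallest_sigma_algebra.
move=> _ [z _ [D mD <-]].
pose Wz : g_sigma_algebraType rays -> R := W z.
have mW : measurable_fun setT Wz.
  apply: (measurability (@RGenCInfty.G R)); first exact: RGenCInfty.measurableE.
  move=> _ [_ [p ->] <-]; rewrite setTI; apply: sub_sigma_algebra.
  exists [:: (z, p)] => //; apply/seteqP; split => x /=; rewrite /above /= andbT in_itv/= andbT//.
by have := mW measurableT D mD; rewrite setTI.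
Qed.

Let C_indic A : measurable A -> C \1_A.
Proof.
move=> mA; have [B sB nAB] := W_gen mA.
apply: (C_ae (C_rays (cylinders_rays sB))).
  exact: measurable_indic.
case: nAB => N [mN N0 subN]; exists N; split => // x /= xAB; apply: subN => /=.
apply: contrapT => /not_orP[] /not_andP hA /not_andP hB; apply: xAB.
rewrite !indicE; congr (nat_of_bool _)%:R; apply/idP/idP; rewrite !inE => h.
  by case: hB => // /contrapT.
by case: hA => // /contrapT.
Qed.

(** Increasing simple functions stay below [phi], so the bound on [phi] dominates the whole
    approximation. *)
Let C_nneg (phi : X -> R) y K : measurable_fun setT phi -> (forall x, 0 <= phi x) ->
  (forall x, phi x <= K * (1 + expR (W y x))) -> C phi.
Proof.
move=> mphi phi0 phiK.
have mE : measurable_fun setT (EFin \o phi) by exact/measurable_EFinP.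
have [g [ndg gphi]] := approximation measurableT mE
  (fun t _ => (phi0 t : (0 <= (phi t)%:E)%E)).
have gc x : (g n : X -> R) x @[n --> \oo] --> phi x.
  by have := gphi x I => /fine_cvg; apply.
have gle n x : (g n : X -> R) x <= phi x.
  have nd : nondecreasing_seq (fun n => (g n : X -> R) x).
    by move=> m k mk; have /lefP/(_ x) := ndg _ _ mk; exact.
  rewrite -(cvg_lim _ (gc x))//; apply: nondecreasing_cvgn_le => //.
  by apply/cvg_ex; exists (phi x).
apply: (C_dom_exp (y := y) (K := `|K|) (u := fun n => (g n : X -> R))) => //.
  move=> n; have -> : (g n : X -> R) = fun x =>
      \sum_(r <- finmap.enum_fset (fset_set (range (g n : X -> R)))) r * \1_((g n : X -> R) @^-1` [set r]) x.
    apply/funext => x; rewrite (fimfunE (g n) x) fsbig_finite//.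
  elim: (finmap.enum_fset _) => [|r s IH].
    by apply: C_ext (C_scale 0 C_cst1) => x; rewrite big_nil mul0r.
  apply: C_ext (C_lin r (@C_indic ((g n : X -> R) @^-1` [set r]) _) IH) => [x|]; first by rewrite big_cons.
  by rewrite -[X in measurable X]setTI; exact: measurable_funPT.
move=> n x; rewrite ger0_norm//; apply: (le_trans (gle n x)); apply: (le_trans (phiK x)).
by rewrite ler_wpM2r ?ler_norm// addr_ge0// expR_ge0.
Qed.

Lemma exponential_total (phi : X -> R) y K : measurable_fun setT phi ->
  (forall x, `|phi x| <= K * (1 + expR (W y x))) -> C phi.
Proof.
move=> mphi phiK.
have hp : C (fun x => Num.max (phi x) 0).
  apply: (@C_nneg _ y K); first exact: measurable_maxr.
    by move=> x; rewrite le_max lexx orbT.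
  by move=> x; apply: le_trans (phiK x); rewrite ge_max ler_norm normr_ge0.
have hn : C (fun x => Num.max (- phi x) 0).
  apply: (@C_nneg _ y K); first by apply: measurable_maxr => //; exact: measurableT_comp.
    by move=> x; rewrite le_max lexx orbT.
  by move=> x; apply: le_trans (phiK x); rewrite ge_max -normrN ler_norm normr_ge0.
apply: C_ext (C_lin (-1) hn hp) => x /=.
by have [?|?] := leP (phi x) 0; have [?|?] := leP (- phi x) 0; lra.
Qed.

End exponential_total.

(** * Real-valued integrals: domination, a.e. equality, square integrability *)

Section integral_toolbox.
Context d (X : measurableType d) (R : realType) (m : {measure set X -> \bar R}).
Implicit Types f g : X -> R.
Local Notation integr f := (m.-integrable setT (EFin \o f)).

Lemma dominated_Rintegrable f g : measurable_fun setT f ->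
  (forall x, `|f x| <= g x) -> integr g -> integr f.
Proof.
move=> mf fg ig; apply: le_integrable ig => //; first exact/measurable_EFinP.
by move=> x _; rewrite /= lee_fin (le_trans (fg x)) ?ler_norm.
Qed.

Lemma Rintegrable_measurable f : integr f -> measurable_fun setT f.
Proof. by move=> /measurable_int/measurable_EFinP. Qed.

Lemma RintegrableD f g : integr f -> integr g -> integr (fun x => f x + g x).
Proof. by move=> fi gi; have := integrableD measurableT fi gi. Qed.

Lemma RintegrableZ a f : integr f -> integr (fun x => a * f x).
Proof. by move=> fi; have := integrableZl measurableT a fi. Qed.

Lemma RintegrableB f g : integr f -> integr g -> integr (fun x => f x - g x).
Proof. by move=> fi gi; have := integrableB measurableT fi gi. Qed.

Lemma dominated_cvg_Rintegral (u : nat -> X -> R) (v g : X -> R) :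
  (forall n, measurable_fun setT (u n)) -> integr g ->
  (forall n x, `|u n x| <= g x) -> (forall x, u n x @[n --> \oo] --> v x) ->
  [/\ measurable_fun setT v, integr v &
      \int[m]_x u n x @[n --> \oo] --> \int[m]_x v x].
Proof.
move=> mu gi ug uv.
have muE n : measurable_fun setT (EFin \o u n) by exact/measurable_EFinP.
have uvE x : setT x -> (EFin \o u n) x @[n --> \oo] --> (EFin \o v) x.
  by move=> _; apply: cvg_EFin; [exact: nearW|exact: uv].
have mv : measurable_fun setT v.
  by apply/measurable_EFinP; exact: (emeasurable_fun_cvg _ _ muE uvE).
have vg x : `|v x| <= g x.
  have h : `|u n x| @[n --> \oo] --> `|v x| by apply: cvg_norm; exact: uv.
  rewrite -(cvg_lim _ h)//; apply: limr_le; first by apply/cvg_ex; exists `|v x|.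
  by apply: nearW => n; exact: ug.
have vi : integr v by exact: dominated_Rintegrable gi.
split => //; apply: fine_cvg; rewrite fineK; last exact: integrable_fin_num.
apply: (@dominated_cvg _ _ _ m setT measurableT (fun n => EFin \o u n) (EFin \o v) (EFin \o g)) => //.
by move=> n x _; rewrite /= lee_fin.
Qed.

Lemma ae_eq_Rintegral f g : measurable_fun setT f -> measurable_fun setT g ->
  (\forall x \ae m, f x = g x) -> \int[m]_x f x = \int[m]_x g x.
Proof.
move=> mf mg fg; congr fine; apply: ae_eq_integral => //; [exact/measurable_EFinP..|].
by apply: filterS fg => x /= -> _.
Qed.

Lemma ae_eq_Rintegrable f g : measurable_fun setT g ->
  (\forall x \ae m, f x = g x) -> integr f -> integr g.
Proof.
move=> mg fg fi; have mf := Rintegrable_measurable fi.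
have /integrableP[_ h] := fi; apply/integrableP; split; first exact/measurable_EFinP.
rewrite (@ae_eq_integral _ _ _ m setT (fun x => `|(EFin \o f) x|%E))//.
- by apply: measurableT_comp => //; exact/measurable_EFinP.
- by apply: measurableT_comp => //; exact/measurable_EFinP.
- by apply: filterS fg => x /= -> _.
Qed.

Lemma Rintegral_ge0_eq0 f : (forall x, 0 <= f x) -> integr f ->
  \int[m]_x f x = 0 -> \forall x \ae m, f x = 0.
Proof.
move=> f0 fi f00.
have : ae_eq m setT (EFin \o f) (cst 0%E).
  apply/ae_eq_integral_abs => //; first exact: measurable_int fi.
  under eq_integral do rewrite /= (ger0_norm (f0 _)).
  have := integrable_fin_num measurableT fi; move: f00; rewrite /Rintegral.
  by move=> h hf; rewrite -(fineK hf) h.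
by apply: filterS => x /= /(_ I) [].
Qed.

Lemma sqr_RintegrableM f g : measurable_fun setT f -> measurable_fun setT g ->
  integr (fun x => f x ^+ 2) -> integr (fun x => g x ^+ 2) ->
  integr (fun x => f x * g x).
Proof.
move=> mf mg fi gi; apply: dominated_Rintegrable (RintegrableD fi gi).
  exact: measurable_funM.
move=> x; rewrite normrM -(real_normK (num_real (f x))) -(real_normK (num_real (g x))).
move: `|f x| `|g x| => a b; nra.
Qed.

Lemma sqr_RintegrableD f g a : measurable_fun setT f -> measurable_fun setT g ->
  integr (fun x => f x ^+ 2) -> integr (fun x => g x ^+ 2) ->
  integr (fun x => (a * f x + g x) ^+ 2).
Proof.
move=> mf mg fi gi.
apply: dominated_Rintegrable (RintegrableD (RintegrableZ (2 * a ^+ 2) fi) (RintegrableZ 2 gi)).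
  by apply: measurable_funX; apply: measurable_funD => //; exact: measurable_funM.
move=> x; rewrite ger0_norm ?sqr_ge0//; move: (f x) (g x) => b c.
rewrite -subr_ge0; have -> : 2 * a ^+ 2 * b ^+ 2 + 2 * c ^+ 2 - (a * b + c) ^+ 2 = (a * b - c) ^+ 2 by ring.
exact: sqr_ge0.
Qed.

(** A weighted Young inequality in place of Cauchy-Schwarz: [e] is free, to be tuned so that a
    merely bounded factor contributes little. *)
Lemma normr_Rintegral_mul_le f g e : 0 < e ->
  measurable_fun setT f -> measurable_fun setT g ->
  integr (fun x => f x ^+ 2) -> integr (fun x => g x ^+ 2) ->
  `|\int[m]_x (f x * g x)| <= e^-1 * \int[m]_x f x ^+ 2 + e * \int[m]_x g x ^+ 2.
Proof.
move=> e0 mf mg fi gi; have fgi := sqr_RintegrableM mf mg fi gi.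
apply: (le_trans (le_normr_Rintegral _ fgi)) => //.
rewrite -!RintegralZl// -RintegralD//; [|exact: RintegrableZ..].
apply: le_Rintegral => //.
- by have := integrable_norm fgi.
- by apply: RintegrableD; exact: RintegrableZ.
- move=> x _; rewrite normrM -(real_normK (num_real (f x))) -(real_normK (num_real (g x))).
  move: (normr_ge0 (f x)) (normr_ge0 (g x)); move: `|f x| `|g x| => a b a0 b0.
  rewrite -subr_ge0; have -> : e^-1 * a ^+ 2 + e * b ^+ 2 - a * b = e^-1 * (a - e * b) ^+ 2 + a * b.
    by field; rewrite gt_eqF.
  have ei : 0 <= e^-1 by rewrite invr_ge0 ltW.
  by apply: addr_ge0; apply: mulr_ge0 => //; exact: sqr_ge0.
Qed.

End integral_toolbox.

(** The masses determine the density up to a null set, so [p] agrees a.e. with the Radon-Nikodym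
    derivative, for which the change of variables holds. *)
Lemma ge0_integral_density d (X : measurableType d) (R : realType)
    (nu : {finite_measure set X -> \bar R}) (m : {sigma_finite_measure set X -> \bar R})
    (p : X -> R) (f : X -> \bar R) :
  nu `<< m -> measurable_fun setT p ->
  (forall A, measurable A -> nu A = \int[m]_(x in A) (p x)%:E)%E ->
  (forall x, 0 <= f x)%E -> measurable_fun setT f ->
  (\int[nu]_x f x = \int[m]_x (f x * (p x)%:E))%E.
Proof.
move=> num mp nup f0 mf.
rewrite -(Radon_Nikodym_SigmaFinite.change_of_variables num)//.
have mRN : measurable_fun setT (Radon_Nikodym_SigmaFinite.f nu m).
  exact: (measurable_int _ (Radon_Nikodym_SigmaFinite.f_integrable num)).
have mpE : measurable_fun setT (EFin \o p) by exact/measurable_EFinP.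
apply: ae_eq_integral => //; [exact: emeasurable_funM..|].
apply: ae_eqe_mul2l; apply: integral_ae_eq => //.
  exact: Radon_Nikodym_SigmaFinite.f_integrable.
by move=> A _ mA; rewrite -nup// -Radon_Nikodym_SigmaFinite.f_integral.
Qed.

(** * Weak convergence in [L^2] tested on exponentials *)

Section weak_convergence.
Context {R : realType} {H : lmodType R} {d} {X : measurableType d}
  (mu : probability X R) (W : H -> {mfun X >-> R}).
Hypothesis W_lin : forall a z y, \forall w \ae mu, W (a *: z + y) w = a * W z w + W y w.
Hypothesis W_gen : forall A : set X, measurable A ->
  exists2 B : set X,
    <<s [set W xi @^-1` C | xi in [set: H] & C in measurable] >> B &
    mu.-negligible ((A `\` B) `|` (B `\` A)).
Local Notation integr f := (mu.-integrable setT (EFin \o f)).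
Hypothesis W_sqr : forall z, exists2 e, 0 < e & forall y K,
  integr (fun x => (K * (1 + expR (W y x) * expR (e * W z x ^+ 2))) ^+ 2).

Let integrable_sqr_exp z : integr (fun x => expR (W z x) ^+ 2).
Proof.
have [e e0 h] := W_sqr z; apply: dominated_Rintegrable (h z 1).
  by apply: measurable_funX; exact: measurableT_comp.
move=> x; rewrite ger0_norm ?sqr_ge0// lerXn2r ?nnegrE ?mul1r ?addr_ge0 ?mulr_ge0 ?expR_ge0//.
apply: (@le_trans _ _ (expR (W z x) * expR (e * W z x ^+ 2))); last by rewrite lerDr.
by rewrite ler_peMr ?expR_ge0// -[leLHS]expR0 ler_expR mulr_ge0 ?sqr_ge0// ltW.
Qed.

(** The test functions for which the pairings converge are closed under dominated limits: domination
    by a square-integrable weight gives convergence in [L^2], and the [k n] are bounded in [L^2], so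
    the pairings with [u j] approximate those with [v] uniformly in [n]. *)
Lemma weak_cvg_exponential (k : nat -> X -> R) (l : X -> R) (B : R) :
  (forall n, measurable_fun setT (k n)) -> measurable_fun setT l ->
  (forall n, integr (fun x => k n x ^+ 2)) -> integr (fun x => l x ^+ 2) ->
  (forall n, \int[mu]_x k n x ^+ 2 <= B) ->
  (forall z, \int[mu]_x (expR (W z x) * k n x) @[n --> \oo] -->
             \int[mu]_x (expR (W z x) * l x)) ->
  forall (phi : X -> R) y K, measurable_fun setT phi ->
    (forall x, `|phi x| <= K * (1 + expR (W y x))) ->
    \int[mu]_x (phi x * k n x) @[n --> \oo] --> \int[mu]_x (phi x * l x).
Proof.
move=> mk ml ki li kB hexp phi y K mphi phiK.
pose C (f : X -> R) := [/\ measurable_fun setT f, integr (fun x => f x ^+ 2) &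
  \int[mu]_x (f x * k n x) @[n --> \oo] --> \int[mu]_x (f x * l x)].
suff [] : C phi by [].
apply: (@exponential_total R H d X mu W W_lin W_gen C _ _ _ _ phi y K) => //.
- move=> a f g [mf fi fc] [mg gi gc]; split.
  + by apply: measurable_funD => //; exact: measurable_funM.
  + exact: sqr_RintegrableD.
  + have split_int (h : X -> R) : measurable_fun setT h -> integr (fun x => h x ^+ 2) ->
        \int[mu]_x ((a * f x + g x) * h x) = a * \int[mu]_x (f x * h x) + \int[mu]_x (g x * h x).
      move=> mh hi; have fh := sqr_RintegrableM mf mh fi hi; have gh := sqr_RintegrableM mg mh gi hi.
      rewrite -RintegralZl// -RintegralD//; last exact: RintegrableZ.
      by apply: eq_Rintegral => x _; rewrite mulrDl mulrA.
    rewrite split_int//; under eq_fun do rewrite split_int//.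
    by apply: cvgD => //; apply: cvgM => //; exact: cvg_cst.
- move=> f g [mf fi fc] mg fg; split => //.
  + apply: ae_eq_Rintegrable fi; first exact: measurable_funX.
    by apply: filterS fg => x ->.
  + have eqi (h : X -> R) : measurable_fun setT h -> \int[mu]_x (g x * h x) = \int[mu]_x (f x * h x).
      move=> mh; apply: ae_eq_Rintegral; [exact: measurable_funM..|].
      by apply: filterS fg => x ->.
    by rewrite eqi//; under eq_fun do rewrite eqi//.
- move=> z; have [e e0 hP] := W_sqr z; exists e => // y' K' u v Cu uP uv.
  set P := fun x => K' * (1 + expR (W y' x) * expR (e * W z x ^+ 2)) in uP.
  have Pi : integr (fun x => P x ^+ 2) := hP y' K'.
  have mu_ n : measurable_fun setT (u n) by case: (Cu n).
  have iu n : integr (fun x => u n x ^+ 2) by case: (Cu n).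
  have mv : measurable_fun setT v.
    apply/measurable_EFinP; apply: (@emeasurable_fun_cvg _ _ _ setT (fun n => EFin \o u n)).
      by move=> n; exact/measurable_EFinP.
    by move=> x _; apply: cvg_EFin; [exact: nearW|exact: uv].
  have vP x : `|v x| <= P x.
    have h : `|u n x| @[n --> \oo] --> `|v x| by apply: cvg_norm; exact: uv.
    rewrite -(cvg_lim _ h)//; apply: limr_le; first by apply/cvg_ex; exists `|v x|.
    by apply: nearW => n; exact: uP.
  have iv : integr (fun x => v x ^+ 2).
    apply: dominated_Rintegrable Pi; first exact: measurable_funX.
    by move=> x; rewrite normrX lerXn2r ?nnegrE// (le_trans _ (vP x)).
  split => //.
  have [||||_ _ vu0] := @dominated_cvg_Rintegral _ X R mu (fun n x => (v x - u n x) ^+ 2) (fun=> 0)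
    (fun x => 4 * P x ^+ 2) _ _ _ _.
    move=> n; apply: measurable_funX; exact: measurable_funB.
    exact: RintegrableZ.
    move=> n x; rewrite normrX.
    have -> : 4 * P x ^+ 2 = (P x + P x) ^+ 2 by ring.
    rewrite lerXn2r ?nnegrE// ?addr_ge0 ?(le_trans _ (vP x))//.
    by apply: (le_trans (ler_normB _ _)); apply: lerD.
    move=> x; have -> : (0 : R) = (v x - v x) ^+ 2 by rewrite subrr expr0n.
    by under eq_fun do rewrite expr2; rewrite expr2; apply: cvgM; (apply: cvgB; [exact: cvg_cst|exact: uv]).
  rewrite Rintegral_cst// mul0r in vu0.
  have mvu n : measurable_fun setT (fun x => v x - u n x) by exact: measurable_funB.
  have ivu n : integr (fun x => (v x - u n x) ^+ 2).
    apply: (@dominated_Rintegrable _ _ _ _ _ (fun x => (-1 * u n x + v x) ^+ 2)).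
    + exact: measurable_funX.
    + by move=> x; rewrite ger0_norm ?sqr_ge0// mulN1r addrC.
    + exact: sqr_RintegrableD.
  have [B' B'0 [kB' lB']] : exists2 B', 0 < B' & (forall n, \int[mu]_x k n x ^+ 2 <= B') /\
      \int[mu]_x l x ^+ 2 <= B'.
    have l0 : 0 <= \int[mu]_x l x ^+ 2 by apply: Rintegral_ge0 => x _; exact: sqr_ge0.
    have k0 : 0 <= \int[mu]_x k 0%N x ^+ 2 by apply: Rintegral_ge0 => x _; exact: sqr_ge0.
    have B0 := le_trans k0 (kB 0%N).
    exists (B + \int[mu]_x l x ^+ 2 + 1); first by rewrite ltr_wpDl// addr_ge0.
    by split => [n|]; [have := kB n|]; lra.
  apply/cvgrPdist_le => eta eta0.
  (* With this [c] both terms of the Young inequality are at most [eta / 6], once the squared [L^2]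
     distance from [u j] to [v] is at most [c eta / 6]. *)
  pose c := eta / (6 * B'); have c0 : 0 < c by rewrite divr_gt0// mulr_gt0.
  have [j _ hj] : \forall n \near \oo, `|\int[mu]_x (v x - u n x) ^+ 2| <= c * eta / 6.
    by apply: (cvgr0Pnorm_le _).1 => //; rewrite divr_gt0// mulr_gt0.
  have {hj}hj := hj j (leqnn j).
  have split_int (h : X -> R) : measurable_fun setT h -> integr (fun x => h x ^+ 2) ->
     \int[mu]_x h x ^+ 2 <= B' ->
     `|\int[mu]_x (v x * h x) - \int[mu]_x (u j x * h x)| <= eta / 3.
    move=> mh hi hB; rewrite -RintegralB//; [|exact: sqr_RintegrableM..].
    have -> : \int[mu]_x (v x * h x - u j x * h x) = \int[mu]_x ((v x - u j x) * h x).
      by apply: eq_Rintegral => x _; rewrite mulrBl.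
    apply: (le_trans (normr_Rintegral_mul_le c0 _ _ _ _)) => //.
    have -> : eta / 3 = c^-1 * (c * eta / 6) + c * B'.
      by rewrite /c; field; rewrite !gt_eqF.
    apply: lerD; last by rewrite ler_pM2l.
    by rewrite ler_pM2l ?invr_gt0//; apply: le_trans hj; rewrite ler_norm.
  have [_ _ cj] := Cu j; have eta3 : 0 < eta / 3 by rewrite divr_gt0.
  move/cvgrPdist_le : cj => /(_ _ eta3); apply: filterS => n hn.
  have h1 := split_int _ (mk n) (ki n) (kB' n); have h2 := split_int _ ml li lB'.
  move: h1 h2 hn; rewrite !ler_norml; lra.
- move=> z; split; [exact: measurableT_comp|exact: integrable_sqr_exp|exact: hexp].
Qed.

(** The constant sequence [t] has the same pairings with exponentials as 0, hence also the same
    pairing with the bounded function [t] itself, so that its square integrates to 0. *)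
Lemma exponential_separating (t : X -> R) (M : R) : measurable_fun setT t ->
  (forall x, `|t x| <= M) -> (forall z, \int[mu]_x (expR (W z x) * t x) = 0) ->
  \forall x \ae mu, t x = 0.
Proof.
move=> mt tM t0.
have ti : integr (fun x => t x ^+ 2).
  apply: (@dominated_Rintegrable _ _ _ _ _ (fun=> M ^+ 2)); first exact: measurable_funX.
    by move=> x; rewrite normrX lerXn2r ?nnegrE// (le_trans _ (tM x)).
  exact: finite_measure_integrable_cst.
have M0 x : 0 <= M := le_trans (normr_ge0 _) (tM x).
have tt : \int[mu]_x (t x * t x) @[n --> \oo] --> \int[mu]_x (t x * 0).
  apply: (@weak_cvg_exponential (fun=> t) (fun=> 0) (\int[mu]_x t x ^+ 2) _ _ _ _ _ _ t 0 M) => //.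
  - by under eq_fun do rewrite expr0n; exact: (finite_measure_integrable_cst mu 0).
  - move=> z; rewrite t0; under eq_Rintegral do rewrite mulr0.
    by rewrite Rintegral_cst// mul0r; exact: cvg_cst.
  - by move=> x; rewrite (le_trans (tM x))// ler_peMr ?lerDl ?expR_ge0// (M0 x).
have : \int[mu]_x t x ^+ 2 = 0.
  transitivity (\int[mu]_x (t x * 0)); last first.
    by under eq_Rintegral do rewrite mulr0; rewrite Rintegral_cst// mul0r.
  by rewrite -(cvg_lim _ tt)// lim_cst.
move=> /(Rintegral_ge0_eq0 (fun x => sqr_ge0 (t x)) ti).
by apply: filterS => x /eqP; rewrite sqrf_eq0 => /eqP.
Qed.

End weak_convergence.

(** * Gaussian random variables and the Cameron-Martin formula *)

Section gaussian_density.
Context {R : realType}.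
Implicit Types (a s x m : R).

Lemma normal_pdf_expRE m s x : s != 0 ->
  normal_pdf m s x = normal_peak s * expR (- (x - m) ^+ 2 / (2 * s ^+ 2)).
Proof.
by move=> s0; rewrite normal_pdfE//= /normal_fun -[s ^+ 2 *+ 2]mulr_natl.
Qed.

Lemma normal_pdf_tilt a m s x : s != 0 ->
  expR (a * x) * normal_pdf m s x =
  expR (a * m + a ^+ 2 * s ^+ 2 / 2) * normal_pdf (m + a * s ^+ 2) s x.
Proof.
move=> s0; rewrite !normal_pdf_expRE// mulrCA [RHS]mulrCA; congr (_ * _).
by rewrite -!expRD; congr expR; field.
Qed.

Lemma normal_pdf_shift m s x c : s != 0 -> normal_pdf m s (x + c) = normal_pdf (m - c) s x.
Proof.
by move=> s0; rewrite !normal_pdf_expRE//; have -> : x + c - m = x - (m - c) by ring.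
Qed.

Lemma normal_peak_double s : 0 < s -> normal_peak s = 2 * normal_peak (2 * s).
Proof.
move=> s0; rewrite /normal_peak.
have -> : (2 * s) ^+ 2 * pi *+ 2 = 2 ^+ 2 * (s ^+ 2 * pi *+ 2).
  by rewrite exprMn -mulrA mulrnAr.
by rewrite sqrtrM ?sqr_ge0// sqrtr_sqr ger0_norm// invfM mulrA divff ?mul1r.
Qed.

(** Doubling the deviation frees [1/(2 s^2) - 1/(8 s^2) = 3/(8 s^2)] in the exponent and halves the
    peak, whence the factor 2. *)
Lemma normal_pdf_widen e s x : 0 < s -> e <= 3 / (8 * s ^+ 2) ->
  expR (e * x ^+ 2) * normal_pdf 0 s x <= 2 * normal_pdf 0 (2 * s) x.
Proof.
move=> s0 es; rewrite !normal_pdf_expRE// ?gt_eqF// ?mulr_gt0// (normal_peak_double s0).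
rewrite -mulrA mulrCA ler_wpM2l// mulrCA ler_wpM2l ?normal_peak_ge0//.
rewrite -expRD ler_expR !subr0.
have -> : - x ^+ 2 / (2 * (2 * s) ^+ 2) = 3 / (8 * s ^+ 2) * x ^+ 2 + - x ^+ 2 / (2 * s ^+ 2).
  by field; rewrite gt_eqF.
by rewrite lerD2r ler_wpM2r// sqr_ge0.
Qed.

Lemma dominated_lebesgue_integrable (f g : R -> R) : measurable_fun setT f ->
  (forall x, `|f x| <= g x) -> (@lebesgue_measure R).-integrable setT (EFin \o g) ->
  (@lebesgue_measure R).-integrable setT (EFin \o f).
Proof. exact: (@dominated_Rintegrable _ (measurableTypeR R) R (@lebesgue_measure R) f g). Qed.

Lemma Rintegral_normal_pdf m s : \int[@lebesgue_measure R]_x normal_pdf m s x = 1.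
Proof. by rewrite /Rintegral integral_normal_pdf. Qed.

End gaussian_density.

Lemma Rintegral_probability_cst (R : realType) d (X : measurableType d)
  (mu : probability X R) (c : R) : \int[mu]_x c = c.
Proof. by rewrite /Rintegral integral_cst//= probability_setT mule1. Qed.

Section gaussian_family.
Context (R : realType) (H : completeNormedModType R)
  (dot : {dot H for idfun}) (hdot : hilbert_norm dot)
  (d : measure_display) (X : measurableType d) (mu : probability X R)
  (W : H -> {mfun X >-> R}) (hW : gaussian_construction mu W).
Local Notation integr f := (mu.-integrable setT (EFin \o f)).
Local Notation lambda := (@lebesgue_measure R).

Lemma dotC x y : dot x y = dot y x.
Proof. by rewrite hermC expr0 mul1r. Qed.

Lemma sqr_normD x y : `|x + y| ^+ 2 = `|x| ^+ 2 + 2 * dot x y + `|y| ^+ 2.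
Proof.
rewrite !hdot linearDl !linearDr /= (dotC y x); ring.
Qed.

Lemma W0 : \forall x \ae mu, W 0 x = 0.
Proof.
have := gc_linear hW (-1) 0 0; apply: filterS => x.
by rewrite scaler0 addr0 mulN1r addNr.
Qed.

Lemma WZ a z : \forall x \ae mu, W (a *: z) x = a * W z x.
Proof.
have := gc_linear hW a z 0; apply: filterS2 W0 => x h0.
by rewrite addr0 h0 addr0.
Qed.

Lemma WD z y : \forall x \ae mu, W (z + y) x = W z x + W y x.
Proof.
by have := gc_linear hW 1 z y; apply: filterS => x; rewrite scale1r mul1r.
Qed.

Let law_ge0 z (f : R -> R) : `|z| != 0 -> measurable_fun setT f -> (forall x, 0 <= f x) ->
  (\int[mu]_x (f (W z x))%:E = \int[lambda]_x (f x * normal_pdf 0 `|z| x)%:E)%E.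
Proof.
move=> z0 mf f0; have mWz : @measurable_fun _ _ X (measurableTypeR R) setT (W z).
  have mW : measurable_fun setT (W z) by exact: measurable_funPT.
  by move=> mD Y mY; exact: (mW mD Y mY).
(* [normal_prob] lives on [measurableTypeR R], a different display from [R]. *)
pose V : {mfun X >-> measurableTypeR R} := HB.pack (W z : X -> measurableTypeR R)
  (isMeasurableFun.Build _ _ X (measurableTypeR R) (W z) mWz).
have mfE : @measurable_fun _ _ (measurableTypeR R) _ setT (EFin \o f) by exact/measurable_EFinP.
have fE0 (x : measurableTypeR R) : (0 <= (EFin \o f) x)%E by rewrite lee_fin.
have <- := @ge0_integral_distribution _ _ _ (measurableTypeR R) _ mu V (EFin \o f) mfE fE0.
transitivity (\int[normal_prob 0 `|z|]_x (f x)%:E)%E.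
  have E A : measurable A -> A `<=` setT -> distribution mu V A = normal_prob 0 `|z| A.
    move=> mA _; transitivity (distribution mu (W z) A) => //.
    by rewrite (gc_gaussian hW)// /centered_gaussian (negbTE z0).
  have := @eq_measure_integral _ (measurableTypeR R) R setT (normal_prob 0 `|z|) (distribution mu V) (EFin \o f) E.
  exact.
rewrite (@ge0_integral_density _ _ _ (normal_prob 0 `|z|) lambda (normal_pdf 0 `|z|))//.
- exact: normal_prob_dominates.
- exact: measurable_normal_pdf.
Qed.

(** Positive and negative parts reduce to nonnegative functions. The degenerate law at [|z| = 0] has
    no density and is handled through [norm0_W]. *)
Lemma gaussian_law z (f : R -> R) : `|z| != 0 -> measurable_fun setT f ->
  lambda.-integrable setT (EFin \o (fun x => f x * normal_pdf 0 `|z| x)) ->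
  integr (fun x => f (W z x)) /\
  \int[mu]_x f (W z x) = \int[lambda]_x (f x * normal_pdf 0 `|z| x).
Proof.
move=> z0 mf fi; have mp := @measurable_normal_pdf R 0 `|z|.
have ge0 (g : R -> R) : measurable_fun setT g -> (forall x, 0 <= g x) -> (forall x, g x <= `|f x|) ->
    [/\ integr (fun x => g (W z x)),
      lambda.-integrable setT (EFin \o (fun x => g x * normal_pdf 0 `|z| x)) &
      \int[mu]_x g (W z x) = \int[lambda]_x (g x * normal_pdf 0 `|z| x)].
  move=> mg g0 gf.
  have gi : lambda.-integrable setT (EFin \o (fun x => g x * normal_pdf 0 `|z| x)).
    apply: dominated_lebesgue_integrable (integrable_norm fi); first exact: measurable_funM.
    by move=> x /=; rewrite !normrM ler_wpM2r// ger0_norm.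
  split => //; last by rewrite /Rintegral law_ge0.
  apply/integrableP; split; first by apply/measurable_EFinP; exact: measurableT_comp.
  under eq_integral do rewrite /= ger0_norm//.
  rewrite law_ge0//; case/integrableP : gi => _.
  by under eq_integral do rewrite /= ger0_norm ?mulr_ge0 ?normal_pdf_ge0//.
have [] := @ge0 (fun x => Num.max (f x) 0).
- exact: measurable_maxr.
- by move=> x; rewrite le_max lexx orbT.
- by move=> x; rewrite ge_max ler_norm normr_ge0.
move=> p1 p2 p3; have [] := @ge0 (fun x => Num.max (- f x) 0).
- by apply: measurable_maxr => //; exact: measurableT_comp.
- by move=> x; rewrite le_max lexx orbT.
- by move=> x; rewrite ge_max -normrN ler_norm normr_ge0.
move=> n1 n2 n3.
have fE x : f x = Num.max (f x) 0 - Num.max (- f x) 0.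
  by have [?|?] := leP (f x) 0; have [?|?] := leP (- f x) 0; lra.
split.
  have := RintegrableB p1 n1; congr (_.-integrable _ _).
  by apply/funext => x /=; rewrite -fE.
transitivity (\int[mu]_x (Num.max (f (W z x)) 0 - Num.max (- f (W z x)) 0)).
  by apply: eq_Rintegral => x _; rewrite -fE.
rewrite RintegralB// p3 n3 -RintegralB//.
by apply: eq_Rintegral => x _; rewrite -mulrBl -fE.
Qed.

Lemma norm0_W z : `|z| = 0 -> \forall x \ae mu, W z x = 0.
Proof. by move=> /normr0_eq0 ->; exact: W0. Qed.

Lemma gaussian_mgf a z : integr (fun x => expR (a * W z x)) /\
  \int[mu]_x expR (a * W z x) = expR (a ^+ 2 * `|z| ^+ 2 / 2).
Proof.
have [z0|z0] := eqVneq `|z| 0.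
  have h : \forall x \ae mu, 1 = expR (a * W z x).
    by apply: filterS (norm0_W z0) => x ->; rewrite mulr0 expR0.
  have m1 : measurable_fun setT (fun x => expR (a * W z x)).
    by apply: measurableT_comp => //; exact: measurable_funM.
  split; first by apply: ae_eq_Rintegrable h _ => //; exact: finite_measure_integrable_cst.
  rewrite -(@ae_eq_Rintegral _ _ _ mu (fun=> 1))//.
  by rewrite Rintegral_probability_cst z0 expr0n/= mulr0 mul0r expR0.
have E : (fun x => expR (a * x) * normal_pdf 0 `|z| x) =
    (fun x => expR (a ^+ 2 * `|z| ^+ 2 / 2) * normal_pdf (a * `|z| ^+ 2) `|z| x).
  by apply/funext => x; rewrite normal_pdf_tilt// mulr0 !add0r.
have [|//|h1 h2] := @gaussian_law z (fun x => expR (a * x)) z0.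
- by apply: measurableT_comp => //; exact: measurable_funM.
- by rewrite E; apply: RintegrableZ; exact: integrable_normal_pdf.
split=> //; rewrite h2 E RintegralZl//; last exact: integrable_normal_pdf.
by rewrite Rintegral_normal_pdf mulr1.
Qed.

Lemma integrable_expW z : integr (fun x => expR (W z x)).
Proof.
have [h _] := gaussian_mgf 1 z; move: h; congr (_.-integrable _ _).
by apply/funext => x /=; rewrite mul1r.
Qed.

Lemma Rintegral_expW z : \int[mu]_x expR (W z x) = expR (`|z| ^+ 2 / 2).
Proof.
have [_] := gaussian_mgf 1 z; rewrite expr1n mul1r => <-.
by apply: eq_Rintegral => x _; rewrite mul1r.
Qed.

Lemma integrable_gauss_weight z : exists2 e, 0 < e & integr (fun x => expR (e * W z x ^+ 2)).
Proof.
have [z0|z0] := eqVneq `|z| 0.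
  exists 1 => //; have h : \forall x \ae mu, 1 = expR (1 * W z x ^+ 2).
    by apply: filterS (norm0_W z0) => x ->; rewrite expr0n mulr0 expR0.
  apply: ae_eq_Rintegrable h _; last exact: finite_measure_integrable_cst.
  by apply: measurableT_comp => //; apply: measurable_funM => //; exact: measurable_funX.
have zp : 0 < `|z| by rewrite lt0r z0 /=.
exists (3 / (8 * `|z| ^+ 2)); first by rewrite divr_gt0// mulr_gt0// exprn_gt0.
have mf : measurable_fun setT (fun x : R => expR (3 / (8 * `|z| ^+ 2) * x ^+ 2)).
  by apply: measurableT_comp => //; apply: measurable_funM => //; exact: measurable_funX.
have [||//] := @gaussian_law z (fun x => expR (3 / (8 * `|z| ^+ 2) * x ^+ 2)) z0 => //.
apply: (@dominated_lebesgue_integrable _ _ (fun x => 2 * normal_pdf 0 (2 * `|z|) x)).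
- by apply: measurable_funM => //; exact: measurable_normal_pdf.
- by move=> x; rewrite ger0_norm ?mulr_ge0 ?expR_ge0 ?normal_pdf_ge0// normal_pdf_widen.
- by apply: RintegrableZ; exact: integrable_normal_pdf.
Qed.

(** The quarter comes from [(1 + a b)^2 <= 2 + 2 (a^4 + b^4)], which separates the exponential from
    the Gaussian weight at the cost of fourth powers. *)
Lemma gaussian_weight_sqr z : exists2 e, 0 < e & forall y K,
  integr (fun x => (K * (1 + expR (W y x) * expR (e * W z x ^+ 2))) ^+ 2).
Proof.
have [e e0 he] := integrable_gauss_weight z; exists (e / 4); first by rewrite divr_gt0.
move=> y K; have [hy _] := gaussian_mgf 4 y.
apply: (@dominated_Rintegrable _ _ _ _ _ (fun x =>
  2 * K ^+ 2 + (2 * K ^+ 2) * (expR (4 * W y x) + expR (e * W z x ^+ 2)))).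
- apply: measurable_funX; apply: measurable_funM => //; apply: measurable_funD => //.
  apply: measurable_funM; apply: measurableT_comp => //.
  by apply: measurable_funM => //; exact: measurable_funX.
- move=> x; rewrite ger0_norm ?sqr_ge0//.
  have -> : expR (4 * W y x) = expR (W y x) ^+ 4 by rewrite -expRM_natl.
  have -> : expR (e * W z x ^+ 2) = expR (e / 4 * W z x ^+ 2) ^+ 4.
    by rewrite -expRM_natl; congr expR; field.
  move: (expR (W y x)) (expR (e / 4 * _)) => a b.
  rewrite -subr_ge0; have -> : 2 * K ^+ 2 + 2 * K ^+ 2 * (a ^+ 4 + b ^+ 4) - (K * (1 + a * b)) ^+ 2 =
    K ^+ 2 * ((1 - a * b) ^+ 2 + (a ^+ 2 - b ^+ 2) ^+ 2 + (a ^+ 2) ^+ 2 + (b ^+ 2) ^+ 2) by ring.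
  by rewrite mulr_ge0 ?sqr_ge0// !addr_ge0// sqr_ge0.
- apply: RintegrableD; first exact: finite_measure_integrable_cst.
  by apply: RintegrableZ; exact: RintegrableD.
Qed.

Definition W_weak_cvg := weak_cvg_exponential (gc_linear hW) (gc_generate hW) gaussian_weight_sqr.

Definition W_separating := exponential_separating (gc_linear hW) (gc_generate hW) gaussian_weight_sqr.

Section translation.
Variable T : H -> {mfun X >-> X}.
Hypothesis hT : gaussian_translation dot mu W T.

Lemma ae_translate g (P : X -> Prop) : (\forall x \ae mu, P x) -> \forall x \ae mu, P (T g x).
Proof.
have [[_ [dom _]] _] := hT g; move=> [N [mN N0 PN]].
exists (T g @^-1` N); split.
- by rewrite -[X in measurable X]setTI; exact: measurable_funPT.
- by apply: (dom N) => // A mA AN; apply/eqP; rewrite -measure_le0 -N0 le_measure// inE.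
- by move=> x /= Px; apply: PN.
Qed.

(** On [exp(W z)] both sides are moment generating functions and agree because [|z + g|^2] expands;
    totality of the exponentials does the rest. Integrability of both integrands is part of the
    class, since it has to survive the dominated limits. *)
Lemma cameron_martin g (phi : X -> R) y K : measurable_fun setT phi ->
  (forall x, `|phi x| <= K * (1 + expR (W y x))) ->
  [/\ integr (fun x => phi (T g x)),
      integr (fun x => phi x * expR (W g x - `|g| ^+ 2 / 2)) &
      \int[mu]_x phi (T g x) = \int[mu]_x (phi x * expR (W g x - `|g| ^+ 2 / 2))].
Proof.
move=> mphi phiK; set q := fun x => expR (W g x - `|g| ^+ 2 / 2).
have mq : measurable_fun setT q by apply: measurableT_comp => //; exact: measurable_funB.
have qi2 : integr (fun x => q x ^+ 2).
  have [h _] := gaussian_mgf 2 g; have := RintegrableZ (expR (- `|g| ^+ 2)) h.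
  congr (_.-integrable _ _); apply/funext => x /=.
  by rewrite /q -expRM_natl -expRD; congr (expR _)%:E; field.
pose C (f : X -> R) := [/\ measurable_fun setT f, integr (fun x => f (T g x)),
  integr (fun x => f x * q x) & \int[mu]_x f (T g x) = \int[mu]_x (f x * q x)].
suff [] : C phi by [].
apply: (@exponential_total R H d X mu W (gc_linear hW) (gc_generate hW) C _ _ _ _ phi y K) => //.
- move=> a f h [mf f1 f2 f3] [mh h1 h2 h3].
  have E : (fun x => (a * f x + h x) * q x) = (fun x => a * (f x * q x) + h x * q x).
    by apply/funext => x; ring.
  split; first by apply: measurable_funD => //; exact: measurable_funM.
  + by apply: RintegrableD => //; exact: RintegrableZ.
  + by rewrite E; apply: RintegrableD => //; exact: RintegrableZ.
  + by rewrite E !RintegralD ?RintegralZl// ?f3 ?h3//; exact: RintegrableZ.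
- move=> f h [mf f1 f2 f3] mh fh.
  have fhT := ae_translate g fh.
  have mfT : measurable_fun setT (fun x => f (T g x)) by exact: measurableT_comp.
  have mhT : measurable_fun setT (fun x => h (T g x)) by exact: measurableT_comp.
  have fhq : \forall x \ae mu, f x * q x = h x * q x by apply: filterS fh => x ->.
  split => //.
  + exact: ae_eq_Rintegrable fhT f1.
  + by apply: ae_eq_Rintegrable fhq f2; exact: measurable_funM.
  + rewrite -(ae_eq_Rintegral mfT mhT fhT) f3.
    by apply: ae_eq_Rintegral => //; exact: measurable_funM.
(* Half of the weight is given up because the majorant must also be integrable after translation,
   where [(W z + <g,z>)^2 <= 2 (W z)^2 + 2 <g,z>^2]. *)
- move=> z; have [e e0 hP] := gaussian_weight_sqr z; exists (e / 2); first by rewrite divr_gt0.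
  move=> y' K' u v Cu uP uv.
  set P := fun x => K' * (1 + expR (W y' x) * expR (e / 2 * W z x ^+ 2)) in uP.
  have mP : measurable_fun setT P.
    apply: measurable_funM => //; apply: measurable_funD => //.
    apply: measurable_funM; apply: measurableT_comp => //.
    by apply: measurable_funM => //; exact: measurable_funX.
  have Pi2 : integr (fun x => P x ^+ 2).
    apply: dominated_Rintegrable (hP y' K'); first exact: measurable_funX.
    move=> x; rewrite ger0_norm ?sqr_ge0// !exprMn ler_wpM2l ?sqr_ge0//.
    rewrite lerXn2r ?nnegrE ?addr_ge0 ?mulr_ge0 ?expR_ge0// lerD2l ler_wpM2l ?expR_ge0// ler_expR.
    by rewrite ler_wpM2r ?sqr_ge0//; lra.
  have PTi : integr (fun x => P (T g x)).
    pose c := expR (dot g y') * expR (e * dot g z ^+ 2).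
    have Bi : integr (fun x => `|K'| * (1 + c * (1 * (1 + expR (W y' x) * expR (e * W z x ^+ 2))) ^+ 2)).
      apply: RintegrableZ; apply: RintegrableD; first exact: finite_measure_integrable_cst.
      by apply: RintegrableZ.
    have hPT : \forall x \ae mu, `|P (T g x)| <=
        `|K'| * (1 + c * (1 * (1 + expR (W y' x) * expR (e * W z x ^+ 2))) ^+ 2).
      have h1 := (hT g).2 y'; have h2 := (hT g).2 z; apply: filterS2 h1 h2 => x h1 h2.
      rewrite /P normrM ler_wpM2l// ger0_norm ?addr_ge0 ?mulr_ge0 ?expR_ge0// lerD2l h1 h2.
      rewrite expRD.
      have swap (s t r : R) : s * t * r = t * (s * r) by rewrite mulrCA mulrA mulrC mulrA.
      rewrite swap /c -[leRHS]mulrA ler_wpM2l ?expR_ge0//.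
      have h3 : e / 2 * (W z x + dot g z) ^+ 2 <= e * dot g z ^+ 2 + e * W z x ^+ 2.
        rewrite -subr_ge0.
        have -> : e * dot g z ^+ 2 + e * W z x ^+ 2 - e / 2 * (W z x + dot g z) ^+ 2 =
          e / 2 * (W z x - dot g z) ^+ 2 by field.
        by rewrite mulr_ge0 ?sqr_ge0// divr_ge0// ltW.
      apply: (@le_trans _ _ (expR (W y' x) * (expR (e * dot g z ^+ 2) * expR (e * W z x ^+ 2)))).
        by rewrite ler_wpM2l ?expR_ge0// -expRD ler_expR.
      rewrite mulrCA ler_wpM2l ?expR_ge0// mul1r.
      by move: (expR_ge0 (W y' x)) (expR_ge0 (e * W z x ^+ 2)); move: (expR (W y' x)) (expR (e * _)) => s t s0 t0; nra.
    apply/integrableP; split; first by apply/measurable_EFinP; exact: measurableT_comp.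
    case/integrableP : Bi => mB; apply: le_lt_trans.
    apply: ae_ge0_le_integral => //.
    + by apply: measurableT_comp => //; apply/measurable_EFinP; exact: measurableT_comp.
    + exact: measurableT_comp.
    + by apply: filterS hPT => x h _ /=; rewrite lee_fin (le_trans h)// ler_norm.
  have mu_ n : measurable_fun setT (u n) by case: (Cu n).
  have [||||mv uTi uTc] := @dominated_cvg_Rintegral _ X R mu (fun n x => u n (T g x)) (fun x => v (T g x)) (fun x => P (T g x)) => //.
    by move=> n; exact: measurableT_comp.
  have [||||mv' uqi uqc] := @dominated_cvg_Rintegral _ X R mu (fun n x => u n x * q x) (fun x => v x * q x) (fun x => P x * q x).
    by move=> n; exact: measurable_funM.
    exact: sqr_RintegrableM.
    by move=> n x; rewrite normrM (ger0_norm (expR_ge0 _)) ler_wpM2r ?expR_ge0.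
    by move=> x; apply: cvgM => //; exact: cvg_cst.
  split => //.
  + apply/measurable_EFinP; apply: (@emeasurable_fun_cvg _ _ _ setT (fun n => EFin \o u n)).
      by move=> n; exact/measurable_EFinP.
    by move=> x _; apply: cvg_EFin; [exact: nearW|exact: uv].
  + rewrite -(cvg_lim _ uTc)// -(cvg_lim _ uqc)//; congr (lim (_ @ \oo)).
    by apply/funext => n; case: (Cu n).
- move=> z; have mz : measurable_fun setT (fun x => expR (W z x)) by exact: measurableT_comp.
  have E1 : \forall x \ae mu, expR (dot g z) * expR (W z x) = expR (W z (T g x)).
    by apply: filterS ((hT g).2 z) => x ->; rewrite -expRD addrC.
  have E2 : \forall x \ae mu, expR (- (`|g| ^+ 2 / 2)) * expR (W (z + g) x) = expR (W z x) * q x.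
    by apply: filterS (WD z g) => x ->; rewrite /q -!expRD; congr expR; ring.
  have i1 := RintegrableZ (expR (dot g z)) (integrable_expW z).
  have i2 := RintegrableZ (expR (- (`|g| ^+ 2 / 2))) (integrable_expW (z + g)).
  have m1 : measurable_fun setT (fun x => expR (W z (T g x))) by exact: (measurableT_comp mz).
  have m2 : measurable_fun setT (fun x => expR (W z x) * q x) by exact: measurable_funM.
  split => //.
  + exact: ae_eq_Rintegrable E1 i1.
  + exact: ae_eq_Rintegrable E2 i2.
  + rewrite -(ae_eq_Rintegral (Rintegrable_measurable i1) m1 E1).
    rewrite -(ae_eq_Rintegral (Rintegrable_measurable i2) m2 E2).
    rewrite !RintegralZl//; [|exact: integrable_expW..].
    rewrite !Rintegral_expW -!expRD sqr_normD (dotC g z); by congr expR; field.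
Qed.

End translation.
End gaussian_family.

(** * Weakly null sequences in the group *)

Section weak_sequences.
Context (R : realType) (H : completeNormedModType R)
  (dot : {dot H for idfun}) (hdot : hilbert_norm dot).

Lemma dot0l y : dot 0 y = 0.
Proof. by rewrite -(scale0r (0 : H)) linearZl_LR /= mul0r. Qed.

Lemma dot0r y : dot y 0 = 0.
Proof. by rewrite (dotC dot) dot0l. Qed.

Lemma norm_dot_le x y : `|dot x y| <= `|x| * `|y|.
Proof.
have [->|y0] := eqVneq y 0.
  by rewrite dot0r normr0 mulr_ge0.
have yp : 0 < `|y| ^+ 2 by rewrite exprn_gt0// normr_gt0.
pose t := dot x y / `|y| ^+ 2.
have : 0 <= `|x + (- t) *: y| ^+ 2 by exact: sqr_ge0.
rewrite (sqr_normD hdot) linearZr /= normrZ exprMn normrN real_normK ?num_real//.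
have -> : `|x| ^+ 2 + 2 * (- t * dot x y) + t ^+ 2 * `|y| ^+ 2 =
  `|x| ^+ 2 - dot x y ^+ 2 / `|y| ^+ 2 by rewrite /t; field; rewrite normr_eq0.
rewrite subr_ge0 ler_pdivrMr// -exprMn -(real_normK (num_real (dot x y))).
by rewrite ler_sqr ?nnegrE ?mulr_ge0.
Qed.

Lemma weak_limitN u x : weak_limit dot u x -> weak_limit dot (fun n => - u n) (- x).
Proof.
by move=> h y; rewrite linearNl; under eq_fun do rewrite linearNl; apply: cvgN; exact: h.
Qed.

Lemma weak_limitD u v x y : weak_limit dot u x -> weak_limit dot v y ->
  weak_limit dot (fun n => u n + v n) (x + y).
Proof.
move=> hu hv z; rewrite linearDl; under eq_fun do rewrite linearDl.
by apply: cvgD; [exact: hu|exact: hv].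
Qed.

Lemma weak_limitMn u x k : weak_limit dot u x -> weak_limit dot (fun n => u n *+ k) (x *+ k).
Proof.
move=> h; elim: k => [|k IH]; last by under eq_fun do rewrite mulrS; rewrite mulrS; exact: weak_limitD.
move=> y; have -> : (fun n => dot (u n *+ 0) y) = fun=> 0.
  by apply/funext => n; rewrite mulr0n dot0l.
by rewrite mulr0n dot0l; exact: cvg_cst.
Qed.

(** Uniform boundedness for the functionals [dot (u n)], whose bound on the unit ball is read off at
    the unit vector along [u n]. *)
Lemma weak_limit_bounded u x : weak_limit dot u x -> exists M, forall n, `|u n| <= M.
Proof.
move=> ux; pose F : set (H -> R^o) := [set f | exists n, f = dot (u n)].
have hF f : F f -> bounded_fun_norm f /\ linear f.
  move=> [n ->]; split; last first.
    by move=> a y z; rewrite linearPr.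
  move=> r; exists (`|u n| * r) => y yr; apply: (le_trans (norm_dot_le _ _)).
  by rewrite ler_wpM2l.
have bF : pointwise_bounded F.
  move=> y; have : cvgn (fun n => dot (u n) y : R^o) by apply/cvg_ex; exists (dot x y); exact: ux.
  move=> /cvg_seq_bounded [M [_ hM]]; exists (M + 1) => f [n ->].
  by apply: hM => //; rewrite ltrDl.
have [M hM] := Banach_Steinhauss hF bF 1; exists M => n.
have [->|u0] := eqVneq (u n) 0.
  rewrite normr0; have := hM _ (ex_intro _ 0%N erefl) 0; rewrite normr0 => /(_ ler01).
  exact: le_trans.
have up : 0 < `|u n| by rewrite normr_gt0.
have := hM _ (ex_intro _ n erefl) (`|u n|^-1 *: u n).
rewrite normrZ normfV normr_id mulVf ?normr_eq0// lexx => /(_ isT).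
rewrite linearZr /= -hdot expr2 mulrA mulVf ?normr_eq0// mul1r.
by rewrite normr_id.
Qed.

Lemma orthogonal_projection (e : nat -> H) n x : exists a : nat -> R,
  forall i, (i < n)%N -> dot (x - \sum_(j < n) a j *: e j) (e i) = 0.
Proof.
elim: n x => [|n IH] x; first by exists (fun=> 0).
have [a ha] := IH x; have [b hb] := IH (e n).
set x' := x - _ in ha; set p := e n - _ in hb.
pose c := dot x' p / dot p p.
have hc : dot x' p = c * dot p p.
  (* The family [e] may be linearly dependent: then the residual [p] of [e n] can vanish, and the
     identity reads [0 = 0]. *)
  have [p0|p0] := eqVneq (dot p p) 0; last by rewrite /c divfK.
  have -> : p = 0 by apply/eqP; rewrite -normr_eq0 -sqrf_eq0 hdot p0.
  by rewrite !dot0r mulr0.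
pose a' i := if i == n then c else a i - c * b i.
exists a'.
have -> : x - \sum_(j < n.+1) a' j *: e j = x' - c *: p.
  rewrite big_ord_recr/= {2}/a' eqxx /x' /p scalerBr scaler_sumr.
  have -> : \sum_(i < n) a' i *: e i = \sum_(i < n) a i *: e i - \sum_(i < n) c *: (b i *: e i).
    rewrite -sumrB; apply: eq_bigr => i _.
    by rewrite /a' ltn_eqF// scalerBl scalerA.
  by rewrite !opprD !opprK -!addrA; congr (_ + (_ + _)); rewrite addrC.
have perp i : (i < n)%N -> dot (x' - c *: p) (e i) = 0.
  by move=> i_n; rewrite linearBl linearZl_LR /= ha// hb// mulr0 subrr.
move=> i; rewrite ltnS leq_eqVlt => /orP[/eqP ->|]; last exact: perp.
have -> : e n = p + \sum_(j < n) b j *: e j by rewrite /p subrK.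
rewrite linearDr /= linear_sumr /= big1 ?addr0; last first.
  by move=> j _; rewrite linearZr /= perp// mulr0.
by rewrite linearBl linearZl_LR /= hc subrr.
Qed.

Section infinite_dimension.
Hypothesis hsep : separable_space H.
Hypothesis hinf : infinite_dimensional H.

Lemma unit_orthogonal (e : nat -> H) n : exists2 x, `|x| = 1 &
  forall i, (i < n)%N -> dot x (e i) = 0.
Proof.
have [x hx] := hinf (fun i : 'I_n => e i); have [a ha] := orthogonal_projection e n x.
set y := x - _ in ha; have y0 : y != 0.
  by rewrite subr_eq0; apply/eqP; exact: hx.
exists (`|y|^-1 *: y); first by rewrite normrZ normfV normr_id mulVf// normr_eq0.
by move=> i i_n; rewrite linearZl_LR /= ha// mulr0.
Qed.

(** The n-th vector is orthogonal to the first [n] members of a dense family. A vector [y] lies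
    within [eps] of some member [v], and from some rank on its product with the sequence is the
    product of [y - v]. *)
Lemma unit_weakly_null : exists2 x : nat -> H, (forall n, `|x n| = 1) & weak_limit dot x 0.
Proof.
have [D /countable_injP[f finj] dD] := hsep.
(* The family is indexed through an injection of [D] into the naturals; indices outside its range
   get the harmless value 0. *)
pose e k := xget 0 [set v | D v /\ f v = k].
have eD v : D v -> e (f v) = v.
  move=> Dv; have [De fe] : [set w | D w /\ f w = f v] (e (f v)).
    by apply: (@xgetPex _ 0 [set w | D w /\ f w = f v]); exists v.
  by apply: finj; rewrite ?inE.
have ex n : exists x, `|x| = 1 /\ forall i, (i < n)%N -> dot x (e i) = 0.
  by have [x x1 x2] := unit_orthogonal e n; exists x.
exists (fun n => sval (cid (ex n))).
  by move=> n; case: (cid (ex n)) => x [].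
move=> y; rewrite dot0l.
apply/cvgrPdist_le => eps eps0.
have [v [yv Dv]] : ball y eps `&` D !=set0.
  by apply: dD; [exists y; exact: ballxx|exact: ball_open].
near=> n; rewrite sub0r normrN; case: (cid (ex n)) => x /= [x1 x2].
have -> : dot x y = dot x (y - v).
  rewrite linearBr /= -[in X in _ - X](eD _ Dv) x2 ?subr0//; near: n; exact: nbhs_infty_gt.
apply: (le_trans (norm_dot_le _ _)); rewrite x1 mul1r.
by move: yv; rewrite -ball_normE /ball_/= => /ltW.
Unshelve. all: by end_near. Qed.

Context (G : zmodClosed H) (hG : seq_weakly_dense dot G).

(* If [G] is norm dense, perturb a weakly null sequence of unit vectors.
   Otherwise differences of a sequence of [G] converging weakly to a point at
   positive distance from [G] work. *)
Let far_exists : exists e, 0 < e /\ exists u : nat -> H,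
  [/\ forall n, u n \in G, weak_limit dot u 0 & forall n, e <= `|u n|].
Proof.
have [dense|/existsNP[x /existsNP[e /not_implyP[e0 far]]]] :=
  pselect (forall x e, 0 < e -> exists2 g, g \in G & `|x - g| < e).
  have [x x1 xw] := unit_weakly_null.
  (* With [n + 2] the error is at most [1/2] from [n = 0] on, so that the perturbed vectors keep
     norm at least [1/2]. *)
  have pos n : 0 < (n.+2%:R : R)^-1 by rewrite invr_gt0.
  have ex n : exists g, g \in G /\ `|x n - g| < n.+2%:R^-1.
    by have [g g1 g2] := dense (x n) _ (pos n); exists g.
  pose u n := sval (cid (ex n)).
  have uG n : u n \in G by rewrite /u; case: (cid _) => ? [].
  have ux n : `|x n - u n| < n.+2%:R^-1 by rewrite /u; case: (cid _) => ? [].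
  exists 2^-1; split; first by rewrite invr_gt0.
  exists u; split => //.
  - move=> y; apply/cvgrPdist_le => eps eps0.
    have h := xw y; rewrite dot0l in h *.
    have eps2 : 0 < eps / 2 by rewrite divr_gt0.
    move/cvgrPdist_le : h => /(_ _ eps2) h.
    have h0 : (fun n => n.+2%:R^-1 * `|y| : R) @ \oo --> 0 * `|y|.
      apply: cvgM; last exact: cvg_cst.
      by have := @cvg_harmonic R; rewrite -cvg_shiftS.
    rewrite mul0r in h0; move/cvgrPdist_le : h0 => /(_ _ eps2) h0.
    near=> n; have h1 : `|0 - dot (x n) y| <= eps / 2 by near: n.
    have h2 : `|0 - n.+2%:R^-1 * `|y| | <= eps / 2 by near: n.
    rewrite sub0r normrN in h1; rewrite sub0r normrN ger0_norm in h2; last first.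
      by rewrite mulr_ge0// ltW.
    rewrite sub0r normrN.
    have -> : u n = x n - (x n - u n) by rewrite opprB addrC subrK.
    rewrite linearBl /=; apply: (le_trans (ler_normB _ _)).
    have h3 : `|dot (x n - u n) y| <= n.+2%:R^-1 * `|y|.
      by apply: (le_trans (norm_dot_le _ _)); rewrite ler_wpM2r// ltW.
    by rewrite (splitr eps); apply: lerD => //; exact: le_trans h2.
  - move=> n; have h2 : (n.+2%:R : R)^-1 <= 2^-1 by rewrite lef_pV2 ?posrE// ler_nat.
    have h3 : `|x n| <= `|x n - u n| + `|u n|.
      by rewrite -{1}(subrK (u n) (x n)) ler_normD.
    have : 1 <= 2^-1 + `|u n|.
      by rewrite -[leLHS](x1 n) (le_trans h3)// lerD2r (le_trans (ltW (ux n))).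
    by rewrite -lerBlDl; apply: le_trans; lra.
have [u uG ux] := hG x.
have ge n : e <= `|x - u n|.
  by rewrite leNgt; apply/negP => h; apply: far; exists (u n).
(* Pairing [u m - u n] with [y = x - u n] tends to [|y|^2] as [m] grows, so for large [m] the
   difference has norm at least [|y|/2], hence at least [e/2]. *)
have ex n : exists m, (n <= m)%N /\ e / 2 <= `|u m - u n|.
  pose y := x - u n; have y0 : 0 < `|y| := lt_le_trans e0 (ge n).
  have h : dot (u m - u n) y @[m --> \oo] --> dot y y.
    rewrite /y linearBl; under eq_fun do rewrite linearBl.
    by apply: cvgB; [exact: ux|exact: cvg_cst].
  have y20 : 0 < `|y| ^+ 2 / 2 by rewrite divr_gt0// exprn_gt0.
  move/cvgrPdist_le : h => /(_ _ y20) [N _ hN]; exists (maxn n N); split; first exact: leq_maxl.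
  have := hN _ (leq_maxr n N); rewrite -hdot ler_norml => /andP[_ h].
  have h2 := le_trans (ler_norm _) (norm_dot_le (u (maxn n N) - u n) y).
  have h3 : `|y| / 2 <= `|u (maxn n N) - u n|.
    have : `|y| / 2 * `|y| <= `|u (maxn n N) - u n| * `|y|.
      by apply: le_trans h2; rewrite mulrAC -expr2; lra.
    by rewrite ler_pM2r.
  by apply: le_trans h3; rewrite ler_pM2r ?invr_gt0//; exact: ge.
pose m n := sval (cid (ex n)).
have nm n : (n <= m n)%N by rewrite /m; case: (cid _) => ? [].
have mu_ n : e / 2 <= `|u (m n) - u n| by rewrite /m; case: (cid _) => ? [].
exists (e / 2); split; first by rewrite divr_gt0.
exists (fun n => u (m n) - u n); split => //.
- by move=> n; rewrite rpredB.
- rewrite -(subrr x); apply: weak_limitD; last exact: weak_limitN.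
  move=> y; have := ux y; apply: cvg_comp.
  move=> A [N _ hA]; exists N => // k /= Nk; apply: hA => /=.
  exact: leq_trans (nm k).
Unshelve. all: by end_near. Qed.

(** A mere subgroup allows no rescaling, but integer multiples stay in [G] and remain weakly null,
    so any positive lower bound can be raised to [s]. *)
Lemma weakly_null_far s : exists u : nat -> H,
  [/\ forall n, u n \in G, weak_limit dot u 0 & forall n, s <= `|u n|].
Proof.
have [e [e0 [u [uG uw ue]]]] := far_exists.
pose k := (Num.truncn (s / e)).+1.
exists (fun n => u n *+ k); split.
- by move=> n; rewrite rpredMn.
- by rewrite -(mul0rn _ k); exact: weak_limitMn.
- move=> n; rewrite normrMn -mulr_natr.
  apply: (@le_trans _ _ (e * k%:R)); last by rewrite ler_wpM2r.
  by rewrite mulrC -ler_pdivrMr// ltW// truncnS_gt.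
Qed.

End infinite_dimension.
End weak_sequences.

(** * Spreading by wide Gaussians *)

Section product_toolbox.
Context d1 d2 (T1 : measurableType d1) (T2 : measurableType d2) (R : realType).
Variables (m1 : {sigma_finite_measure set T1 -> \bar R})
  (m2 : {sigma_finite_measure set T2 -> \bar R}).

Lemma Rintegrable_prod (F : T1 * T2 -> R) (B : T1 -> R) : measurable_fun setT F ->
  (forall x, m2.-integrable setT (EFin \o (fun y => F (x, y)))) ->
  (forall x, \int[m2]_y `|F (x, y)| <= B x) ->
  m1.-integrable setT (EFin \o B) ->
  (m1 \x m2)%E.-integrable setT (EFin \o F).
Proof.
move=> mF Fi FB Bi; apply/integrable12ltyP; first exact/measurable_EFinP.
have /integrableP[mB] := Bi; apply: le_lt_trans.
apply: ge0_le_integral => //.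
- by move=> x _; apply: integral_ge0 => y _; rewrite abse_ge0.
- have mF' : measurable_fun setT (fun p : T1 * T2 => `|(EFin \o F) p|%E).
    by apply: measurableT_comp => //; exact/measurable_EFinP.
  exact: (@measurable_fun_fubini_tonelli_F _ _ _ _ _ m2 _ mF' (fun p => abse_ge0 _)).
- exact: measurableT_comp.
- move=> x _; have h := integrable_norm (Fi x).
  have -> : (\int[m2]_y `|(EFin \o F) (x, y)| = (\int[m2]_y `|F (x, y)|)%:E)%E.
    by rewrite /Rintegral fineK//; exact: (integrable_fin_num _ h).
  by rewrite /= lee_fin (le_trans (FB x))// ler_norm.
Qed.

(** All sections, not just almost all, are asked to be integrable: the inner real integrals then
    coincide everywhere with the extended ones and nothing is lost to [fine]. *)
Lemma RFubini (F : T1 * T2 -> R) : (m1 \x m2)%E.-integrable setT (EFin \o F) ->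
  (forall x, m2.-integrable setT (EFin \o (fun y => F (x, y)))) ->
  (forall y, m1.-integrable setT (EFin \o (fun x => F (x, y)))) ->
  [/\ m1.-integrable setT (EFin \o (fun x => \int[m2]_y F (x, y))),
      m2.-integrable setT (EFin \o (fun y => \int[m1]_x F (x, y))) &
      \int[m1]_x \int[m2]_y F (x, y) = \int[m2]_y \int[m1]_x F (x, y)].
Proof.
move=> Fi F1 F2.
have E1 : (fubini_F m2 (EFin \o F)) = EFin \o (fun x => \int[m2]_y F (x, y)).
  apply/funext => x; rewrite /fubini_F /= /Rintegral fineK//.
  exact: (integrable_fin_num _ (F1 x)).
have E2 : (fubini_G m1 (EFin \o F)) = EFin \o (fun y => \int[m1]_x F (x, y)).
  apply/funext => x; rewrite /fubini_G /= /Rintegral fineK//.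
  exact: (integrable_fin_num _ (F2 x)).
have h1 := integrable_fubini_F Fi.
have h2 : m2.-integrable setT (fubini_G m1 (EFin \o F)).
  have mG := measurable_fubini_G Fi; apply/integrableP; split => //.
  have /integrableP[mF _] := Fi; move/(integrable21ltyP _ _ mF) : Fi; apply: le_lt_trans.
  have mF' : measurable_fun setT (fun p : T1 * T2 => `|(EFin \o F) p|%E) by exact: measurableT_comp.
  apply: ge0_le_integral => //.
  - exact: measurableT_comp.
  - exact: (@measurable_fun_fubini_tonelli_G _ _ _ _ _ m1 _ mF' (fun p => abse_ge0 _)).
  - by move=> y _; apply: le_abse_integral => //; have /integrableP[] := F2 y.
have H := Fubini Fi; rewrite E1 in h1; rewrite E2 in h2; split => //.
have e1 := congr1 (fun g => \int[m1]_x g x)%E E1.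
have e2 := congr1 (fun g => \int[m2]_x g x)%E E2.
by rewrite {1}/Rintegral -[X in fine X]e1 /fubini_F H -[X in fine X]/(\int[m2]_x fubini_G m1 (EFin \o F) x)%E e2.
Qed.

Lemma ae_prod_section (P : T1 * T2 -> Prop) : (\forall p \ae (m1 \x m2)%E, P p) ->
  \forall x \ae m1, \forall y \ae m2, P (x, y).
Proof.
move=> [N [mN N0 PN]].
have mx := measurable_fun_xsection m2 mN.
have : ae_eq m1 setT (m2 \o xsection N) (cst 0%E).
  apply/ae_eq_integral_abs => //; rewrite -[RHS]N0.
  by apply: eq_integral => x _; rewrite gee0_abs.
apply: filterS => x /= /(_ I) Nx0; exists (xsection N x); split => //.
- exact: measurable_xsection.
- by move=> y /= nP; rewrite /xsection/= inE; exact: PN.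
Qed.

End product_toolbox.

(** * Translation invariance of integrals on the line *)

Section lebesgue_translation.
Context {R : realType}.
Local Notation lambda := (@lebesgue_measure R).
Local Notation Y := (measurableTypeR R).

Let measurable_shift (c : R) : @measurable_fun _ _ Y Y setT (fun t => t + c).
Proof.
have h : measurable_fun setT (fun t : R => t + c) by exact: measurable_funD.
by move=> mD A mA; exact: (h mD A mA).
Qed.

Lemma lebesgue_measure_shift (c : R) (A : set Y) : measurable A ->
  lambda ((fun t => t + c) @^-1` A) = lambda A.
Proof.
pose sh : {mfun Y >-> Y} := HB.pack (fun t : Y => (t + c : Y))
  (isMeasurableFun.Build _ _ Y Y (fun t => t + c) (measurable_shift c)).
move=> mA; symmetry; apply: (@lebesgue_measure_unique R (pushforward lambda sh) _ A mA).
move=> _ [[a b] _ <-] /=.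
change (lambda `]a, b]%classic = lambda ((fun t : R => t + c) @^-1` `]a, b]%classic)).
have -> : (fun t : R => t + c) @^-1` `]a, b] = `]a - c, b - c]%classic.
  by apply/seteqP; split => t /=; rewrite !in_itv/= ltrBlDr lerBrDr.
rewrite !lebesgue_measure_itv/= !lte_fin ltrD2r; case: ifP => // _.
by rewrite -!EFinD; congr EFin; ring.
Qed.

Lemma Rintegral_shift (c : R) (f : R -> R) :
  lambda.-integrable setT (EFin \o f) ->
  lambda.-integrable setT (EFin \o (fun t => f (t + c))) /\
  \int[lambda]_t f (t + c) = \int[lambda]_t f t.
Proof.
move=> fi; have mf := Rintegrable_measurable fi.
pose sh : {mfun Y >-> Y} := HB.pack (fun t : Y => (t + c : Y))
  (isMeasurableFun.Build _ _ Y Y (fun t => t + c) (measurable_shift c)).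
have shE (g : Y -> \bar R) : (\int[pushforward lambda sh]_t g t = \int[lambda]_t g t)%E.
  apply: (@eq_measure_integral _ Y R setT lambda (pushforward lambda sh)) => A mA _.
  exact: lebesgue_measure_shift.
have mfE : @measurable_fun _ _ Y _ setT (EFin \o f) by exact/measurable_EFinP.
have si : lambda.-integrable setT (EFin \o (fun t => f (t + c))).
  have /integrableP[_ h] := fi; apply/integrableP; split.
    exact: (measurableT_comp mfE (measurable_shift c)).
  apply: le_lt_trans h; rewrite -(shE (fun t => `|(EFin \o f) t|%E)).
  rewrite (@ge0_integral_pushforward _ _ Y Y R sh)//; last exact: measurableT_comp.
split => //; rewrite /Rintegral -[in RHS](shE (EFin \o f)).
by rewrite (@integral_pushforward _ _ Y Y R sh).
Qed.

End lebesgue_translation.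

Section gaussian_translation_continuity.
Context {R : realType}.
Local Notation lambda := (@lebesgue_measure R).

(* Bounds the total variation by the chi-square distance, which is explicit. *)
Lemma normal_pdf_L1_dist_le (e m s c : R) : 0 < e -> s != 0 ->
  \int[lambda]_x `|normal_pdf (m + c) s x - normal_pdf m s x| <=
  (e + (expR (c ^+ 2 / s ^+ 2) - 1) / e) / 2.
Proof.
move=> e0 s0; pose E := expR (c ^+ 2 / s ^+ 2).
pose p n x := normal_pdf n s x : R.
have pi n : lambda.-integrable setT (EFin \o p n) by exact: integrable_normal_pdf.
have pI n : \int[lambda]_x p n x = 1 by exact: Rintegral_normal_pdf.
(* With [p'] the shifted density and [p] the original one, this is [(e/2) p + (p' - p)^2 / (2 e p)],
   Young's bound for [|p' - p|]. By the identity [key] below, [p'^2 / p] is a multiple of another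
   Gaussian density, so every term has a known integral. *)
pose B x := (e / 2) * p m x + ((2 * e)^-1 * E * p (m + 2 * c) x + ((- e^-1) * p (m + c) x + (2 * e)^-1 * p m x)).
have i1 := RintegrableZ (e / 2) (pi m).
have i2 := RintegrableZ ((2 * e)^-1 * E) (pi (m + 2 * c)).
have i3 := RintegrableZ (- e^-1) (pi (m + c)).
have i4 := RintegrableZ ((2 * e)^-1) (pi m).
have i34 := RintegrableD i3 i4; have i234 := RintegrableD i2 i34.
have -> : (e + (expR (c ^+ 2 / s ^+ 2) - 1) / e) / 2 = \int[lambda]_x B x.
  rewrite /B RintegralD// RintegralD// RintegralD// !RintegralZl// !pI !mulr1 -/E.
  by field; rewrite gt_eqF.
apply: le_Rintegral => //.
- have := integrable_norm (RintegrableB (pi (m + c)) (pi m)); exact.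
- exact: RintegrableD.
move=> x _; rewrite -/(p (m + c) x) -/(p m x).
have q0 : 0 < p m x by rewrite /p normal_pdf_expRE// mulr_gt0 ?expR_gt0// normal_peak_gt0.
have key : E * p (m + 2 * c) x * p m x = p (m + c) x ^+ 2.
  rewrite /E /p !normal_pdf_expRE// expr2.
  have swap (a b r u : R) : a * (b * r) * (b * u) = b * b * (a * r * u) by ring.
  rewrite swap -!expRD [RHS]mulrACA -expRD; congr (_ * expR _).
  by field.
have -> : B x = (e / 2) * p m x + (2 * e)^-1 * (p (m + c) x - p m x) ^+ 2 / p m x.
  have -> : (p (m + c) x - p m x) ^+ 2 = p m x * (E * p (m + 2 * c) x - 2 * p (m + c) x + p m x).
    rewrite sqrrB -key -mulr_natr; ring.
  by rewrite /B; field; rewrite !gt_eqF.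
move: (p (m + c) x) (p m x) q0 => a q q0.
rewrite -(real_normK (num_real (a - q))); move: `|a - q| (normr_ge0 (a - q)) => b b0.
rewrite -subr_ge0.
have -> : e / 2 * q + (2 * e)^-1 * b ^+ 2 / q - b = (2 * e * q)^-1 * (e * q - b) ^+ 2.
  by field; rewrite !gt_eqF.
by rewrite mulr_ge0 ?sqr_ge0// invr_ge0 !mulr_ge0// ltW.
Qed.

(** Only the ratio [c/s] matters, hence a threshold proportional to [s] and uniform in [m]. The
    constant solves [exp(k^2) - 1 = e^2], which makes each half of the chi-square bound at most
    [e/2]. *)
Lemma normal_pdf_L1_continuous (e : R) : 0 < e -> exists2 k, 0 < k &
  forall m s c : R, 0 < s -> `|c| <= k * s ->
  \int[lambda]_x `|normal_pdf (m + c) s x - normal_pdf m s x| <= e.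
Proof.
move=> e0; have l0 : 0 < ln (1 + e ^+ 2) by rewrite ln_gt0// ltrDl exprn_gt0.
exists (Num.sqrt (ln (1 + e ^+ 2))); first by rewrite sqrtr_gt0.
move=> m s c s0 ck; apply: (le_trans (normal_pdf_L1_dist_le m c e0 _)); first by rewrite gt_eqF.
suff h : (expR (c ^+ 2 / s ^+ 2) - 1) / e <= e by lra.
rewrite ler_pdivrMr// -expr2 lerBlDl.
have p1 : 0 < 1 + e ^+ 2 by rewrite ltr_pwDl// sqr_ge0.
rewrite -[leRHS]lnK ?posrE// ler_expR ler_pdivrMr ?exprn_gt0//.
rewrite -(real_normK (num_real c)) -(sqr_sqrtr (ltW l0)) -exprMn.
by rewrite lerXn2r ?nnegrE// mulr_ge0 ?sqrtr_ge0// ltW.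
Qed.

End gaussian_translation_continuity.

(** * Bounded functions of bounded support against Gaussian densities *)

Section bounded_support.
Context {R : realType}.
Local Notation lambda := (@lebesgue_measure R).
Variables (h : R -> R) (B N : R).
Hypotheses (mh : measurable_fun setT h) (hB : forall x, `|h x| <= B)
  (hN : forall x, N < `|x| -> h x = 0).

Lemma bounded_support_integrable : lambda.-integrable setT (EFin \o h).
Proof.
apply: (@dominated_lebesgue_integrable _ _ (fun x => B * \1_`[- N, N] x)) => //.
  move=> x; rewrite indicE; case: (boolP (x \in _)) => [_|/negP]; first by rewrite mulr1.
  rewrite inE /= in_itv/= -ler_norml => /negP; rewrite -ltNge => /hN ->.
  by rewrite normr0 mulr0.
apply: RintegrableZ; apply/integrableP; split.
  by apply/measurable_EFinP; exact: measurable_indic.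
under eq_integral do rewrite /= ger0_norm//.
rewrite integral_indic//= setIT; have -> := @lebesgue_measure_itv R `[- N, N]; rewrite /=; case: ifP => _; last exact: ltry.
by rewrite -EFinD ltry.
Qed.

Lemma bounded_support_pdf_integrable m s :
  lambda.-integrable setT (EFin \o (fun x => h x * normal_pdf m s x)).
Proof.
apply: (@dominated_lebesgue_integrable _ _ (fun x => B * normal_pdf m s x)).
- by apply: measurable_funM => //; exact: measurable_normal_pdf.
- by move=> x; rewrite normrM (ger0_norm (normal_pdf_ge0 _ _ _)) ler_wpM2r// normal_pdf_ge0.
- by apply: RintegrableZ; exact: integrable_normal_pdf.
Qed.

Lemma bounded_support_pdf_le m s : `|\int[lambda]_x (h x * normal_pdf m s x)| <= B.
Proof.
have hi := bounded_support_pdf_integrable m s.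
apply: (le_trans (le_normr_Rintegral _ hi)) => //.
rewrite -[leRHS]mulr1 -(Rintegral_normal_pdf m s) -RintegralZl//; last exact: integrable_normal_pdf.
apply: le_Rintegral => //.
- have := integrable_norm hi; exact.
- by apply: RintegrableZ; exact: integrable_normal_pdf.
- by move=> x _; rewrite normrM (ger0_norm (normal_pdf_ge0 _ _ _)) ler_wpM2r// normal_pdf_ge0.
Qed.

Lemma bounded_support_pdf_dist m s c e : 0 <= B ->
  \int[lambda]_x `|normal_pdf (m + c) s x - normal_pdf m s x| <= e ->
  `|\int[lambda]_x (h x * normal_pdf (m + c) s x) - \int[lambda]_x (h x * normal_pdf m s x)| <= B * e.
Proof.
move=> B0 he; rewrite -RintegralB//; [|exact: bounded_support_pdf_integrable..].
have hi := RintegrableB (bounded_support_pdf_integrable (m + c) s) (bounded_support_pdf_integrable m s).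
have pi := integrable_norm (RintegrableB (integrable_normal_pdf (m + c) s) (integrable_normal_pdf m s)).
apply: (le_trans (le_normr_Rintegral _ hi)) => //.
apply: (@le_trans _ _ (\int[lambda]_x (B * `|normal_pdf (m + c) s x - normal_pdf m s x|))).
  apply: le_Rintegral => //.
  - have := integrable_norm hi; exact.
  - exact: RintegrableZ.
  - by move=> x _; rewrite -mulrBr normrM ler_wpM2r.
by rewrite RintegralZl// ler_wpM2l.
Qed.

Lemma normal_peak_le (s s' : R) : 0 < s -> s <= s' -> normal_peak s' <= normal_peak s.
Proof.
move=> s0 ss; rewrite /normal_peak lef_pV2 ?posrE; last 2 first.
- by rewrite sqrtr_gt0 pmulrn_lgt0// mulr_gt0 ?pi_gt0// exprn_gt0// (lt_le_trans s0).
- by rewrite sqrtr_gt0 pmulrn_lgt0// mulr_gt0 ?pi_gt0// exprn_gt0.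
rewrite ler_wsqrtr// ler_pMn2r// ler_wpM2r ?pi_ge0// lerXn2r// nnegrE ltW//.
exact: lt_le_trans ss.
Qed.

(** The future majorant for dominated convergence in [t], uniform over deviations in [[s0, s1]] and
    centres displaced by at most [b0]. The peak is largest at [s0], the tail is heaviest at [s1],
    and passing to [2 s1] leaves room for the bounded displacement. *)
Lemma bounded_support_pdf_decay (s0 s1 b0 : R) : 0 < s0 -> 0 <= b0 -> exists2 K, 0 <= K &
  forall s b t, s0 <= s <= s1 -> `|b| <= b0 ->
  \int[lambda]_x (`|h x| * normal_pdf (t + b) s x) <= K * normal_pdf 0 (2 * s1) t.
Proof.
move=> s00 b00.
pose c := normal_peak s0 * expR ((N + b0) ^+ 2 / (2 * s1 ^+ 2)) / normal_peak (2 * s1).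
have hi := bounded_support_integrable; have hni := integrable_norm hi.
have c0 : 0 <= c by rewrite divr_ge0 ?normal_peak_ge0// mulr_ge0 ?normal_peak_ge0 ?expR_ge0.
exists (c * \int[lambda]_x `|h x|); first by rewrite mulr_ge0//; apply: Rintegral_ge0.
move=> s b t /andP[s0s ss1] bb.
have sp : 0 < s := lt_le_trans s00 s0s; have s1p : 0 < s1 := lt_le_trans sp ss1.
rewrite mulrAC -RintegralZl//; apply: le_Rintegral => //.
- have := integrable_norm (bounded_support_pdf_integrable (t + b) s).
  congr (_.-integrable _ _); apply/funext => x /=.
  by rewrite normrM (ger0_norm (normal_pdf_ge0 _ _ _)).
- exact: RintegrableZ.
move=> x _; rewrite [leRHS]mulrC.
have [Nx|xN] := ltP N `|x|; first by rewrite hN// normr0 !mul0r.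
rewrite ler_wpM2l// /c !normal_pdf_expRE ?gt_eqF// ?mulr_gt0// [leRHS]mulrA divfK; last first.
  by rewrite gt_eqF// normal_peak_gt0// gt_eqF// mulr_gt0.
rewrite -mulrA ler_pM ?normal_peak_ge0 ?expR_ge0//; first exact: normal_peak_le.
rewrite -expRD ler_expR subr0.
(* On the support [|x - b| <= N + b0], and [t^2/2 <= (a - t)^2 + a^2] with [a = x - b]. *)
have h1 : t ^+ 2 / 2 - (N + b0) ^+ 2 <= (x - (t + b)) ^+ 2.
  have h2 : `|x - b| <= N + b0 by apply: (le_trans (ler_normB _ _)); exact: lerD.
  have h3 : (x - b) ^+ 2 <= (N + b0) ^+ 2.
    by rewrite -(real_normK (num_real (x - b))) lerXn2r// nnegrE// (le_trans _ h2).
  have : 0 <= (t / 2 - (x - b)) ^+ 2 by exact: sqr_ge0.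
  move: h3; set a := x - b; have -> : x - (t + b) = a - t by rewrite /a; ring.
  by move=> *; nra.
have h4 : (x - (t + b)) ^+ 2 / (2 * s1 ^+ 2) <= (x - (t + b)) ^+ 2 / (2 * s ^+ 2).
  rewrite ler_wpM2l ?sqr_ge0// lef_pV2 ?posrE ?mulr_gt0 ?exprn_gt0// ler_pM2l//.
  by rewrite lerXn2r// nnegrE ltW.
rewrite !mulNr -lerN2 opprD !opprK; apply: le_trans h4.
apply: (@le_trans _ _ ((t ^+ 2 / 2 - (N + b0) ^+ 2) / (2 * s1 ^+ 2))); last first.
  by rewrite ler_wpM2r// invr_ge0 mulr_ge0// sqr_ge0.
rewrite -subr_ge0.
have -> : (t ^+ 2 / 2 - (N + b0) ^+ 2) / (2 * s1 ^+ 2) -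
    (- ((N + b0) ^+ 2 / (2 * s1 ^+ 2)) + t ^+ 2 / (2 * (2 * s1) ^+ 2)) = t ^+ 2 / (8 * s1 ^+ 2).
  by field; rewrite gt_eqF.
by rewrite divr_ge0 ?sqr_ge0// mulr_ge0// sqr_ge0.
Qed.

End bounded_support.

(** * Convolution of a mean-zero function with a wide Gaussian *)

Section spread.
Context {R : realType}.
Local Notation lambda := (@lebesgue_measure R).
Local Notation Y := (measurableTypeR R).

Lemma measurable_fst_R d (Z : measurableType d) : measurable_fun setT (fun p : Y * Z => p.1 : R).
Proof.
move=> mD A mA; exact: (@measurable_fst _ _ Y Z measurableT A mA).
Qed.

Lemma measurable_snd_R d (Z : measurableType d) : measurable_fun setT (fun p : Z * Y => p.2 : R).
Proof.
move=> mD A mA; exact: (@measurable_snd _ _ Z Y measurableT A mA).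
Qed.

Lemma normal_pdf_swap (t c s x : R) : s != 0 -> normal_pdf (t + c) s x = normal_pdf (- c) s (t - x).
Proof.
move=> s0; rewrite !normal_pdf_expRE//.
by have -> : (x - (t + c)) ^+ 2 = (t - x - - c) ^+ 2 by ring.
Qed.

Variables (h : R -> R) (B N : R).
Hypotheses (mh : measurable_fun setT h) (hB : forall x, `|h x| <= B)
  (hN : forall x, N < `|x| -> h x = 0) (N0 : 0 < N).

(** Because [h] has integral 0, the density shifted by [x] may be replaced by its difference with
    the unshifted one. On the support the shift is at most [N <= k s], small against the width, and
    Fubini turns this into an [L^1] bound. It is uniform in the centre [c], which will move with the
    sequence. *)
Lemma spread_L1_small (e : R) : \int[lambda]_x h x = 0 -> 0 < e -> exists2 s0, 0 < s0 &
  forall s c, s0 <= s ->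
  let q t := \int[lambda]_x (h x * normal_pdf (t + c) s x) in
  lambda.-integrable setT (EFin \o q) /\ \int[lambda]_t `|q t| <= e.
Proof.
move=> h0 e0; have hi := bounded_support_integrable mh hB hN; have hni := integrable_norm hi.
pose I := \int[lambda]_x `|h x|; have I0 : 0 <= I by exact: Rintegral_ge0.
have e10 : 0 < e / (I + 1) by rewrite divr_gt0// ltr_wpDl.
have Ie : \int[lambda]_x (`|h x| * (e / (I + 1))) <= e.
  rewrite (RintegralZr (e / (I + 1)) measurableT hni) -/I mulrCA -[leRHS]mulr1.
  rewrite ler_wpM2l ?(ltW e0)// ltW// ltr_pdivrMr ?mul1r ?ltrDl// ltr_wpDl//.
have [k k0 hk] := normal_pdf_L1_continuous e10.
exists (N / k); first by rewrite divr_gt0.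
move=> s c Nks q; have s0 : 0 < s by apply: lt_le_trans Nks; rewrite divr_gt0.
have s0' : s != 0 by rewrite gt_eqF.
pose p x t : R := normal_pdf (- c + x) s t.
pose F (z : Y * Y) : R := h z.1 * (p z.1 z.2 - p 0 z.2).
have pE x t : p x t = normal_pdf (- c) s (t - x).
  by rewrite /p normal_pdf_shift// opprK addrC.
have mF : measurable_fun setT F.
  have mfst := @measurable_fst_R _ Y; have msnd := @measurable_snd_R _ Y.
  apply: measurable_funM; first exact: (measurableT_comp mh mfst).
  apply: measurable_funB.
    have -> : (fun z : Y * Y => p z.1 z.2) = (fun z : Y * Y => normal_pdf (- c) s (z.2 - z.1)).
      by apply/funext => z; rewrite pE.
    by apply: (measurableT_comp (@measurable_normal_pdf R (- c) s)); exact: measurable_funB.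
  exact: (measurableT_comp (@measurable_normal_pdf R (- c + 0) s) msnd).
have pi x : lambda.-integrable setT (EFin \o (fun t => p x t - p 0 t)).
  by apply: RintegrableB; exact: integrable_normal_pdf.
have pni x := integrable_norm (pi x).
have F1 x : lambda.-integrable setT (EFin \o (fun t => F (x, t))).
  exact: (RintegrableZ (h x) (pi x)).
have pL x : `|x| <= N -> \int[lambda]_t `|p x t - p 0 t| <= e / (I + 1).
  move=> xN; rewrite /p addr0; apply: hk => //; apply: (le_trans xN).
  by rewrite mulrC -ler_pdivrMr.
have FB x : \int[lambda]_t `|F (x, t)| <= `|h x| * (e / (I + 1)).
  have -> : \int[lambda]_t `|F (x, t)| = `|h x| * \int[lambda]_t `|p x t - p 0 t|.
    rewrite -RintegralZl//; last exact: pni.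
    by apply: eq_Rintegral => t _; rewrite /F /= normrM.
  have [Nx|xN] := ltP N `|x|; first by rewrite hN// normr0 !mul0r.
  by rewrite ler_wpM2l// pL.
have hnie : lambda.-integrable setT (EFin \o (fun x => `|h x| * (e / (I + 1)))).
  have := RintegrableZ (e / (I + 1)) hni.
  by congr (_.-integrable _ _); apply/funext => x /=; rewrite mulrC.
have Fi : (lambda \x lambda)%E.-integrable setT (EFin \o F) by exact: Rintegrable_prod hnie.
have F2 t : lambda.-integrable setT (EFin \o (fun x => F (x, t))).
  have pb x : `|p x t - p 0 t| <= 2 * normal_peak s.
    apply: (le_trans (ler_normB _ _)); rewrite !ger0_norm ?normal_pdf_ge0//.
    by have := normal_pdf_ub (- c + x) t s0'; have := normal_pdf_ub (- c + 0) t s0'; rewrite /p; lra.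
  apply: (@dominated_lebesgue_integrable _ _ (fun x => 2 * normal_peak s * `|h x|)).
  - exact: (measurable_fun_pair1 t mF).
  - by move=> x; rewrite /F /= normrM mulrC ler_wpM2r.
  - exact: RintegrableZ.
have qE t : q t = \int[lambda]_x F (x, t).
  have hp x : normal_pdf (t + c) s x = p x t by rewrite normal_pdf_swap// pE.
  have i1 : lambda.-integrable setT (EFin \o (fun x => p 0 t * h x)) by exact: RintegrableZ.
  have i2 := bounded_support_pdf_integrable mh hB (t + c) s.
  have : \int[lambda]_x (h x * normal_pdf (t + c) s x) - \int[lambda]_x (p 0 t * h x) = \int[lambda]_x F (x, t).
    rewrite -RintegralB//; apply: eq_Rintegral => x _.
    by rewrite /F /= hp mulrBr (mulrC (h x) (p 0 t)).
  by rewrite RintegralZl// h0 mulr0 subr0.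
have [_ Gi _] := RFubini Fi F1 F2.
have qi : lambda.-integrable setT (EFin \o q).
  by have -> : q = (fun t => \int[lambda]_x F (x, t)) by exact/funext.
split => //; have F2n t := integrable_norm (F2 t).
have Fn1 x := integrable_norm (F1 x).
have [Gn1 Gn2 Gn] := RFubini (integrable_norm Fi : (lambda \x lambda)%E.-integrable setT (EFin \o (fun z => `|F z|))) Fn1 F2n.
apply: (@le_trans _ _ (\int[lambda]_t \int[lambda]_x `|F (x, t)|)).
  apply: (@le_Rintegral _ Y R lambda setT (fun t => `|q t|) _ measurableT (integrable_norm qi) Gn2).
  by move=> t _; rewrite qE; apply: (le_normr_Rintegral measurableT (F2 t)).
rewrite -Gn; apply: (@le_trans _ _ (\int[lambda]_x (`|h x| * (e / (I + 1))))).
  exact: (@le_Rintegral _ Y R lambda setT _ _ measurableT Gn1 hnie (fun x _ => FB x)).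
exact: Ie.
Qed.

End spread.

(** * Functions invariant under the Maharam extension *)

Section maharam_kernel.
Context (R : realType) (H : completeNormedModType R)
  (dot : {dot H for idfun}) (hdot : hilbert_norm dot)
  (d : measure_display) (X : measurableType d) (mu : probability X R)
  (W : H -> {mfun X >-> R}) (hW : gaussian_construction mu W)
  (T : H -> {mfun X >-> X}) (hT : gaussian_translation dot mu W T).
Local Notation integr f := (mu.-integrable setT (EFin \o f)).
Local Notation lambda := (@lebesgue_measure R).
Local Notation Y := (measurableTypeR R).

(* The adjoint of the Maharam extension of [T g], applied to [h] in the second variable. *)
Definition maharam_kernel (h : R -> R) (g : H) (t : R) (x : X) : R :=
  h (t + W g x - `|g| ^+ 2 / 2) * expR (W g x - `|g| ^+ 2 / 2).

Lemma measurable_maharam_kernel (h : R -> R) g t : measurable_fun setT h ->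
  measurable_fun setT (maharam_kernel h g t).
Proof.
move=> mh; apply: measurable_funM.
  apply: (measurableT_comp mh); apply: measurable_funB => //; exact: measurable_funD.
by apply: measurableT_comp => //; exact: measurable_funB.
Qed.

(** Cameron-Martin along [z + g] absorbs both exponentials, leaving [exp((|z + g|^2 - |g|^2)/2)].
    The same translation raises [W g] by [dot z g + |g|^2], so the drift [- |g|^2/2] becomes
    [+ |g|^2/2] in the centre of the Gaussian. *)
Lemma expW_maharam_kernel (h : R -> R) (B : R) z g t : measurable_fun setT h -> (forall x, `|h x| <= B) ->
  `|g| != 0 ->
  integr (fun x => expR (W z x) * maharam_kernel h g t x) /\
  \int[mu]_x (expR (W z x) * maharam_kernel h g t x) =
  expR (`|z| ^+ 2 / 2 + dot z g) *
  \int[lambda]_x (h x * normal_pdf (t + `|g| ^+ 2 / 2 + dot z g) `|g| x).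
Proof.
move=> mh hB g0; set b := dot z g; set c := `|g| ^+ 2 / 2.
have B0 : 0 <= B := le_trans (normr_ge0 _) (hB 0).
pose phi x := h (t + W g x - c).
have mphi : measurable_fun setT phi.
  apply: (measurableT_comp mh); apply: measurable_funB => //; exact: measurable_funD.
have phiB x : `|phi x| <= B * (1 + expR (W 0 x)).
  by apply: (le_trans (hB _)); rewrite ler_peMr// lerDl expR_ge0.
have [i1 i2 e12] := cameron_martin hdot hW hT (z + g) mphi phiB.
have zg : `|z + g| ^+ 2 / 2 = `|z| ^+ 2 / 2 + b + c.
  by rewrite (sqr_normD hdot) /b /c; field.
have E1 : \forall x \ae mu, expR (`|z| ^+ 2 / 2 + b) *
    (phi x * expR (W (z + g) x - `|z + g| ^+ 2 / 2)) = expR (W z x) * maharam_kernel h g t x.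
  apply: filterS (WD hW z g) => x ->; rewrite /maharam_kernel -/c -/(phi x) zg.
  by rewrite mulrCA [RHS]mulrCA -!expRD; congr (_ * expR _); ring.
pose m := t + c + b; pose f y := h (y + m).
have mf : measurable_fun setT f by apply: (measurableT_comp mh); exact: measurable_funD.
have fB y : `|f y| <= B by exact: hB.
have E2 : \forall x \ae mu, phi (T (z + g) x) = f (W g x).
  apply: filterS ((hT (z + g)).2 g) => x e.
  rewrite /phi /f /m e linearDl /= -hdot -/b; congr h; rewrite /c; by field.
have [j1 j2] := gaussian_law hW g0 mf (bounded_support_pdf_integrable mf fB 0 `|g|).
have mk : measurable_fun setT (fun x => expR (W z x) * maharam_kernel h g t x).
  by apply: measurable_funM; [exact: measurableT_comp|exact: measurable_maharam_kernel].
have i2' := RintegrableZ (expR (`|z| ^+ 2 / 2 + b)) i2.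
split; first exact: (ae_eq_Rintegrable mk E1 i2').
rewrite -(ae_eq_Rintegral (Rintegrable_measurable i2') mk E1) (RintegralZl _ measurableT i2) -e12.
rewrite (ae_eq_Rintegral (Rintegrable_measurable i1) (Rintegrable_measurable j1) E2) j2; congr (_ * _).
have [_ <-] := Rintegral_shift m (bounded_support_pdf_integrable mh hB m `|g|).
by apply: eq_Rintegral => x _; rewrite normal_pdf_shift// subrr.
Qed.

Variables (h : R -> R) (B N : R).
Hypotheses (mh : measurable_fun setT h) (hB : forall x, `|h x| <= B)
  (hN : forall x, N < `|x| -> h x = 0).

Let B0 : 0 <= B. Proof. exact: le_trans (normr_ge0 _) (hB 0). Qed.

(** Where [h] does not vanish, [W g x - |g|^2/2] is at most [N - t]. The density is unbounded, yet
    the kernel is bounded uniformly in [g] and [x]. *)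
Lemma maharam_kernel_bound g t x : `|maharam_kernel h g t x| <= B * expR (N - t).
Proof.
rewrite /maharam_kernel; set a := t + W g x - _.
have [Na|aN] := ltP N `|a|; first by rewrite hN// mul0r normr0 mulr_ge0 ?expR_ge0.
rewrite normrM (ger0_norm (expR_ge0 _)) ler_pM ?expR_ge0// ler_expR.
by have := le_trans (ler_norm _) aN; rewrite /a; lra.
Qed.

Let q (g : H) (t : R) := \int[lambda]_x (h x * normal_pdf (t + `|g| ^+ 2 / 2) `|g| x).

Let q_le g t : `|q g t| <= B.
Proof. exact: bounded_support_pdf_le. Qed.

Let kq_le g t x : `|maharam_kernel h g t x - q g t| <= B * expR (N - t) + B.
Proof.
by apply: (le_trans (ler_normB _ _)); apply: lerD; [exact: maharam_kernel_bound|exact: q_le].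
Qed.

(* Along a weakly null sequence bounded away from 0 the variables [W (u n)] become
   asymptotically independent of everything. *)
Lemma maharam_kernel_weak_cvg (u : nat -> H) s t : 0 < s -> (forall n, s <= `|u n|) ->
  weak_limit dot u 0 -> forall (phi : X -> R) y K, measurable_fun setT phi ->
    (forall x, `|phi x| <= K * (1 + expR (W y x))) ->
    \int[mu]_x (phi x * (maharam_kernel h (u n) t x - q (u n) t)) @[n --> \oo] --> (0 : R).
Proof.
move=> s0 su u0 phi y K mphi phiK.
have un0 n : `|u n| != 0 by rewrite gt_eqF// (lt_le_trans s0).
have mk n : measurable_fun setT (fun x => maharam_kernel h (u n) t x - q (u n) t).
  by apply: measurable_funB => //; exact: measurable_maharam_kernel.
have kB n x : (maharam_kernel h (u n) t x - q (u n) t) ^+ 2 <= (B * expR (N - t) + B) ^+ 2.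
  rewrite -(real_normK (num_real (maharam_kernel h (u n) t x - q (u n) t))).
  have D0 : 0 <= B * expR (N - t) + B by rewrite addr_ge0 ?mulr_ge0 ?expR_ge0.
  by rewrite ler_sqr ?nnegrE//; exact: kq_le.
have ci (c : R) : integr (fun=> c) := finite_measure_integrable_cst mu c measurableT.
have ki n : integr (fun x => (maharam_kernel h (u n) t x - q (u n) t) ^+ 2).
  apply: (dominated_Rintegrable _ _ (ci ((B * expR (N - t) + B) ^+ 2))).
    exact: measurable_funX.
  by move=> x; rewrite ger0_norm ?sqr_ge0.
have := @W_weak_cvg _ _ _ _ _ _ hW (fun n x => maharam_kernel h (u n) t x - q (u n) t)
  (fun=> 0) ((B * expR (N - t) + B) ^+ 2) mk (measurable_cst _) ki _ _ _ phi y K mphi phiK.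
have -> : \int[mu]_x (phi x * 0) = 0.
  by under eq_Rintegral do rewrite mulr0; exact: Rintegral_probability_cst.
apply.
- by under eq_fun do rewrite expr0n; exact: ci.
- move=> n; rewrite -[leRHS](Rintegral_probability_cst mu); apply: le_Rintegral => //.
- move=> z; have -> : \int[mu]_x (expR (W z x) * 0) = 0.
    by under eq_Rintegral do rewrite mulr0; exact: Rintegral_probability_cst.
  pose b n := dot z (u n).
  have b0 : b n @[n --> \oo] --> (0 : R).
    have := u0 z; rewrite dot0l; apply: cvg_trans; apply: near_eq_cvg; apply: nearW => n.
    by rewrite /b (dotC dot).
  (* Two errors appear: the factor [exp(b n) - 1], and the displacement of the Gaussian centre by
     [b n]. Both vanish as [b n] tends to 0, the second because the deviations stay above [s]. *)
  have E n : \int[mu]_x (expR (W z x) * (maharam_kernel h (u n) t x - q (u n) t)) =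
      expR (`|z| ^+ 2 / 2) * ((expR (b n) - 1) *
       \int[lambda]_x (h x * normal_pdf (t + `|u n| ^+ 2 / 2 + b n) `|u n| x) +
       (\int[lambda]_x (h x * normal_pdf (t + `|u n| ^+ 2 / 2 + b n) `|u n| x) - q (u n) t)).
    have [k1 k2] := expW_maharam_kernel z t mh hB (un0 n).
    have i3 : integr (fun x => expR (W z x) * q (u n) t).
      have := RintegrableZ (q (u n) t) (integrable_expW hW z).
      by congr (_.-integrable _ _); apply/funext => x /=; rewrite mulrC.
    under eq_Rintegral do rewrite mulrBr.
    rewrite (RintegralB measurableT k1 i3) k2 (RintegralZr _ measurableT (integrable_expW hW z)).
    by rewrite (Rintegral_expW hW) expRD -/(b n); ring.
  under eq_fun do rewrite E.
  rewrite -(mulr0 (expR (`|z| ^+ 2 / 2))); apply: cvgM; first exact: cvg_cst.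
  rewrite -[X in _ --> X]addr0; apply: cvgD; apply/cvgr0Pnorm_le => e e0.
  + have eb : (expR (b n) - 1) @[n --> \oo] --> (0 : R).
      have := cvg_comp _ _ b0 (@continuous_expR R 0); rewrite expR0 => h1.
      by rewrite -(subrr 1); apply: cvgB => //; exact: cvg_cst.
    have e1 : 0 < e / (B + 1) by rewrite divr_gt0// ltr_wpDl.
    move/cvgr0Pnorm_le : eb => /(_ _ e1); apply: filterS => n hn.
    rewrite normrM; apply: (le_trans (ler_pM _ _ hn (bounded_support_pdf_le mh hB _ _))) => //.
    by rewrite mulrAC ler_pdivrMr ?ltr_wpDl// ler_wpM2l ?lerDl// ltW.
  + have e1 : 0 < e / (B + 1) by rewrite divr_gt0// ltr_wpDl.
    have [k k0 hk] := normal_pdf_L1_continuous e1.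
    have ks : 0 < k * s by rewrite mulr_gt0.
    move/cvgr0Pnorm_le : b0 => /(_ _ ks); apply: filterS => n hn.
    apply: (le_trans (bounded_support_pdf_dist mh hB B0 (hk (t + `|u n| ^+ 2 / 2) `|u n| (b n) _ _))).
    - exact: lt_le_trans (su n).
    - by apply: (le_trans hn); rewrite ler_pM2l.
    - by rewrite mulrCA -[leRHS]mulr1 ler_wpM2l ?ltW// ltr_pdivrMr ?mul1r ?ltrDl// ltr_wpDl.
Qed.

End maharam_kernel.

(** * Section integrals of an invariant function *)

Section maharam_invariant.
Context (R : realType) (H : completeNormedModType R)
  (dot : {dot H for idfun}) (hdot : hilbert_norm dot)
  (d : measure_display) (X : measurableType d) (mu : probability X R)
  (W : H -> {mfun X >-> R}) (hW : gaussian_construction mu W)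
  (T : H -> {mfun X >-> X}) (hT : gaussian_translation dot mu W T).
Local Notation integr f := (mu.-integrable setT (EFin \o f)).
Local Notation lambda := (@lebesgue_measure R).
Local Notation Y := (measurableTypeR R).
Variables (h : R -> R) (B N : R).
Hypotheses (mh : measurable_fun setT h) (hB : forall x, `|h x| <= B)
  (hN : forall x, N < `|x| -> h x = 0).
Variables (f : X * Y -> R) (M : R).
Hypotheses (mf : measurable_fun setT f) (fM : forall p, `|f p| <= M).

Let M0 : 0 <= M. Proof. exact: le_trans (normr_ge0 _) (fM (point, 0)). Qed.

Let hi : lambda.-integrable setT (EFin \o h).
Proof. exact: bounded_support_integrable mh hB hN. Qed.

Let I := \int[lambda]_t `|h t|.

Let I0 : 0 <= I. Proof. exact: Rintegral_ge0. Qed.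

Let shift_integrable a : lambda.-integrable setT (EFin \o (fun t => `|h (t + a)|)).
Proof. by have [i _] := Rintegral_shift a (integrable_norm hi). Qed.

Let shift_integral a : \int[lambda]_t `|h (t + a)| = I.
Proof. by have [_] := Rintegral_shift a (integrable_norm hi). Qed.

Let section_integrable x x' a :
  lambda.-integrable setT (EFin \o (fun t => f (x, t) * h (t + a) * x')).
Proof.
apply: (@dominated_lebesgue_integrable _ _ (fun t => (M * `|x'|) * `|h (t + a)|)).
- apply: measurable_funM => //; apply: measurable_funM; first exact: (measurable_fun_pair2 x mf).
  by apply: (measurableT_comp mh); exact: measurable_funD.
- move=> t; rewrite !normrM mulrAC ler_wpM2r// ler_wpM2r//.
- exact: (RintegrableZ (M * `|x'|) (shift_integrable a)).
Qed.

Let section_le x x' a : \int[lambda]_t `|f (x, t) * h (t + a) * x'| <= M * I * `|x'|.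
Proof.
have i := integrable_norm (section_integrable x x' a).
have j := RintegrableZ (M * `|x'|) (shift_integrable a).
apply: (@le_trans _ _ (\int[lambda]_t (M * `|x'| * `|h (t + a)|))).
  apply: (@le_Rintegral _ Y R lambda setT _ _ measurableT i j) => t _ /=.
  by rewrite !normrM mulrAC ler_wpM2r// ler_wpM2r.
by rewrite (RintegralZl _ measurableT (shift_integrable a)) shift_integral mulrAC.
Qed.

Section random_shift.
Variables (v : X -> R) (mv : measurable_fun setT v).

Let measurable_section : @measurable_fun _ _ (X * Y)%type R setT
  (fun p => f p * h (p.2 + v p.1)).
Proof.
apply: measurable_funM => //; apply: (measurableT_comp mh).
apply: measurable_funD; first exact: measurable_snd_R.
by apply: measurableT_comp => //; exact: measurable_fst.
Qed.

Let weight (w : X -> R) : measurable_fun setT w -> integr (fun x => `|w x|) ->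
  let F (p : X * Y) := f p * h (p.2 + v p.1) * w p.1 in
  measurable_fun setT F /\ (mu \x lambda)%E.-integrable setT (EFin \o F).
Proof.
move=> mw wi F; have mF : measurable_fun setT F.
  apply: measurable_funM; first exact: measurable_section.
  by apply: measurableT_comp => //; exact: measurable_fst.
split => //; apply: (@Rintegrable_prod _ _ _ _ _ mu lambda F (fun x => M * I * `|w x|) mF).
- by move=> x; exact: (section_integrable x (w x) (v x)).
- by move=> x; exact: (section_le x (w x) (v x)).
- exact: RintegrableZ.
Qed.

(** The random shift [v] covers two cases at once: [v = 0] gives the function called [F] in the
    overview, and [v = W g - |g|^2/2] what it becomes after translation by [g]. *)
Definition smear x := \int[lambda]_t (f (x, t) * h (t + v x)).

Lemma smear_le x : `|smear x| <= M * I.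
Proof.
have i := section_integrable x 1 (v x).
have := section_le x 1 (v x); rewrite normr1 mulr1.
apply: le_trans; have -> : smear x = \int[lambda]_t (f (x, t) * h (t + v x) * 1).
  by apply: eq_Rintegral => t _; rewrite mulr1.
exact: (le_normr_Rintegral measurableT i).
Qed.

Lemma measurable_smear : measurable_fun setT smear.
Proof.
have [mF Fi] := @weight (fun=> 1) (measurable_cst _)
  (finite_measure_integrable_cst mu `|1| measurableT).
apply: (@Rintegrable_measurable _ _ _ mu).
have := integrable_fubini_F Fi; congr (_.-integrable _ _).
apply/funext => x; rewrite /fubini_F /smear /Rintegral /=.
rewrite -(fineK (integrable_fin_num measurableT (section_integrable x 1 (v x)))).
by congr (_%:E); congr fine; apply: eq_integral => t _; rewrite /= mulr1.
Qed.

Lemma smear_fubini (w : X -> R) : measurable_fun setT w -> integr (fun x => `|w x|) ->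
  (forall t, integr (fun x => f (x, t) * h (t + v x) * w x)) ->
  lambda.-integrable setT (EFin \o (fun t => \int[mu]_x (f (x, t) * h (t + v x) * w x))) /\
  \int[mu]_x (smear x * w x) = \int[lambda]_t \int[mu]_x (f (x, t) * h (t + v x) * w x).
Proof.
move=> mw wi F2; have [mF Fi] := weight mw wi.
have F1 x := section_integrable x (w x) (v x).
have [_ i2 e] := RFubini Fi F1 F2; split => //; rewrite -e.
apply: eq_Rintegral => x _; rewrite /smear -RintegralZr//.
have := section_integrable x 1 (v x); congr (_.-integrable _ _).
by apply/funext => t /=; rewrite mulr1.
Qed.

End random_shift.

Let theta x := \int[lambda]_t (f (x, t) * h t).

Let thetaE : theta = smear (fun=> 0).
Proof. by apply/funext => x; apply: eq_Rintegral => t _; rewrite addr0. Qed.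

Let shift_by g x := W g x - `|g| ^+ 2 / 2.

Let measurable_shift_by g : measurable_fun setT (shift_by g).
Proof. exact: measurable_funB. Qed.

(** For almost every [x], invariance and the substitution [t -> t + |g|^2/2 + W g x] give
    [theta x = smear (shift_by g) (T g x)]; Cameron-Martin then trades [T g] for the density. The
    factor in front comes from [W z (T g x) = W z x + dot g z]. *)
Lemma maharam_section_integral g z :
  (\forall p \ae (mu \x lambda)%E, f (T g p.1, p.2 - `|g| ^+ 2 / 2 - W g p.1) = f p) ->
  expR (dot z g) * \int[mu]_x (expR (W z x) * theta x) =
  \int[mu]_x (smear (shift_by g) x * (expR (W z x) * expR (W g x - `|g| ^+ 2 / 2))).
Proof.
move=> inv; set c := `|g| ^+ 2 / 2; pose J := smear (shift_by g).
have mJ : measurable_fun setT J by exact: measurable_smear.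
have mW z' : measurable_fun setT (fun x => expR (W z' x)) by exact: measurableT_comp.
pose phi x := expR (W z x) * J x.
have mphi : measurable_fun setT phi by exact: measurable_funM.
have phiK x : `|phi x| <= M * I * (1 + expR (W z x)).
  rewrite normrM (ger0_norm (expR_ge0 _)) mulrC.
  apply: (@le_trans _ _ (M * I * expR (W z x))); first by rewrite ler_wpM2r ?expR_ge0// smear_le.
  by rewrite ler_wpM2l ?mulr_ge0// lerDr.
have [i1 i2 e12] := cameron_martin hdot hW hT g mphi phiK.
transitivity (\int[mu]_x (phi x * expR (W g x - c))); last first.
  by apply: eq_Rintegral => x _; rewrite /phi -/J; ring.
have thetaJ : \forall x \ae mu, theta x = J (T g x).
  apply: filterS2 (ae_prod_section inv) ((hT g).2 g) => x ix Wx.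
  pose a := c + W g x; pose F3 t := f (T g x, t - a) * h t.
  have -> : J (T g x) = \int[lambda]_t F3 (t + a).
    apply: eq_Rintegral => t _; rewrite /F3 addrK; congr (_ * h _).
    by rewrite /shift_by Wx /a -hdot /c; field.
  have mF3 : measurable_fun setT F3.
    apply: measurable_funM => //.
    apply: (measurableT_comp (measurable_fun_pair2 (T g x) mf)).
    have ms : measurable_fun setT (fun t : R => t - a) by exact: measurable_funB.
    by move=> mD A mA; exact: (ms mD A mA).
  have F3i : lambda.-integrable setT (EFin \o F3).
    apply: (@dominated_lebesgue_integrable _ _ (fun t => M * `|h t|)) => //.
      by move=> t; rewrite normrM ler_wpM2r.
    exact: (RintegrableZ M (integrable_norm hi)).
  have [_ ->] := Rintegral_shift a F3i.
  apply: ae_eq_Rintegral => //.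
    by apply: measurable_funM => //; exact: (measurable_fun_pair2 x mf).
  apply: filterS ix => t /=; rewrite /F3 /a /c => <-; congr (f (_, _) * _); ring.
have E : \forall x \ae mu, phi (T g x) = expR (dot z g) * (expR (W z x) * theta x).
  apply: filterS2 thetaJ ((hT g).2 z) => x -> e.
  by rewrite /phi e expRD (dotC dot g z); ring.
have mt : measurable_fun setT theta by rewrite thetaE; exact: measurable_smear.
have ti : integr (fun x => expR (W z x) * theta x).
  apply: (dominated_Rintegrable _ _ (RintegrableZ (M * I) (integrable_expW hW z))).
    exact: measurable_funM.
  move=> x; rewrite normrM (ger0_norm (expR_ge0 _)) mulrC ler_wpM2r ?expR_ge0//.
  by rewrite thetaE smear_le.
rewrite -(RintegralZl _ measurableT ti) -e12; apply: ae_eq_Rintegral.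
- by apply: measurable_funM => //; exact: measurable_funM.
- exact: (measurableT_comp mphi).
- by apply: filterS E => x ->.
Qed.

Lemma maharam_kernel_fubini g z : `|g| != 0 ->
  let G t := \int[mu]_x (f (x, t) * expR (W z x) * maharam_kernel W h g t x) in
  (forall t, integr (fun x => f (x, t) * expR (W z x) * maharam_kernel W h g t x)) /\
  lambda.-integrable setT (EFin \o G) /\
  \int[mu]_x (smear (shift_by g) x * (expR (W z x) * expR (W g x - `|g| ^+ 2 / 2))) =
  \int[lambda]_t G t.
Proof.
move=> g0 G; pose w x := expR (W z x) * expR (W g x - `|g| ^+ 2 / 2).
have E t x : f (x, t) * expR (W z x) * maharam_kernel W h g t x = f (x, t) * h (t + shift_by g x) * w x.
  by rewrite /maharam_kernel /shift_by addrA /w; ring.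
have mw : measurable_fun setT w.
  by apply: measurable_funM; apply: measurableT_comp => //; exact: measurable_funB.
have wi : integr w.
  have [|x|_ + _] := cameron_martin hdot hW hT g (phi := fun x => expR (W z x)) (y := z) (K := 1).
  - exact: measurableT_comp.
  - by rewrite ger0_norm ?expR_ge0// mul1r lerDr.
  - exact.
have F2 t : integr (fun x => f (x, t) * expR (W z x) * maharam_kernel W h g t x).
  have [k1 _] := expW_maharam_kernel hdot hW hT z t mh hB g0.
  apply: (dominated_Rintegrable _ _ (RintegrableZ M (integrable_norm k1))).
    apply: measurable_funM; last exact: measurable_maharam_kernel.
    apply: measurable_funM; first exact: (measurable_fun_pair1 t mf).
    exact: measurableT_comp.
  by move=> x /=; rewrite -mulrA normrM ler_wpM2r.
have F2' t : integr (fun x => f (x, t) * h (t + shift_by g x) * w x).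
  by under eq_fun do rewrite -E; exact: F2.
have [i2 e2] := @smear_fubini _ (measurable_shift_by g) w mw (integrable_norm wi) F2'.
have GE : G = (fun t => \int[mu]_x (f (x, t) * h (t + shift_by g x) * w x)).
  by apply/funext => t; apply: eq_Rintegral => x _; rewrite E.
by split => //; rewrite GE.
Qed.

Section sequence.
Variables (s : R) (u : nat -> H) (z : H).
Hypotheses (s0 : 0 < s) (su : forall n, s <= `|u n|) (u0 : weak_limit dot u 0).

Let un0 n : `|u n| != 0. Proof. by rewrite gt_eqF// (lt_le_trans s0). Qed.

Let phi t x := f (x, t) * expR (W z x).

Let measurable_phi t : measurable_fun setT (phi t).
Proof.
by apply: measurable_funM; [exact: (measurable_fun_pair1 t mf)|exact: measurableT_comp].
Qed.

Let phi_le t x : `|phi t x| <= M * expR (W z x).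
Proof. by rewrite normrM (ger0_norm (expR_ge0 _)) ler_wpM2r ?expR_ge0. Qed.

Let phi_integrable t : integr (phi t).
Proof. exact: dominated_Rintegrable (phi_le t) (RintegrableZ M (integrable_expW hW z)). Qed.

Let Q n t := \int[lambda]_x (h x * normal_pdf (t + `|u n| ^+ 2 / 2) `|u n| x).

Let V := M * expR (`|z| ^+ 2 / 2).

Let phi_mean_le t : \int[mu]_x `|phi t x| <= V.
Proof.
apply: (@le_trans _ _ (\int[mu]_x (M * expR (W z x)))).
  apply: le_Rintegral => //.
  - exact: integrable_norm (phi_integrable t).
  - exact: RintegrableZ (integrable_expW hW z).
by rewrite (RintegralZl _ measurableT (integrable_expW hW z)) (Rintegral_expW hW).
Qed.

Let phiQ_le n t : `|\int[mu]_x (phi t x * Q n t)| <= V * `|Q n t|.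
Proof.
rewrite (RintegralZr _ measurableT (phi_integrable t)) normrM ler_wpM2r//.
exact: le_trans (le_normr_Rintegral measurableT (phi_integrable t)) (phi_mean_le t).
Qed.

Let phiQ_integrable n : lambda.-integrable setT (EFin \o Q n) ->
  lambda.-integrable setT (EFin \o (fun t => \int[mu]_x (phi t x * Q n t))).
Proof.
move=> Qi; have mQ := Rintegrable_measurable Qi.
pose F (p : X * Y) := phi p.2 p.1 * Q n p.2.
have mF : measurable_fun setT F.
  apply: measurable_funM; last first.
    have mQR : @measurable_fun _ _ R R setT (Q n) by move=> mD A mA; exact: (mQ mD A mA).
    exact: (measurableT_comp mQR (@measurable_snd_R R _ X)).
  have -> : (fun p : X * Y => phi p.2 p.1) = (fun p => f p * expR (W z p.1)).
    by apply/funext => -[].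
  apply: measurable_funM => //; apply: measurableT_comp => //.
  by apply: measurableT_comp => //; exact: measurable_fst.
have F2 t : integr (fun x => F (x, t)).
  have := RintegrableZ (Q n t) (phi_integrable t).
  by congr (_.-integrable _ _); apply/funext => x /=; rewrite mulrC.
have F1d x : lambda.-integrable setT (EFin \o (fun t => (M * expR (W z x)) * `|Q n t|)).
  exact: (RintegrableZ (M * expR (W z x)) (integrable_norm Qi)).
have F1l x t : `|F (x, t)| <= (M * expR (W z x)) * `|Q n t|.
  by rewrite normrM ler_wpM2r// phi_le.
have F1 x : lambda.-integrable setT (EFin \o (fun t => F (x, t))).
  exact: (@dominated_lebesgue_integrable _ _ _ (measurable_fun_pair2 x mF) (F1l x) (F1d x)).
have Fi : (mu \x lambda)%E.-integrable setT (EFin \o F).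
  apply: (@Rintegrable_prod _ _ _ _ _ mu lambda F
    (fun x => (M * \int[lambda]_t `|Q n t|) * expR (W z x)) mF F1).
  - move=> x; have i := integrable_norm (F1 x).
    apply: (le_trans (@le_Rintegral _ Y R lambda setT _ _ measurableT i (F1d x) (fun t _ => F1l x t))).
    by rewrite (RintegralZl _ measurableT (integrable_norm Qi)) mulrAC.
  - exact: RintegrableZ (integrable_expW hW z).
by have [_] := RFubini Fi F1 F2.
Qed.

Let D n t := \int[mu]_x (phi t x * (maharam_kernel W h (u n) t x - Q n t)).

Let DE n t : D n t = \int[mu]_x (phi t x * maharam_kernel W h (u n) t x) -
  \int[mu]_x (phi t x * Q n t).
Proof.
have [k1 _] := maharam_kernel_fubini z (un0 n).
rewrite -RintegralB//; first by apply: eq_Rintegral => x _; rewrite mulrBr.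
  exact: k1.
have := RintegrableZ (Q n t) (phi_integrable t).
by congr (_.-integrable _ _); apply/funext => x /=; rewrite mulrC.
Qed.

(** The pointwise bound on the kernel explodes as [t] tends to minus infinity. A majorant integrable
    in [t] comes instead from the exact mean of the kernel against [exp(W z)], a Gaussian integral
    whose deviation lies in [[s, S]] and whose centre is displaced from [t] by a bounded amount. *)
Let D_decay : exists2 g : R -> R, lambda.-integrable setT (EFin \o g) &
  forall n t, `|D n t| <= g t.
Proof.
have [S uS] := weak_limit_bounded hdot u0.
have Sp : 0 < S := lt_le_trans s0 (le_trans (su 0%N) (uS 0%N)).
pose b1 := `|z| * S; have b1p : 0 <= b1 by rewrite mulr_ge0// ltW.
have b1le n : `|dot z (u n)| <= b1.
  by apply: (le_trans (norm_dot_le hdot _ _)); rewrite ler_wpM2l.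
pose b2 := S ^+ 2 / 2 + b1.
have b2p : 0 <= b2 by rewrite addr_ge0// divr_ge0// sqr_ge0.
have cle n : 0 <= `|u n| ^+ 2 / 2 <= S ^+ 2 / 2.
  apply/andP; split; first by rewrite divr_ge0// sqr_ge0.
  by rewrite ler_pM2r ?invr_gt0// ler_sqr ?nnegrE// ltW.
have [K K0 hK] := bounded_support_pdf_decay mh hB hN S s0 b2p.
pose A := M * expR (`|z| ^+ 2 / 2 + b1).
have A0 : 0 <= A by rewrite mulr_ge0 ?expR_ge0.
have V0 : 0 <= V by rewrite mulr_ge0 ?expR_ge0.
exists (fun t => (A * K + V * K) * normal_pdf 0 (2 * S) t).
  exact: (RintegrableZ (A * K + V * K) (integrable_normal_pdf 0 (2 * S))).
(* The absolute value of the kernel of [h] is the kernel of [|h|], to which the exact formula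
   applies as well. *)
have mhn : measurable_fun setT (fun x => `|h x|) by exact: measurableT_comp.
have hBn x : `| `|h x| | <= B by rewrite normr_id.
move=> n t; have /andP[c0 cS] := cle n.
have sS : s <= `|u n| <= S by rewrite su uS.
rewrite DE mulrDl; apply: (le_trans (ler_normB _ _)); apply: lerD.
- have [k1 _] := maharam_kernel_fubini z (un0 n).
  apply: (le_trans (le_normr_Rintegral measurableT (k1 t))).
  have [j1 j2] := expW_maharam_kernel hdot hW hT z t mhn hBn (un0 n).
  have kE x : maharam_kernel W (fun x => `|h x|) (u n) t x = `|maharam_kernel W h (u n) t x|.
    by rewrite /maharam_kernel normrM (ger0_norm (expR_ge0 _)).
  apply: (@le_trans _ _ (\int[mu]_x (M * (expR (W z x) * maharam_kernel W (fun x => `|h x|) (u n) t x)))).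
    apply: le_Rintegral => //.
    + exact: integrable_norm (k1 t).
    + exact: RintegrableZ j1.
    + by move=> x _; rewrite kE mulrA normrM ler_wpM2r// phi_le.
  rewrite (RintegralZl _ measurableT j1) j2.
  have -> : A * K * normal_pdf 0 (2 * S) t =
    M * (expR (`|z| ^+ 2 / 2 + b1) * (K * normal_pdf 0 (2 * S) t)) by rewrite /A -!mulrA.
  rewrite ler_wpM2l//; apply: ler_pM.
  + exact: expR_ge0.
  + by apply: Rintegral_ge0 => x _; rewrite mulr_ge0 ?normal_pdf_ge0.
  + by rewrite ler_expR lerD2l (le_trans (ler_norm _)).
  + rewrite -addrA; apply: hK => //; apply: (le_trans (ler_normD _ _)); rewrite (ger0_norm c0).
    exact: lerD.
- apply: (le_trans (phiQ_le n t)); rewrite -mulrA ler_wpM2l//.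
  have i := bounded_support_pdf_integrable mh hB (t + `|u n| ^+ 2 / 2) `|u n|.
  apply: (le_trans (le_normr_Rintegral measurableT i)).
  have -> : \int[lambda]_x `|h x * normal_pdf (t + `|u n| ^+ 2 / 2) `|u n| x| =
      \int[lambda]_x (`|h x| * normal_pdf (t + `|u n| ^+ 2 / 2) `|u n| x).
    by apply: eq_Rintegral => x _; rewrite normrM (ger0_norm (normal_pdf_ge0 _ _ _)).
  by apply: hK => //; rewrite ger0_norm// (le_trans cS)// lerDl.
Qed.

(** For each [n], [exp(dot z (u n))] times the integral on the left, less the error [int D n], is an
    integral controlled by the [L^1] norm of [Q n]. The exponential tends to 1 and the error to 0,
    so the bound passes to the limit although [Q n] itself may have none. *)
Lemma maharam_sequence_le e :
  (forall n, \forall p \ae (mu \x lambda)%E,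
    f (T (u n) p.1, p.2 - `|u n| ^+ 2 / 2 - W (u n) p.1) = f p) ->
  (forall n, lambda.-integrable setT (EFin \o Q n) /\ \int[lambda]_t `|Q n t| <= e) ->
  `|\int[mu]_x (expR (W z x) * theta x)| <= V * e.
Proof.
move=> inv hQ; set L := \int[mu]_x _.
have V0 : 0 <= V by rewrite mulr_ge0 ?expR_ge0.
have Gi n := (maharam_kernel_fubini z (un0 n)).2.1.
have Ui n := phiQ_integrable (hQ n).1.
have Di n : lambda.-integrable setT (EFin \o D n).
  have := RintegrableB (Gi n) (Ui n); congr (_.-integrable _ _).
  by apply/funext => t /=; rewrite DE.
have D0 t : D n t @[n --> \oo] --> (0 : R).
  apply: (maharam_kernel_weak_cvg hdot hW hT mh hB hN t s0 su u0 (y := z) (K := M)) => //.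
  by move=> x; apply: (le_trans (phi_le t x)); rewrite ler_wpM2l// lerDr.
have [g gi Dg] := D_decay.
have [_ _] := @dominated_cvg_Rintegral _ Y R lambda D (fun=> 0) g
  (fun n => Rintegrable_measurable (Di n)) gi Dg D0.
have -> : \int[lambda]_t (0 : R) = 0 by rewrite Rintegral_cst// mul0r.
move=> ID0.
have E n : expR (dot z (u n)) * L - \int[lambda]_t D n t =
    \int[lambda]_t \int[mu]_x (phi t x * Q n t).
  rewrite (maharam_section_integral z (inv n)) (maharam_kernel_fubini z (un0 n)).2.2.
  rewrite -(RintegralB measurableT (Gi n) (Di n)).
  by apply: eq_Rintegral => t _; rewrite DE opprB addrCA subrr addr0.
have le n : `|expR (dot z (u n)) * L - \int[lambda]_t D n t| <= V * e.
  rewrite E; apply: (le_trans (le_normr_Rintegral measurableT (Ui n))).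
  have i := RintegrableZ V (integrable_norm (hQ n).1).
  apply: (le_trans (@le_Rintegral _ Y R lambda setT _ _ measurableT (integrable_norm (Ui n)) i (fun t _ => phiQ_le n t))).
  by rewrite (RintegralZl _ measurableT (integrable_norm (hQ n).1)) ler_wpM2l// (hQ n).2.
have b0 : expR (dot z (u n)) @[n --> \oo] --> (1 : R).
  have bz : dot z (u n) @[n --> \oo] --> (0 : R).
    have := @u0 z; rewrite dot0l; apply: cvg_trans; apply: near_eq_cvg; apply: nearW => n.
    by rewrite (dotC dot).
  by have := cvg_comp _ _ bz (@continuous_expR R 0); rewrite expR0.
have lim : `|expR (dot z (u n)) * L - \int[lambda]_t D n t| @[n --> \oo] --> `|L|.
  apply: cvg_norm; rewrite -[X in _ --> X]subr0; apply: cvgB => //.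
  by rewrite -[X in _ --> X]mul1r; apply: cvgM => //; exact: cvg_cst.
rewrite -(cvg_lim _ lim)//; apply: limr_le; first by apply/cvg_ex; exists `|L|.
exact: nearW.
Qed.

End sequence.

(** It suffices to pair with each exponential. The width [s] is extracted from the tolerance first,
    and only then is a sequence of [G] with norms above [s] requested. *)
Lemma maharam_invariant_orthogonal (G : {pred H}) : 0 < N -> \int[lambda]_t h t = 0 ->
  (forall s, exists u : nat -> H,
    [/\ forall n, u n \in G, weak_limit dot u 0 & forall n, s <= `|u n|]) ->
  (forall g, g \in G -> \forall p \ae (mu \x lambda)%E,
    f (T g p.1, p.2 - `|g| ^+ 2 / 2 - W g p.1) = f p) ->
  \forall x \ae mu, \int[lambda]_t (f (x, t) * h t) = 0.
Proof.
move=> N0 h0 far inv; apply: (W_separating hW (M := M * I)).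
- by rewrite -/theta thetaE; exact: measurable_smear.
- by move=> x; rewrite -/(theta x) thetaE; exact: smear_le.
move=> z; apply/eqP; rewrite -normr_le0; apply/ler_addgt0Pr => e e0; rewrite add0r.
set V := M * expR (`|z| ^+ 2 / 2); have V0 : 0 <= V by rewrite mulr_ge0 ?expR_ge0.
have e1 : 0 < e / (V + 1) by rewrite divr_gt0// ltr_wpDl.
have [s s0 hs] := spread_L1_small mh hB hN N0 h0 e1.
have [u [uG u0 su]] := far s.
apply: (@le_trans _ _ (V * (e / (V + 1)))); last first.
  by rewrite mulrCA -[leRHS]mulr1 ler_wpM2l ?ltW// ltr_pdivrMr ?mul1r ?ltrDl// ltr_wpDl.
apply: (maharam_sequence_le z s0 su u0) => n; first exact: inv.
exact: hs.
Qed.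

End maharam_invariant.

(** * Ergodicity *)

(* The sets over which [F] integrates to [0] form a Dynkin system that contains the rectangles. *)
Lemma prod_ae_eq0 d1 d2 (T1 : measurableType d1) (T2 : measurableType d2) (R : realType)
    (m1 : {sigma_finite_measure set T1 -> \bar R})
    (m2 : {sigma_finite_measure set T2 -> \bar R}) (F : T1 * T2 -> R) :
  (m1 \x m2)%E.-integrable setT (EFin \o F) ->
  (forall B, measurable B ->
     \forall x \ae m1, (\int[m2]_(y in B) (F (x, y))%:E = 0)%E) ->
  \forall p \ae (m1 \x m2)%E, F p = 0.
Proof.
move=> Fi F0; set m := (m1 \x m2)%E in Fi *.
have mF : measurable_fun setT (EFin \o F) := measurable_int _ Fi.
have mFS S : measurable_fun S (EFin \o F) by exact: measurable_funTS.
have FiS S : measurable S -> m.-integrable S (EFin \o F).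
  by move=> mS; exact: (integrableS measurableT mS (@subsetT _ _) Fi).
have rectangle A B : measurable A -> measurable B ->
    (\int[m]_(p in A `*` B) (F p)%:E = 0)%E.
  move=> mA mB; have mAB : measurable (A `*` B) by exact: measurableX.
  have Gi : m.-integrable setT ((EFin \o F) \_ (A `*` B)).
    exact: (iffLR (integrable_mkcond _ mAB) (FiS _ mAB)).
  rewrite integral_mkcond -(integral12_prod_meas1 Gi).
  have mG := measurable_int _ (integrable_fubini_F Gi).
  rewrite -(@integral0 _ T1 R m1 setT); apply: ae_eq_integral => //.
  apply: filterS (F0 B mB) => x Bx _; rewrite /fubini_F.
  have [xA|xA] := boolP (x \in A).
    rewrite -[RHS]Bx [RHS]integral_mkcond; apply: eq_integral => y _.
    by rewrite !patchE in_setX xA.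
  by apply: integral0_eq => y _; rewrite patchE in_setX (negbTE xA).
have all0 S : measurable S -> (\int[m]_(p in S) (F p)%:E = 0)%E.
  pose Rect := [set A `*` B | A in d1.-measurable & B in d2.-measurable] : set (set (T1 * T2)).
  rewrite measurable_prod_measurableType.
  apply: (@dynkin_induction _ (T1 * T2)%type Rect (fun S => (\int[m]_(p in S) (F p)%:E = 0)%E)).
  - exact: measurable_prod_measurableType.
  - move=> _ _ [A1 mA1 [B1 mB1 <-]] [A2 mA2 [B2 mB2 <-]].
    exists (A1 `&` A2); first exact: measurableI.
    by exists (B1 `&` B2); [exact: measurableI|rewrite setXI].
  - by rewrite -setXTT; exact: rectangle.
  - by move=> _ [A mA [B mB <-]]; exact: rectangle.
  - move=> S' mS' S0; have : (\int[m]_(p in S' `|` ~` S') (F p)%:E = 0)%E.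
      by rewrite setUv -setXTT; exact: rectangle.
    rewrite integral_setU ?S0 ?add0e//; first exact: measurableC.
    by rewrite disj_set2E setICr eqxx.
  - move=> S' mS' tS' S0; rewrite integral_bigcup//; last by apply: FiS; exact: bigcup_measurable.
    by rewrite eseries0.
have := @integral_ae_eq _ _ _ m setT measurableT (cst 0%E) (EFin \o F) Fi (measurable_cst _).
move=> H; have {}H : ae_eq m setT (EFin \o F) (cst 0%E).
  by apply: H => S _ mS; rewrite integral0; exact: all0.
by apply: filterS H => p /(_ I)[].
Qed.

Lemma ae_prod_fst d1 d2 (T1 : measurableType d1) (T2 : measurableType d2) (R : realType)
    (m1 : {sigma_finite_measure set T1 -> \bar R})
    (m2 : {sigma_finite_measure set T2 -> \bar R}) (P : T1 -> Prop) :
  (\forall x \ae m1, P x) -> \forall p \ae (m1 \x m2)%E, P p.1.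
Proof.
move=> [N [mN N0 NP]]; exists (N `*` setT); split; first exact: measurableX.
  by transitivity (m1 N * m2 setT)%E; [exact: product_measure1E|rewrite N0 mul0e].
by move=> p /= Pp; split => //; apply: NP.
Qed.

Section translation_invariance.
Context (R : realType) (H : completeNormedModType R)
  (dot : {dot H for idfun}) (hdot : hilbert_norm dot)
  (d : measure_display) (X : measurableType d) (mu : probability X R)
  (W : H -> {mfun X >-> R}) (hW : gaussian_construction mu W).
Local Notation integr f := (mu.-integrable setT (EFin \o f)).

(* Weak density turns invariance of [\int f] under the densities of [G] into the same
   identity for all of [H], so that [f - \int f] is orthogonal to all exponentials. *)
Lemma density_invariant_cst (G : {pred H}) (f : X -> R) (M : R) :
  seq_weakly_dense dot G -> measurable_fun setT f -> (forall x, `|f x| <= M) ->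
  (forall g, g \in G ->
     \int[mu]_x (f x * expR (W g x - `|g| ^+ 2 / 2)) = \int[mu]_x f x) ->
  \forall x \ae mu, f x = \int[mu]_y f y.
Proof.
move=> hG mf fM inv; set a := \int[mu]_x f x.
have M0 : 0 <= M := le_trans (normr_ge0 _) (fM point).
pose k (g : H) x := expR (W g x - `|g| ^+ 2 / 2).
have mk g : measurable_fun setT (k g) by apply: measurableT_comp => //; exact: measurable_funB.
(* The [L^2] norm of the density depends only on [|g|], so a norm-bounded sequence of [G] gives the
   bounded family that [W_weak_cvg] needs. *)
have ksq g : integr (fun x => k g x ^+ 2) /\ \int[mu]_x (k g x ^+ 2) = expR (`|g| ^+ 2).
  have [i e] := gaussian_mgf hW 2 g.
  have E : (fun x => k g x ^+ 2) = (fun x => expR (- `|g| ^+ 2) * expR (2 * W g x)).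
    by apply/funext => x; rewrite /k -expRM_natl -expRD; congr expR; field.
  rewrite E; split; first exact: RintegrableZ.
  by rewrite (RintegralZl _ measurableT i) e -expRD; congr expR; field.
have kexp z g : \int[mu]_x (expR (W z x) * k g x) = expR (`|z| ^+ 2 / 2 + dot z g).
  have E : \forall x \ae mu, expR (W z x) * k g x = expR (- (`|g| ^+ 2 / 2)) * expR (W (z + g) x).
    by apply: filterS (WD hW z g) => x ->; rewrite /k -!expRD; congr expR; ring.
  have mW z' : measurable_fun setT (fun x => expR (W z' x)) by exact: measurableT_comp.
  rewrite (ae_eq_Rintegral _ _ E).
  - rewrite (RintegralZl _ measurableT (integrable_expW hW (z + g))) (Rintegral_expW hW) -expRD.
    by congr expR; rewrite (sqr_normD hdot); field.
  - by apply: measurable_funM.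
  - by apply: measurable_funM.
have fk z : \int[mu]_x (f x * k z x) = a.
  have [u uG uz] := hG z; have [S uS] := weak_limit_bounded hdot uz.
  have fB x : `|f x| <= M * (1 + expR (W 0 x)).
    by apply: (le_trans (fM x)); rewrite ler_peMr// lerDl expR_ge0.
  have cv : \int[mu]_x (f x * k (u n) x) @[n --> \oo] --> \int[mu]_x (f x * k z x).
    apply: (@W_weak_cvg _ _ _ _ _ _ hW (fun n => k (u n)) (k z) (expR (S ^+ 2)) _ _ _ _ _ _ f 0 M) => //.
    - by move=> n; exact: (ksq _).1.
    - exact: (ksq _).1.
    - move=> n; rewrite (ksq _).2 ler_expR.
      have S0 : 0 <= S := le_trans (normr_ge0 _) (uS n).
      by rewrite ler_sqr ?nnegrE.
    - move=> y; rewrite kexp; have -> : (fun n => \int[mu]_x (expR (W y x) * k (u n) x)) =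
          (fun n => expR (`|y| ^+ 2 / 2 + dot y (u n))) by apply/funext => n; rewrite kexp.
      apply: continuous_cvg; first exact: continuous_expR.
      apply: cvgD; first exact: cvg_cst.
      have := @uz y; rewrite (dotC dot y z); apply: cvg_trans.
      by apply: near_eq_cvg; apply: nearW => n; rewrite (dotC dot).
  have E : (fun n => \int[mu]_x (f x * k (u n) x)) = fun=> a.
    by apply/funext => n; exact: inv.
  by move: cv; rewrite E => cv; rewrite -(cvg_lim (@Rhausdorff R) cv) lim_cst.
have tM x : `|f x - a| <= M + `|a| by apply: (le_trans (ler_normB _ _)); rewrite lerD2r.
have mt : measurable_fun setT (fun x => f x - a) by exact: measurable_funB.
have fW z : integr (fun x => f x * expR (W z x)).
  apply: (dominated_Rintegrable _ _ (RintegrableZ M (integrable_expW hW z))).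
    by apply: measurable_funM => //; exact: measurableT_comp.
  by move=> x; rewrite normrM (ger0_norm (expR_ge0 _)) ler_wpM2r ?expR_ge0.
have := @W_separating _ _ _ _ _ _ hW (fun x => f x - a) _ mt tM.
move=> sep; have {}sep : \forall x \ae mu, f x - a = 0.
  apply: sep => z; have iz := RintegrableZ a (integrable_expW hW z).
  transitivity (\int[mu]_x (f x * expR (W z x) - a * expR (W z x))).
    by apply: eq_Rintegral => x _; ring.
  rewrite (RintegralB measurableT (fW z) iz) (RintegralZl _ measurableT (integrable_expW hW z)).
  rewrite (Rintegral_expW hW).
  have -> : \int[mu]_x (f x * expR (W z x)) = expR (`|z| ^+ 2 / 2) * a.
    have i : integr (fun x => f x * k z x).
      have := RintegrableZ (expR (- (`|z| ^+ 2 / 2))) (fW z); congr (_.-integrable _ _).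
      by apply/funext => x /=; rewrite mulrCA -expRD addrC.
    rewrite -(fk z) -(RintegralZl _ measurableT i).
    by apply: eq_Rintegral => x _; rewrite mulrCA /k -expRD addrCA subrr addr0.
  by rewrite mulrC subrr.
by apply: filterS sep => x /eqP; rewrite subr_eq0 => /eqP.
Qed.

End translation_invariance.

Section maharam_ergodic.
Context (R : realType) (H : completeNormedModType R)
  (dot : {dot H for idfun}) (hdot : hilbert_norm dot)
  (hsep : separable_space H) (hinf : infinite_dimensional H)
  (G : zmodClosed H) (hG : seq_weakly_dense dot G)
  (d : measure_display) (X : measurableType d) (mu : probability X R)
  (W : H -> {mfun X >-> R}) (hW : gaussian_construction mu W)
  (T : H -> {mfun X >-> X}) (hT : gaussian_translation dot mu W T).
Local Notation integr f := (mu.-integrable setT (EFin \o f)).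
Local Notation lambda := (@lebesgue_measure R).
Local Notation Y := (measurableTypeR R).
Variables (f : X * Y -> R) (M : R).
Hypotheses (mf : measurable_fun setT f) (fM : forall p, `|f p| <= M).
Hypothesis inv : forall g, g \in G -> \forall p \ae (mu \x lambda)%E,
  f (T g p.1, p.2 - `|g| ^+ 2 / 2 - W g p.1) = f p.

Let M0 : 0 <= M. Proof. exact: le_trans (normr_ge0 _) (fM (point, 0)). Qed.

Let mfY x : measurable_fun setT (fun t : R => f (x, t)).
Proof. by move=> mD A mA; exact: (measurable_fun_pair2 x mf mD mA). Qed.

Let one (D : set R) : R -> R := \1_D.

Let one01 (D : set R) t : `|one D t| <= 1.
Proof. by rewrite /one indicE; case: (t \in D); rewrite ?normr1 ?normr0. Qed.

Let one_off (D : set R) n t : D `<=` `[(- n)%R, n] -> n < `|t| -> one D t = 0.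
Proof.
move=> Dn nt; rewrite /one indicE memNset// => /Dn /=.
by rewrite in_itv /= -ler_norml leNgt nt.
Qed.

Let one_integral (D : set R) n : measurable D -> D `<=` `[(- n)%R, n] ->
  [/\ measurable_fun setT (one D), lambda.-integrable setT (EFin \o one D) &
    (lambda D = (\int[lambda]_t one D t)%:E)%E].
Proof.
move=> mD Dn; have m1 : measurable_fun setT (one D) by exact: measurable_indic.
have i := bounded_support_integrable m1 (one01 D) (fun t => @one_off D n t Dn).
split => //; rewrite /Rintegral (fineK (integrable_fin_num measurableT i)).
have := @integral_indic _ Y R lambda setT measurableT D mD.
by rewrite setIT => <-.
Qed.

Let J : set R := `[0%R, 1%R]%classic.

Let J1 : J `<=` `[(- 1)%R, 1%R].
Proof. by move=> t; rewrite /J /= !in_itv /= => /andP[t0 ->]; rewrite andbT; lra. Qed.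

Let mJ : measurable J. Proof. exact: measurable_itv. Qed.

Let integral_J : \int[lambda]_t one J t = 1.
Proof.
have [_ _ e] := one_integral mJ J1; apply/EFin_inj; rewrite -e lebesgue_measure_itv /=.
by rewrite lte_fin ltr01 -EFinB subr0.
Qed.

(** The mean over a height interval of length 1, the candidate for [f] as a function of [x]
    alone. *)
Let f0 x := \int[lambda]_t (f (x, t) * one J t).

Let f0E : f0 = smear (one J) f (fun=> 0).
Proof. by apply/funext => x; apply: eq_Rintegral => t _; rewrite addr0. Qed.

Let mf0 : measurable_fun setT f0.
Proof.
have [m1 _ _] := one_integral mJ J1; rewrite f0E.
exact: (measurable_smear mu m1 (one01 J) (fun t => @one_off J 1 t J1) mf fM).
Qed.

Let f0M x : `|f0 x| <= M.
Proof.
have [m1 _ _] := one_integral mJ J1.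
have := smear_le m1 (one01 J) (fun t => @one_off J 1 t J1) mf fM (fun=> 0) x.
rewrite -f0E; have -> : \int[lambda]_t `|one J t| = 1; last by rewrite mulr1.
rewrite -integral_J; apply: eq_Rintegral => t _; rewrite ger0_norm//.
Qed.

Let section_integral (D : set R) n : measurable D -> D `<=` `[(- n)%R, n] ->
  forall x, lambda.-integrable setT (EFin \o (fun t => f (x, t) * one D t)).
Proof.
move=> mD Dn x; have [m1 i _] := one_integral mD Dn.
apply: (@bounded_support_integrable _ _ M n).
- exact: measurable_funM.
- by move=> t; rewrite normrM -[leRHS]mulr1 ler_pM.
- by move=> t nt; rewrite (one_off Dn nt) mulr0.
Qed.

(** The function [1_D - |D| 1_J] has integral 0, so the orthogonality result applies to it. The null
    set depends on [D]. The radius [n + 1] contains [J] as well and is positive even for [n = 0]. *)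
Let section_orthogonal (D : set R) n : 0 <= n -> measurable D -> D `<=` `[(- n)%R, n] ->
  \forall x \ae mu,
    \int[lambda]_t (f (x, t) * one D t) = f0 x * \int[lambda]_t one D t.
Proof.
move=> n0 mD Dn; have [m1 i1 _] := one_integral mD Dn; have [mj ij _] := one_integral mJ J1.
set a := \int[lambda]_t one D t; pose h t := one D t - a * one J t.
have mh : measurable_fun setT h by apply: measurable_funB => //; exact: measurable_funM.
have hB t : `|h t| <= 1 + `|a|.
  apply: (le_trans (ler_normB _ _)); apply: lerD => //.
  by rewrite normrM -[leRHS]mulr1 ler_pM.
have hN t : n + 1 < `|t| -> h t = 0.
  move=> nt; rewrite /h (one_off Dn) ?(one_off J1) ?mulr0 ?subrr//; lra.
have h0 : \int[lambda]_t h t = 0.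
  rewrite (RintegralB measurableT i1 (RintegrableZ a ij)) (RintegralZl _ measurableT ij).
  by rewrite integral_J mulr1 subrr.
have n1 : 0 < n + 1 by rewrite ltr_wpDl.
have := maharam_invariant_orthogonal hdot hW hT mh hB hN mf fM n1 h0
  (weakly_null_far hdot hsep hinf hG) inv.
apply: filterS => x /eqP; have Di := section_integral mD Dn x.
have Ji := section_integral mJ J1 x.
have -> : \int[lambda]_t (f (x, t) * h t) =
    \int[lambda]_t (f (x, t) * one D t - a * (f (x, t) * one J t)).
  by apply: eq_Rintegral => t _; rewrite /h; ring.
rewrite (RintegralB measurableT Di (RintegrableZ a Ji)) (RintegralZl _ measurableT Ji).
by rewrite subr_eq0 => /eqP ->; rewrite mulrC.
Qed.

(** Heights are cut to [[- n, n]] because [f - f0] need not be integrable against the infinite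
    measure. Over each [B] the section integrals vanish for almost every [x], which is what
    [prod_ae_eq0] accepts, without a null set common to all [B]. *)
Let fst_ae : \forall p \ae (mu \x lambda)%E, f p = f0 p.1.
Proof.
suff : \forall p \ae (mu \x lambda)%E, forall n : nat,
    (f p - f0 p.1) * one `[(- n%:R)%R, n%:R] p.2 = 0.
  apply: filterS => -[x t] /= fn; have tn := archi_boundP (normr_ge0 t).
  have := fn (Num.bound `|t|); rewrite /one indicE mem_set ?mulr1; first by move/eqP; rewrite subr_eq0 => /eqP.
  by rewrite /= in_itv /= -ler_norml ltW.
apply: ae_foralln => n; set K : set R := `[(- n%:R)%R, n%:R]%classic.
have mK : measurable K by exact: measurable_itv.
have [m1 i1 _] := one_integral mK (@subset_refl _ K).
pose F (p : X * Y) := (f p - f0 p.1) * one K p.2.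
have mF : measurable_fun setT F.
  apply: measurable_funM; last exact: (measurableT_comp m1 (@measurable_snd_R R _ X)).
  by apply: measurable_funB => //; exact: measurableT_comp.
have FM p : `|F p| <= 2 * M * one K p.2.
  rewrite normrM (ger0_norm (_ : 0 <= one K p.2)); last by rewrite /one indicE; case: (_ \in _).
  rewrite ler_wpM2r//.
  by apply: (le_trans (ler_normB _ _)); have := fM p; have := f0M p.1; lra.
have sF x : lambda.-integrable setT (EFin \o (fun t => F (x, t))).
  apply: (@dominated_lebesgue_integrable _ _ (fun t => 2 * M * one K t)).
  - by move=> mD A mA; exact: (measurable_fun_pair2 x mF mD mA).
  - by move=> t; exact: FM.
  - exact: RintegrableZ.
have Fi : (mu \x lambda)%E.-integrable setT (EFin \o F).
  apply: (@Rintegrable_prod _ _ _ _ _ mu lambda F (fun=> 2 * M * \int[lambda]_t one K t) mF) => //.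
    move=> x; rewrite -(RintegralZl _ measurableT i1).
    have iF := integrable_norm (sF x); have iK := RintegrableZ (2 * M) i1.
    by apply: (@le_Rintegral _ Y R lambda setT _ _ measurableT iF iK) => t _; exact: FM.
  exact: finite_measure_integrable_cst.
apply: (prod_ae_eq0 Fi) => B mB.
have mD : measurable (B `&` K) by exact: measurableI.
have DK : B `&` K `<=` K by exact: subIsetr.
apply: filterS (section_orthogonal (ler0n _ n) mD DK) => x e.
have [m2 i2 _] := one_integral mD DK; have Di := section_integral mD DK x.
have E : \int[lambda]_t (f (x, t) * one (B `&` K) t - f0 x * one (B `&` K) t) = 0.
  by rewrite (RintegralB measurableT Di (RintegrableZ (f0 x) i2)) (RintegralZl _ measurableT i2) e subrr.
have Ei := RintegrableB Di (RintegrableZ (f0 x) i2).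
rewrite integral_mkcond -[RHS]/(0%:E) -E /Rintegral fineK; last exact: (integrable_fin_num measurableT Ei).
apply: eq_integral => t _; rewrite patchE /F /one !indicE in_setI /=.
by case: (t \in B) => /=; rewrite ?mulr0 ?subrr// mulrBl.
Qed.

(** What remains is that the densities of [G] preserve the integral of [f0]. The section formula at
    [z = 0] gives this: [f] being a.e. independent of the height, smearing it with a shifted
    indicator of [[0, 1]] returns [f0] for any random shift. *)
Lemma maharam_invariant_cst : exists c : R, \forall p \ae (mu \x lambda)%E, f p = c.
Proof.
have [m1 i1 _] := one_integral mJ J1.
exists (\int[mu]_x f0 x).
apply: filterS2 fst_ae (ae_prod_fst lambda (density_invariant_cst hdot hW hG mf0 f0M _)).
  by move=> p -> ->.
move=> g gG; have := maharam_section_integral hdot hW hT m1 (one01 J)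
  (fun t => @one_off J 1 t J1) mf fM 0 (inv gG).
rewrite linear0l expR0 mul1r -/f0 => e.
have mW z : measurable_fun setT (fun x => expR (W z x)) by exact: measurableT_comp.
have mk : measurable_fun setT (fun x => expR (W g x - `|g| ^+ 2 / 2)).
  by apply: measurableT_comp => //; exact: measurable_funB.
have mv : measurable_fun setT (fun x => W g x - `|g| ^+ 2 / 2) by exact: measurable_funB.
have ms := measurable_smear mu m1 (one01 J) (fun t => @one_off J 1 t J1) mf fM mv.
transitivity (\int[mu]_x (expR (W 0 x) * f0 x)).
  rewrite e; apply: ae_eq_Rintegral.
  - exact: measurable_funM.
  - by apply: measurable_funM => //; exact: measurable_funM.
  - apply: filterS2 (ae_prod_section fst_ae) (W0 hW) => x fx ->.
    rewrite expR0 mul1r; congr (_ * _); rewrite /smear.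
    have [i2 e2] := Rintegral_shift (W g x - `|g| ^+ 2 / 2) i1.
    transitivity (f0 x * \int[lambda]_t one J (t + (W g x - `|g| ^+ 2 / 2))).
      by rewrite e2 integral_J mulr1.
    rewrite -(RintegralZl _ measurableT i2).
    apply: (@ae_eq_Rintegral _ Y R lambda).
    + by apply: measurable_funM => //; exact: (Rintegrable_measurable i2).
    + apply: measurable_funM; first exact: (measurable_fun_pair2 x mf).
      exact: (Rintegrable_measurable i2).
    + by apply: filterS fx => t /= ->.
apply: ae_eq_Rintegral => //; first exact: measurable_funM.
by apply: filterS (W0 hW) => x ->; rewrite expR0 mul1r.
Qed.

End maharam_ergodic.

(** A bounded version of the form [clip] after [f] inherits every invariance equation of [f] at the
    very points where it holds, which an arbitrary modification would not. *)
Lemma Lfun_infty_bounded_version d (Z : measurableType d) (R : realType)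
    (m : {measure set Z -> \bar R}) (f : Z -> R) : f \in Lfun m +oo%E ->
  exists (clip : R -> R) (M : R), [/\ measurable_fun setT (clip \o f),
    forall x, `|clip (f x)| <= M & \forall x \ae m, clip (f x) = f x].
Proof.
move=> fL; have mf : measurable_fun setT f by exact: (set_mem (sub_Lfun_mfun fL)).
have [M fM] : exists M, \forall x \ae m, `|f x| <= M.
  have := set_mem (sub_Lfun_finLfun fL); rewrite /= /finite_norm unlock /=.
  have [m0|m0] := ltP 0%E (m setT); last first.
    move=> _; exists 0; exists setT; split => //; apply/eqP.
    by rewrite eq_le m0 measure_ge0.
  move=> foo; exists (fine (ess_sup m (abse \o (EFin \o f)))).
  apply: filterS (ess_sup_ge m (abse \o (EFin \o f))) => x /=.
  by move: foo; case: (ess_sup _ _) => [s _|//|_]; rewrite /= ?lee_fin ?leeNy_eq.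
exists (fun t => Num.max (- `|M|) (Num.min `|M| t)), `|M|; split.
- by apply: measurable_maxr => //; apply: measurable_minr.
- move=> x; rewrite ler_norml le_max lexx/= ge_max ge_min lexx/= andbT.
  by have := normr_ge0 M; lra.
- apply: filterS fM => x xM; have := le_trans xM (ler_norm M).
  by rewrite ler_norml => /andP[a b]; rewrite (min_idPr b) (max_idPr a).
Qed.

(** * The cocycle of the Maharam extension *)

Section translation_cocycle.
Context (R : realType) (H : completeNormedModType R)
  (dot : {dot H for idfun}) (hdot : hilbert_norm dot)
  (d : measure_display) (X : measurableType d) (mu : probability X R)
  (W : H -> {mfun X >-> R}) (hW : gaussian_construction mu W)
  (T : H -> {mfun X >-> X}) (hT : gaussian_translation dot mu W T).
Local Notation integr f := (mu.-integrable setT (EFin \o f)).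

(** Cameron-Martin on indicators gives the masses of the translated measure, and these determine the
    derivative up to a null set. *)
Lemma translation_density g : \forall x \ae mu,
  Radon_Nikodym (charge_of_finite_measure (distribution mu (T g))) mu x =
  (expR (W g x - `|g| ^+ 2 / 2))%:E.
Proof.
have dom : charge_of_finite_measure (distribution mu (T g)) `<< mu by exact: (hT g).1.2.1.
pose k x := expR (W g x - `|g| ^+ 2 / 2).
have mk : measurable_fun setT (EFin \o k).
  by apply/measurable_EFinP; apply: measurableT_comp => //; exact: measurable_funB.
have Di := Radon_Nikodym_integrable dom.
suff E : ae_eq mu setT (Radon_Nikodym (charge_of_finite_measure (distribution mu (T g))) mu) (EFin \o k).
  by apply: filterS E => x /(_ I).
apply: (integral_ae_eq measurableT Di mk) => A _ mA.
rewrite -Radon_Nikodym_integral//.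
have m1 : measurable_fun setT (\1_A : X -> R) by exact: measurable_indic.
have b1 x : `|\1_A x| <= 1 * (1 + expR (W 0 x)).
  rewrite mul1r indicE; apply: (@le_trans _ _ 1); last by rewrite lerDl expR_ge0.
  by case: (x \in A); rewrite ?normr1 ?normr0.
have [i1 i2 e] := cameron_martin hdot hW hT g m1 b1.
transitivity ((\int[mu]_x (\1_A (T g x)))%:E)%E.
  rewrite /Rintegral (fineK (integrable_fin_num measurableT i1)).
  have mTA : measurable (T g @^-1` A) by rewrite -[X in measurable X]setTI; exact: measurable_funPT.
  have iA := integral_indic mu measurableT mTA; rewrite setIT in iA.
  transitivity (mu (T g @^-1` A)); [by []|rewrite -iA].
  by apply: eq_integral => x _; rewrite !indicE.
rewrite e /Rintegral (fineK (integrable_fin_num measurableT i2)) [RHS]integral_mkcond.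
apply: eq_integral => x _; rewrite patchE /= indicE.
by case: (x \in A); rewrite ?mul1r ?mul0r.
Qed.

(** The derivative is that of the inverse translate, hence [- g] and the minus sign before [W g].
    Height 0 is enough, since the same amount is added at every height. *)
Lemma maharam_cocycle g : \forall x \ae mu,
  maharam mu T g (x, 0 : measurableTypeR R) = (T g x, - (`|g| ^+ 2 / 2) - W g x).
Proof.
apply: filterS2 (translation_density (- g)) (WZ hW (-1) g) => x Dx.
by rewrite scaleN1r /maharam /= Dx /= => ->; rewrite expRK normrN; congr pair; ring.
Qed.

End translation_cocycle.

Theorem theorem3p1 (R : realType) (H : completeNormedModType R)
  (dot : {dot H for idfun}) (hdot : hilbert_norm dot)
  (hsep : separable_space H) (hinf : infinite_dimensional H)
  (G : zmodClosed H) (hG : seq_weakly_dense dot G)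
  (d : measure_display) (X : measurableType d) (mu : probability X R)
  (W : H -> {mfun X >-> R}) (hW : gaussian_construction mu W)
  (T : H -> {mfun X >-> X}) (hT : gaussian_translation dot mu W T) :
  ergodic mu G (fun eta => T eta) /\ type_III1 mu G T.
Proof.
split=> f fL inv; have [clip [M [mf fM fE]]] := Lfun_infty_bounded_version fL.
  (* For the action itself, Cameron-Martin turns the integral against the density into that of the
     translated function, which invariance makes equal to the integral of [clip] after [f]. *)
  exists (\int[mu]_x clip (f x)).
  apply: filterS2 fE (density_invariant_cst hdot hW hG mf fM _); first by move=> x e; rewrite /= e.
  move=> g gG.
  have fB x : `|clip (f x)| <= M * (1 + expR (W 0 x)).
    have M0 : 0 <= M := le_trans (normr_ge0 _) (fM x).
    by apply: (le_trans (fM x)); rewrite ler_peMr// lerDl expR_ge0.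
  have [i1 i2 <-] := cameron_martin hdot hW hT g mf fB.
  apply: (ae_eq_Rintegral (Rintegrable_measurable i1) mf).
  by apply: filterS (inv g gG) => x /= ->.
(* On the conull set of first coordinates where the cocycle is explicit, invariance under the
   extension is exactly the equation assumed of [f] there, and [clip] passes through it. *)
have [|c cE] := maharam_invariant_cst hdot hsep hinf hG hW hT mf fM.
  move=> g gG; apply: filterS2 (inv g gG) (ae_prod_fst _ (maharam_cocycle hdot hW hT g)).
  move=> [x t] /= e []; rewrite add0r => Dx; rewrite -[in RHS]e /maharam /= Dx.
  by congr (clip (f (_, _))); ring.
by exists c; apply: filterS2 fE cE => p e; rewrite /= e.
Qed.
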